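(* Let $\varphi\in C^0([0,T];L^2(\Omega))$, $\hat{\mathbf f}\in L^2(0,T;\mathbf W^{1,q}_{\Gamma_D}(\Omega))$ and $\mathbf u_0\in\mathbf W^{1,q}_{\Gamma_D}(\Omega)$. Then the non-autonomous abstract Cauchy problem $$\partial_t\mathbf u(t)+\mathcal A(\varphi(t))\mathbf u(t)=\hat{\mathbf f}(t)\ \text{ for a.e. }t\in(0,T),\qquad \mathbf u(0)=\mathbf u_0,$$ has a unique solution $\mathbf u\in H^1(0,T;\mathbf W^{1,q}_{\Gamma_D}(\Omega))$.
   Context: Let $n\in\{1,2,3\}$, $T>0$. $\Omega\subset\mathbb R^n$ is a bounded connected $C^{1,1}$-domain; $\Gamma_D\subset\partial\Omega$ is relatively closed with $\mathcal H^{n-1}(\Gamma_D)>0$, $\Gamma_N=\partial\Omega\setminus\Gamma_D$, and $\Omega\cup\Gamma_N$ is regular in the sense of Gröger: for every $y\in\partial\Omega$ there are an open neighbourhood $U$ of $y$ and a bi-Lipschitz map $\Phi:U\to\mathbb R^n$ with $\Phi(y)=0$ such that $\Phi(U\cap(\Omega\cup\Gamma_N))$ is one of $E_1=\{|x|<1,x_n<0\}$, $E_2=\{|x|<1,x_n\le0\}$, $E_3=\{x\in E_2:x_n<0\text{ or }x_1>0\}$. $W^{1,r}_{\Gamma_D}(\Omega)$ is the closure in $W^{1,r}(\Omega)$ of $\{f|_\Omega: f\in C_c^\infty(\mathbb R^n),\ \mathrm{supp} f\cap\Gamma_D=\emptyset\}$, $\mathbf W^{1,r}_{\Gamma_D}=(W^{1,r}_{\Gamma_D})^n$,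 and $\mathbf W^{-1,r}_{\Gamma_D}=(\mathbf W^{1,r'}_{\Gamma_D})'$ with $1/r+1/r'=1$. $\mathcal E(\mathbf v)=\frac12(\nabla\mathbf v+\nabla\mathbf v^T)$. $\mathbb C,\mathbb C_\nu:\mathbb R\to\mathcal L(\mathbb R^{n\times n}_{sym})$ are bounded, Lipschitz and differentiable with bounded Lipschitz derivatives; for all $\varphi'\in\mathbb{R}$ the maps $\mathbb C(\varphi'),\mathbb C_\nu(\varphi')$ are symmetric with respect to the inner product $:$ and uniformly positive definite ($\mathcal E:\mathbb C(\varphi')\mathcal E\ge c|\mathcal E|^2$ with $c>0$ independent of $\varphi'$, likewise $\mathbb C_\nu$). For $\varphi\in L^2(\Omega)$ define $\mathcal B(\varphi),\mathcal C(\varphi):\mathbf W^{1,q}_{\Gamma_D}(\Omega)\to\mathbf W^{-1,q}_{\Gamma_D}(\Omega)$ by $$\mathcal B(\varphi)\mathbf v=\int_\Omega\mathbb C_\nu(\varphi)\mathcal E(\mathbf v):\mathcal E(\cdot)\,dx,\qquad \mathcal C(\varphi)\mathbf v=\int_\Omega\mathbb C(\varphi)\mathcal E(\mathbf v):\mathcal E(\cdot)\,dx.$$ By a known result (Herzog--Meyer--Wachsmuth) there is $p^*>2$ such that for $q\in[2,p^*]$ these operators are topological isomorphisms, and they and their inverses are bounded in operator norm uniformly in $\varphi\in L^2(\Omega)$. Throughout, $q\in[2,\min\{p^*,3\}]$ is fixed, and $\mathcal A(\varphi)=\mathcal B(\varphi)^{-1}\mathcal C(\varphi)\in\mathcal L(\mathbf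 W^{1,q}_{\Gamma_D}(\Omega))$. *)

(* Defs.v *)
From HB Require Import structures.
From mathcomp Require Import all_boot all_order all_algebra.
From mathcomp Require Import all_classical all_reals all_analysis.
From mathcomp Require Import measurable_realfun.
Set Implicit Arguments.
Unset Strict Implicit.
Unset Printing Implicit Defensive.
Import Order.TTheory GRing.Theory Num.Theory.
Import numFieldNormedType.Exports.
Local Open Scope classical_set_scope.
Local Open Scope ring_scope.

Section borel_rV.
Context (R : realType) (n : nat).

HB.instance Definition _ := @isMeasurable.Build default_measure_display
  'rV[R]_n <<s @open 'rV[R]_n >>
  (@sigma_algebra0 _ setT _) (@sigma_algebraC 'rV[R]_n _)
  (@sigma_algebra_bigcup _ setT _).

Lemma open_measurable_rV (A : set 'rV[R]_n) : open A -> measurable A.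
Proof. exact: sub_sigma_algebra. Qed.

End borel_rV.


Lemma continuous_measurable_rV (R : realType) (n : nat) (f : 'rV[R]_n -> R) :
  continuous f -> measurable_fun setT f.
Proof.
move=> cf.
apply: (measurability _ (RGenOInfty.measurableE R)) => _ [_ [a ->] <-].
rewrite setTI; apply: open_measurable_rV.
by apply: open_comp; [move=> x _; exact: cf|exact: interval_open].
Qed.

Lemma measurable_fun_rV d (T : measurableType d) (R : realType) (n : nat)
    (f : T -> 'rV[R]_n) :
  (forall i, measurable_fun setT (fun t => f t ord0 i)) -> measurable_fun setT f.
Proof.
move=> mf; apply: (measurability (@open 'rV[R]_n)) => // _ [A oA <-].
rewrite setTI.
pose box (p : 'rV[rat]_n * nat) := [set x : 'rV[R]_n |
  forall i, `|x ord0 i - ratr (p.1 ord0 i)| < p.2.+1%:R^-1].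
pose F p := if `[< box p `<=` A >] then f @^-1` box p else set0.
have -> : f @^-1` A = \bigcup_p F p.
  apply/seteqP; split=> [t At|t [p _]]; last first.
    by rewrite /F; case: asboolP => // + Bt; exact.
  have /nbhs_ballP[e /= e0 eA] : nbhs (f t) A by exact: open_nbhs_nbhs.
  have [k ke] : exists k : nat, k.+1%:R^-1 < e / 2.
    have [k _ kP] := near_infty_natSinv_lt (PosNum (divr_gt0 e0 (ltr0Sn R 1))).
    by exists k; exact: (kP k (leqnn k)).
  have /choice[c cP] i : exists q : rat, `|f t ord0 i - ratr q| < k.+1%:R^-1.
    have k0 : 0 < k.+1%:R^-1 :> R by rewrite invr_gt0.
    have /rat_in_itvoo[q] : f t ord0 i - k.+1%:R^-1 < f t ord0 i + k.+1%:R^-1.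
      by rewrite ltrBlDr -addrA ltrDl addr_gt0.
    rewrite in_itv/= => /andP[ql qr]; exists q.
    by rewrite ltr_distl ltrBlDr qr -ltrBlDr ql.
  exists (\row_i c i, k) => //.
  rewrite /F asboolT => [i|x xB]; first by rewrite mxE; exact: cP.
  apply: eA; rewrite -ball_normE /ball_/= [ltLHS]mx_normrE.
  apply/bigmax_ltP; split => // -[i j] _; rewrite !mxE/= (ord1 i).
  have := xB j; rewrite mxE => xj.
  rewrite -(subrK (ratr (c j)) (f t ord0 j)) -addrA (le_lt_trans (ler_normD _ _))//.
  rewrite [ltRHS]splitr ltrD//; first exact: lt_trans (cP j) ke.
  by rewrite distrC (lt_trans xj).
apply: countable_bigcupT_measurable => // p.
rewrite /F; case: ifPn => _ //.
have -> : f @^-1` box p = \bigcap_(i in [set: 'I_n])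
    [set t | `|f t ord0 i - ratr (p.1 ord0 i)| < p.2.+1%:R^-1].
  by apply/seteqP; split=> [t tB i _|t tB i]; exact: tB.
apply: fin_bigcap_measurable => // i _.
rewrite -[X in measurable X]setTI.
have -> : [set t | `|f t ord0 i - ratr (p.1 ord0 i)| < p.2.+1%:R^-1] =
    (fun t => f t ord0 i) @^-1`
      `](ratr (p.1 ord0 i) - p.2.+1%:R^-1), (ratr (p.1 ord0 i) + p.2.+1%:R^-1)[.
  by apply/seteqP; split=> t /=; rewrite in_itv/= ltr_distl.
exact: (mf i).
Qed.

(* R x R^n ~ R^(n+1); Lebesgue measure on R^(n+1) is the image of the product
   of the Lebesgue measures on R and R^n. *)
Section cons_rV.
Context (R : realType) (n : nat).

Definition cons_rV (p : measurableTypeR R * 'rV[R]_n) : 'rV[R]_n.+1 :=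
  \row_i (if unlift ord0 i is Some j then p.2 ord0 j else p.1).
Definition uncons_rV (x : 'rV[R]_n.+1) : measurableTypeR R * 'rV[R]_n :=
  (x ord0 ord0, \row_i x ord0 (lift ord0 i)).

Lemma cons_rVK : cancel cons_rV uncons_rV.
Proof.
move=> [a x]; congr pair; first by rewrite mxE unlift_none.
by apply/rowP => i; rewrite !mxE liftK.
Qed.

Lemma measurable_cons_rV : measurable_fun setT cons_rV.
Proof.
apply: measurable_fun_rV => i; case: (unliftP ord0 i) => [j|] ->.
  rewrite (_ : (fun _ => _) = (fun x : 'rV[R]_n => x ord0 j) \o snd).
    apply: measurableT_comp => //; apply: continuous_measurable_rV.
    exact: coord_continuous.
  by apply/funext => p; rewrite mxE liftK.
rewrite (_ : (fun _ => _) = fst) => [|]; first exact: measurable_fst.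
by apply/funext => p; rewrite mxE unlift_none.
Qed.

Lemma measurable_uncons_rV : measurable_fun setT uncons_rV.
Proof.
apply: measurable_fun_pair.
  by apply: continuous_measurable_rV; exact: coord_continuous.
apply: measurable_fun_rV => i; under eq_fun do rewrite mxE.
by apply: continuous_measurable_rV; exact: coord_continuous.
Qed.

HB.instance Definition _ := isMeasurableFun.Build _ _ _ _ cons_rV
  measurable_cons_rV.

Variable mu : {sigma_finite_measure set 'rV[R]_n -> \bar R}.

Definition cons_measure : set 'rV[R]_n.+1 -> \bar R :=
  pushforward (@lebesgue_measure R \x mu)%E cons_rV.

Let cons_measure0 : cons_measure set0 = 0%E.
Proof. exact: measure0. Qed.

Let cons_measure_ge0 A : (0 <= cons_measure A)%E.
Proof. exact: measure_ge0. Qed.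

Let cons_measure_sigma_additive : semi_sigma_additive cons_measure.
Proof. exact: measure_semi_sigma_additive. Qed.

HB.instance Definition _ := isMeasure.Build _ _ _ cons_measure
  cons_measure0 cons_measure_ge0 cons_measure_sigma_additive.

Let cons_measure_sigma_finite : sigma_finite setT cons_measure.
Proof.
have /sigma_finiteP[F [FT ndF Foo]] := sigma_finiteT (@lebesgue_measure R).
have /sigma_finiteP[G [GT ndG Goo]] := sigma_finiteT mu.
exists (fun k => uncons_rV @^-1` (F k `*` G k)).
  apply/seteqP; split=> // x _.
  have : [set: measurableTypeR R] (uncons_rV x).1 by [].
  rewrite FT => -[i _ Fi].
  have : [set: 'rV[R]_n] (uncons_rV x).2 by [].
  rewrite GT => -[j _ Gj].
  exists (maxn i j) => //; split.
    by move: Fi; exact/subsetPset/ndF/leq_maxl.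
  by move: Gj; exact/subsetPset/ndG/leq_maxr.
move=> k; have [mF Fk] := Foo k; have [mG Gk] := Goo k; split.
  by rewrite -[X in measurable X]setTI; apply: measurable_uncons_rV => //;
    exact: measurableX.
rewrite /cons_measure /pushforward -comp_preimage.
rewrite (_ : uncons_rV \o cons_rV = id) ?preimage_id; last first.
  by apply/funext => p; exact: cons_rVK.
by rewrite product_measure1E// lte_mul_pinfty// ge0_fin_numE.
Qed.

HB.instance Definition _ := Measure_isSigmaFinite.Build _ _ _ cons_measure
  cons_measure_sigma_finite.

End cons_rV.

Fixpoint lebesgue_rV (R : realType) (n : nat) :
    {sigma_finite_measure set 'rV[R]_n -> \bar R} :=
  if n is k.+1 then cons_measure (lebesgue_rV R k) else dirac (0 : 'rV[R]_0).

(* L^q(mu) as a normed space: the quotient of the functions with finite q-norm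
   by a.e. equality. Lq_fun picks a representative of a class. *)
Section Lq.
Context d (T : measurableType d) (R : realType).
Variables (mu : {measure set T -> \bar R}) (q : R) (q1 : 1 <= q).

Local Notation V := (@LfunType d T R mu q%:E q1).

Definition Lq_eqv (f g : V) : bool := `[< {ae mu, forall x, f x = g x} >].

Let Lq_eqv_refl : reflexive Lq_eqv.
Proof. by move=> f; apply/asboolP; apply/aeW. Qed.

Let Lq_eqv_sym : symmetric Lq_eqv.
Proof.
by move=> f g; apply/asboolP/asboolP; apply: filterS => x ->.
Qed.

Let Lq_eqv_trans : transitive Lq_eqv.
Proof.
move=> g f h /asboolP fg /asboolP gh; apply/asboolP.
by move: fg gh; apply: filterS2 => x -> ->.
Qed.

Canonical Lq_equiv_rel :=
  EquivRel Lq_eqv Lq_eqv_refl Lq_eqv_sym Lq_eqv_trans.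

Definition Lq : Type := {eq_quot Lq_eqv}%qT.
HB.instance Definition _ := Choice.on Lq.
HB.instance Definition _ := EqQuotient.on Lq.

Definition Lq_fun (f : Lq) : T -> R := (repr f : V).

Definition Lq_class (f : V) : Lq := (\pi_Lq f)%qT.

Lemma Lq_classP (f g : V) :
  Lq_class f = Lq_class g <-> {ae mu, forall x, f x = g x}.
Proof. by split=> [/eqmodP/asboolP|fg]; [|apply/eqmodP/asboolP]. Qed.

Lemma Lq_classK (f : Lq) : Lq_class (repr f) = f.
Proof. exact: reprK. Qed.

Lemma Lq_reprK (f : V) : {ae mu, forall x, (repr (Lq_class f) : V) x = f x}.
Proof. by apply/Lq_classP; rewrite Lq_classK. Qed.

Let add (f g : Lq) : Lq := Lq_class ((repr f : V) + repr g).
Let opp (f : Lq) : Lq := Lq_class (- (repr f : V)).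
Let scale (a : R) (f : Lq) : Lq := Lq_class (a *: (repr f : V)).

Let addE f g : add (Lq_class f) (Lq_class g) = Lq_class (f + g).
Proof.
apply/Lq_classP; move: (Lq_reprK f) (Lq_reprK g).
by apply: filterS2 => x /= fE gE; rewrite -[LHS]/(_ x + _ x) fE gE.
Qed.

Let oppE f : opp (Lq_class f) = Lq_class (- f).
Proof.
apply/Lq_classP; move: (Lq_reprK f).
by apply: filterS => x /= fE; rewrite -[LHS]/(- _ x) fE.
Qed.

Let scaleE a f : scale a (Lq_class f) = Lq_class (a *: f).
Proof.
apply/Lq_classP; move: (Lq_reprK f).
by apply: filterS => x /= fE; rewrite -[LHS]/(a * _ x) fE.
Qed.

Let addA : associative add.
Proof.
move=> f g h; rewrite -(Lq_classK f) -(Lq_classK g) -(Lq_classK h).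
by rewrite !addE addrA.
Qed.

Let addC : commutative add.
Proof. by move=> f g; rewrite /add addrC. Qed.

Let add0 : left_id (Lq_class 0) add.
Proof. by move=> f; rewrite -(Lq_classK f) addE add0r. Qed.

Let addN : left_inverse (Lq_class 0) opp add.
Proof. by move=> f; rewrite -(Lq_classK f) oppE addE addNr. Qed.

HB.instance Definition _ := GRing.isZmodule.Build Lq addA addC add0 addN.

Let scaleA a b f : scale a (scale b f) = scale (a * b) f.
Proof. by rewrite -(Lq_classK f) !scaleE scalerA. Qed.

Let scale1 : left_id 1 scale.
Proof. by move=> f; rewrite -(Lq_classK f) scaleE scale1r. Qed.

Let scaleDr : right_distributive scale +%R.
Proof.
move=> a f g; rewrite -(Lq_classK f) -(Lq_classK g) -[_ + _]/(add _ _).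
by rewrite addE !scaleE -[RHS]/(add _ _) addE scalerDr.
Qed.

Let scaleDl f : {morph scale^~ f : a b / a + b}.
Proof.
move=> a b; rewrite -(Lq_classK f) !scaleE -[RHS]/(add _ _) addE.
by rewrite scalerDl.
Qed.

HB.instance Definition _ := GRing.Zmodule_isLmodule.Build R Lq
  scaleA scale1 scaleDr scaleDl.

Definition Lq_norm (f : Lq) : R := fine ('N[mu]_(q%:E) [EFin \o Lq_fun f]).

Let seminorm (f : V) : R := fine ('N[mu]_(q%:E) [EFin \o f]).

Let Lq_normE f : Lq_norm (Lq_class f) = seminorm f.
Proof.
congr fine; rewrite unlock; congr (_ `^ _)%E.
have mN (g : V) :
    measurable_fun setT ((fun x => (`|g x| `^ q)%:E) : T -> \bar R).
  apply: measurableT_comp => //; apply: (measurableT_comp (measurable_powR _)).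
  exact: measurableT_comp.
apply: ae_eq_integral; [exact: measurableT|exact: mN|exact: mN|].
by move: (Lq_reprK f); apply: filterS => x fE _ /=; rewrite /Lq_fun fE.
Qed.

Let Lq_normD f g : Lq_norm (f + g) <= Lq_norm f + Lq_norm g.
Proof.
rewrite -(Lq_classK f) -(Lq_classK g) -[_ + _ in leLHS]/(add _ _) addE.
by rewrite !Lq_normE; exact: ler_LnormD.
Qed.

Let Lq_normZ a f : Lq_norm (a *: f) = `|a| * Lq_norm f.
Proof.
rewrite -(Lq_classK f) -[_ *: _ in LHS]/(scale _ _) scaleE !Lq_normE.
by rewrite /seminorm LnormZ -finite_norm_fine.
Qed.

Lemma Lq_fun0 : {ae mu, forall x, Lq_fun 0 x = 0}.
Proof. exact: Lq_reprK. Qed.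

Lemma Lq_fun_linear a (f g : Lq) :
  {ae mu, forall x, Lq_fun (a *: f + g) x = a * Lq_fun f x + Lq_fun g x}.
Proof.
have -> : a *: f + g = Lq_class (a *: (repr f : V) + (repr g : V)).
  rewrite -addE -scaleE !Lq_classK.
  by [].
exact: Lq_reprK.
Qed.

Let Lq_norm_eq0 f : Lq_norm f = 0 -> f = 0.
Proof.
rewrite -(Lq_classK f) Lq_normE => /fine_Lnormr_eq0 f0; apply/Lq_classP.
by move: f0; apply: filterS => x /(_ I).
Qed.

HB.instance Definition _ := Lmodule_isNormed.Build R Lq
  Lq_normD Lq_normZ Lq_norm_eq0.

End Lq.

(* The finite power X^I with the norm sum_i |x_i|; it is equivalent to every other
   usual norm on X^I, and nothing below depends on the choice. *)
Section fpow.
Context (R : realType) (I : finType) (X : normedModType R).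

Definition fpow : Type := {ffun I -> X}.
HB.instance Definition _ := GRing.Lmodule.on fpow.

Definition fpow_coord (x : fpow) (i : I) : X := (x : {ffun I -> X}) i.

Definition fpow_norm (x : fpow) : R := \sum_i `|fpow_coord x i|.

Let fpow_normD x y : fpow_norm (x + y) <= fpow_norm x + fpow_norm y.
Proof.
rewrite -big_split; apply: ler_sum => i _.
by rewrite /fpow_coord ffunE ler_normD.
Qed.

Let fpow_normZ a x : fpow_norm (a *: x) = `|a| * fpow_norm x.
Proof.
rewrite mulr_sumr; apply: eq_bigr => i _.
by rewrite /fpow_coord ffunE normrZ.
Qed.

Let fpow_norm_eq0 x : fpow_norm x = 0 -> x = 0.
Proof.
move=> /eqP; rewrite psumr_eq0// => /allP x0; apply/ffunP => i.
by have /eqP/normr0_eq0 := x0 i (mem_index_enum i); rewrite ffunE.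
Qed.

HB.instance Definition _ := Lmodule_isNormed.Build R fpow
  fpow_normD fpow_normZ fpow_norm_eq0.
End fpow.

Lemma closure_linear (R : realType) (X : normedModType R) (S : set X) :
  (forall a x y, S x -> S y -> S (a *: x + y)) ->
  forall a x y, closure S x -> closure S y -> closure S (a *: x + y).
Proof.
move=> lS a x y clx cly B nB.
have : (a *: p.1 + p.2) @[p --> (x, y)] --> a *: x + y.
  by apply: cvgD; [apply: cvgZr; exact: cvg_fst|exact: cvg_snd].
move=> /(_ _ nB) [[P Q] /= [/clx[u [Su Pu]] /cly[v [Sv Qv]]] PQB].
by exists (a *: u + v); split; [exact: lS|exact: (PQB (u, v))].
Qed.

Section test_functions.
Context (R : realType) (n : nat).
Implicit Types (f g psi : 'rV[R]_n -> R).

Definition partial (i : 'I_n) f : 'rV[R]_n -> R :=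
  fun x => 'D_(delta_mx ord0 i) f x.

Fixpoint iter_partial (s : seq 'I_n) f : 'rV[R]_n -> R :=
  if s is i :: s' then partial i (iter_partial s' f) else f.

(* All iterated partial derivatives exist and are differentiable everywhere. *)
Definition smooth f : Prop := forall s x, differentiable (iter_partial s f) x.

Definition supp f : set 'rV[R]_n := closure [set x | f x != 0].

Definition Cc_infty f : Prop := smooth f /\ compact (supp f).

Lemma iter_partial_linear (a : R) f g s : smooth f -> smooth g ->
  iter_partial s (a *: f + g) = a *: iter_partial s f + iter_partial s g.
Proof.
move=> sf sg; elim: s => [//|i s IHs] /=; rewrite IHs.
apply/funext => x; rewrite /partial deriveD; last 2 first.
- by apply: diff_derivable; apply: differentiableZ.
- exact: diff_derivable.
by rewrite deriveZ//; exact: diff_derivable.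
Qed.

Lemma smooth_continuous f s : smooth f -> continuous (iter_partial s f).
Proof. by move=> sf x; apply: differentiable_continuous; exact: sf. Qed.

Lemma measurable_Cc_infty psi : Cc_infty psi -> measurable_fun setT psi.
Proof.
move=> [spsi _]; apply: continuous_measurable_rV.
exact: (smooth_continuous (s := [::]) spsi).
Qed.

Lemma measurable_partial j psi :
  Cc_infty psi -> measurable_fun setT (partial j psi).
Proof.
move=> [spsi _]; apply: continuous_measurable_rV.
exact: (smooth_continuous (s := [:: j]) spsi).
Qed.

Lemma supp_linear (a : R) f g : supp (a *: f + g) `<=` supp f `|` supp g.
Proof.
rewrite /supp -closureU; apply: closureS => x /= /eqP fg.
have [fx|] := eqVneq (f x) 0; [right|by left].
by apply/eqP => gx; apply: fg; rewrite -[LHS]/(a * f x + g x) fx gx mulr0 addr0.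
Qed.

Lemma Cc_infty_linear (a : R) f g :
  Cc_infty f -> Cc_infty g -> Cc_infty (a *: f + g).
Proof.
move=> [sf cf] [sg cg]; split.
  move=> s x; rewrite iter_partial_linear//.
  by apply: differentiableD => //; exact: differentiableZ.
apply: (subclosed_compact _ _ (@supp_linear a f g)).
  exact: closed_closure.
exact: compactU.
Qed.

Lemma iter_partial0 s : iter_partial s (0 : 'rV[R]_n -> R) = 0.
Proof.
elim: s => [//|i s /= ->]; apply/funext => x.
by rewrite /partial derive_cst.
Qed.

Lemma supp0 : supp (0 : 'rV[R]_n -> R) = set0.
Proof.
rewrite /supp (_ : [set _ | _] = set0) ?closure0//.
by rewrite -subset0 => x /=; rewrite eqxx.
Qed.

Lemma Cc_infty0 : Cc_infty (0 : 'rV[R]_n -> R).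
Proof.
split; last by rewrite supp0; exact: compact0.
by move=> s x; rewrite iter_partial0; exact: differentiable_cst.
Qed.

End test_functions.

Lemma ae_eq_Rintegral d (T : measurableType d) (R : realType)
    (mu : {measure set T -> \bar R}) (f g : T -> R) :
  measurable_fun setT g -> {ae mu, forall x, f x = g x} ->
  mu.-integrable setT (EFin \o f) ->
  mu.-integrable setT (EFin \o g) /\ (\int[mu]_x f x = \int[mu]_x g x)%R.
Proof.
move=> mg fg /integrableP[/measurable_EFinP mf foo].
split; last first.
  congr fine; apply: ae_eq_integral; [by []|exact/measurable_EFinP..|].
  by move: fg; apply: filterS => x /= ->.
apply/integrableP; split; first exact/measurable_EFinP.
rewrite (_ : (\int[mu]_x _)%E = (\int[mu]_x `|(EFin \o f) x|)%E)//.
apply: ae_eq_integral; [by []|..].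
- by apply: measurableT_comp => //; exact/measurable_EFinP.
- by apply: measurableT_comp => //; exact/measurable_EFinP.
- by move: fg; apply: filterS => x /= ->.
Qed.

(* The Sobolev spaces on Omega. W^{1,q}(Omega) is represented as the graph of the
   weak gradient: the families w with w_None = u and w_(Some j) = d_j u, the norm
   being |u|_q + sum_j |d_j u|_q. Functions are defined on all of R^n but only
   matter almost everywhere in Omega. *)
Section sobolev.
Context (R : realType) (n : nat) (Omega GammaD : set 'rV[R]_n).
Context (oOmega : open Omega) (q : R) (q1 : 1 <= q).

Definition leb_on : {measure set 'rV[R]_n -> \bar R} :=
  mrestr (lebesgue_rV R n) (open_measurable_rV oOmega).

Local Notation Lq := (Lq leb_on q1).
Local Notation mu := leb_on.

(* The integrability conditions hold automatically, by Hoelder's inequality. *)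
Definition is_weak_partial (j : 'I_n) (u g : Lq) : Prop :=
  forall psi, Cc_infty psi -> supp psi `<=` Omega ->
  [/\ mu.-integrable setT (EFin \o (fun x => Lq_fun u x * partial j psi x)),
      mu.-integrable setT (EFin \o (fun x => Lq_fun g x * psi x)) &
      (\int[mu]_x (Lq_fun u x * partial j psi x) =
       - \int[mu]_x (Lq_fun g x * psi x))%R].

Definition W1q : set (fpow (option 'I_n) Lq) :=
  [set w | forall j, is_weak_partial j (fpow_coord w None)
                       (fpow_coord w (Some j))].

(* The restrictions to Omega of the functions of C_c^oo(R^n) with support disjoint
   from GammaD, together with their gradients. *)
Definition test_GammaD : set (fpow (option 'I_n) Lq) :=
  [set w | exists f, [/\ Cc_infty f, supp f `&` GammaD = set0,
     {ae mu, forall x, Lq_fun (fpow_coord w None) x = f x} &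
     forall j, {ae mu, forall x, Lq_fun (fpow_coord w (Some j)) x
                                 = partial j f x}]].

(* The closure of the test functions relative to W^{1,q}(Omega). *)
Definition W1q_GammaD_pred : {pred fpow (option 'I_n) Lq} :=
  mem (W1q `&` closure test_GammaD).

Let is_weak_partial_linear a j (u g v h : Lq) :
  is_weak_partial j u g -> is_weak_partial j v h ->
  is_weak_partial j (a *: u + v) (a *: g + h).
Proof.
move=> ug vh psi Cpsi psiO.
have [iu ig ugE] := ug psi Cpsi psiO; have [iv ih vhE] := vh psi Cpsi psiO.
have mdpsi := measurable_partial j Cpsi.
have mpsi := measurable_Cc_infty Cpsi.
have key (w1 w2 : Lq) (f : 'rV[R]_n -> R) : measurable_fun setT f ->
    mu.-integrable setT (EFin \o (fun x => Lq_fun w1 x * f x)) ->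
    mu.-integrable setT (EFin \o (fun x => Lq_fun w2 x * f x)) ->
    mu.-integrable setT (EFin \o (fun x => Lq_fun (a *: w1 + w2) x * f x)) /\
    (\int[mu]_x (Lq_fun (a *: w1 + w2) x * f x) =
      a * \int[mu]_x (Lq_fun w1 x * f x) + \int[mu]_x (Lq_fun w2 x * f x))%R.
  move=> mf i1 i2.
  have i1a : mu.-integrable setT (EFin \o (fun x => a * (Lq_fun w1 x * f x))).
    exact: (integrableZl measurableT a i1).
  have i12 : mu.-integrable setT
      (EFin \o (fun x => a * (Lq_fun w1 x * f x) + Lq_fun w2 x * f x)).
    exact: (integrableD measurableT i1a i2).
  have ae12 : {ae mu, forall x, a * (Lq_fun w1 x * f x) + Lq_fun w2 x * f x =
                                Lq_fun (a *: w1 + w2) x * f x}.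
    by have := Lq_fun_linear a w1 w2; apply: filterS => x ->; rewrite mulrDl mulrA.
  have [|i3 <-] := ae_eq_Rintegral _ ae12 i12; first exact: measurable_funM.
  by split=> //; rewrite RintegralD// RintegralZl.
have [? E1] := key u v _ mdpsi iu iv; have [? E2] := key g h _ mpsi ig ih.
by split=> //; rewrite E1 E2 ugE vhE mulrN opprD.
Qed.

Let W1q_linear a w1 w2 : W1q w1 -> W1q w2 -> W1q (a *: w1 + w2).
Proof.
move=> W1w1 W1w2 j; rewrite /fpow_coord !ffunE.
exact: is_weak_partial_linear.
Qed.

Let test_linear a w1 w2 :
  test_GammaD w1 -> test_GammaD w2 -> test_GammaD (a *: w1 + w2).
Proof.
move=> [f [Cf fG f0 f1]] [g [Cg gG g0 g1]].
exists (a *: f + g); split; first exact: Cc_infty_linear.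
- rewrite -subset0 => x [/supp_linear[fx|gx] Gx].
    by rewrite -fG.
  by rewrite -gG.
- rewrite /fpow_coord !ffunE.
  have := Lq_fun_linear a (fpow_coord w1 None) (fpow_coord w2 None).
  by move: f0 g0; apply: filterS3 => x fE gE ->; rewrite fE gE.
- move=> j; rewrite /fpow_coord !ffunE.
  have := Lq_fun_linear a (fpow_coord w1 (Some j)) (fpow_coord w2 (Some j)).
  have -> : partial j (a *: f + g) = a *: partial j f + partial j g.
    exact: (iter_partial_linear a [:: j] Cf.1 Cg.1).
  by move: (f1 j) (g1 j); apply: filterS3 => x fE gE ->; rewrite fE gE.
Qed.

Let test0 : test_GammaD 0.
Proof.
exists 0; split; first exact: Cc_infty0.
- by rewrite supp0 set0I.
- by rewrite /fpow_coord ffunE; exact: Lq_fun0.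
- move=> j; rewrite /fpow_coord ffunE -[partial j 0]/(iter_partial [:: j] 0).
  by rewrite iter_partial0; exact: Lq_fun0.
Qed.

Let W1q0 : W1q 0.
Proof.
move=> j; rewrite /fpow_coord !ffunE => psi Cpsi _.
have key (f : 'rV[R]_n -> R) : measurable_fun setT f ->
    mu.-integrable setT (EFin \o (fun x => Lq_fun (0 : Lq) x * f x)) /\
    (\int[mu]_x (Lq_fun (0 : Lq) x * f x) = 0)%R.
  move=> mf; have ae0 : {ae mu, forall x, 0 = Lq_fun (0 : Lq) x * f x}.
    have := @Lq_fun0 _ _ _ mu q q1.
    by apply: filterS => x ->; rewrite mul0r.
  have [|] := ae_eq_Rintegral _ ae0 (@integrable0 _ _ _ mu setT).
    exact: measurable_funM.
  by rewrite Rintegral_cst// mul0r.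
have [|? ->] := key (partial j psi); first exact: measurable_partial.
have [|? ->] := key psi; first exact: measurable_Cc_infty.
by rewrite oppr0.
Qed.

Lemma W1q_GammaD_submod_closed : submod_closed W1q_GammaD_pred.
Proof.
split=> [|a w1 w2]; rewrite !inE.
  by split; [exact: W1q0|apply: subset_closure; exact: test0].
move=> [W1w1 clw1] [W1w2 clw2]; split; first exact: W1q_linear.
by apply: closure_linear => //; exact: test_linear.
Qed.

HB.instance Definition _ := GRing.isSubmodClosed.Build _ _ W1q_GammaD_pred
  W1q_GammaD_submod_closed.

Record W1q_GammaD := {
  W1q_GammaD_val :> fpow (option 'I_n) Lq ;
  _ : W1q_GammaD_val \in W1q_GammaD_pred }.

HB.instance Definition _ := [isSub for W1q_GammaD_val].
HB.instance Definition _ := [Choice of W1q_GammaD by <:].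
HB.instance Definition _ := [SubChoice_isSubLmodule of W1q_GammaD by <:].

Definition W1q_GammaD_norm (w : W1q_GammaD) : R := `|W1q_GammaD_val w|.

Let W1q_GammaD_normD x y :
  W1q_GammaD_norm (x + y) <= W1q_GammaD_norm x + W1q_GammaD_norm y.
Proof. exact: ler_normD. Qed.

Let W1q_GammaD_normZ a x : W1q_GammaD_norm (a *: x) = `|a| * W1q_GammaD_norm x.
Proof. exact: normrZ. Qed.

Let W1q_GammaD_norm_eq0 x : W1q_GammaD_norm x = 0 -> x = 0.
Proof. by move=> /normr0_eq0 x0; exact: val_inj. Qed.

HB.instance Definition _ := Lmodule_isNormed.Build R W1q_GammaD
  W1q_GammaD_normD W1q_GammaD_normZ W1q_GammaD_norm_eq0.

(* W^{1,q}_GammaD(Omega)^n: coordinate i is the i-th component of the field. *)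
Definition W1q_GammaD_vec : normedModType R := fpow 'I_n W1q_GammaD.
End sobolev.

Section geometry.
Context (R : realType).

Definition enorm (n : nat) (x : 'rV[R]_n) : R :=
  Num.sqrt (\sum_i x ord0 i ^+ 2).

Definition bdry (n : nat) (A : set 'rV[R]_n) : set 'rV[R]_n :=
  closure A `\` A°.

Definition C11 (k : nat) (gamma : 'rV[R]_k -> R) : Prop :=
  (forall x, differentiable gamma x) /\
  exists L : R, forall j x y,
    `|partial j gamma x - partial j gamma y| <= L * enorm (x - y).

(* Near each boundary point, after a rigid motion, Omega is the strict subgraph of
   a C^{1,1} function of the first n - 1 coordinates. *)
Definition C11_domain (m : nat) (Omega : set 'rV[R]_m.+1) : Prop :=
  forall y, bdry Omega y ->
  exists (Q : 'M[R]_m.+1) (gamma : 'rV[R]_m -> R) (U : set 'rV[R]_m.+1),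
  [/\ Q *m Q^T = 1%:M, C11 gamma, open U, U y &
      forall x, U x -> let z := (x - y) *m Q in
        Omega x <->
        z ord0 ord_max < gamma (\row_(i < m) z ord0 (widen_ord (leqnSn m) i))].

Definition diam (n : nat) (A : set 'rV[R]_n) : \bar R :=
  ereal_sup [set (enorm (x - y))%:E | x in A & y in A].

(* The empty set costs nothing, and a nonempty set of diameter 0 has cost 0^0 = 1
   for s = 0, so that the 0-dimensional measure is the counting measure. *)
Definition hausdorff_cost (n s : nat) (A : set 'rV[R]_n) : \bar R :=
  if `[< A = set0 >] then 0%E else (diam A ^+ s)%E.

Definition hausdorff_pre (n s : nat) (delta : R) (A : set 'rV[R]_n) : \bar R :=
  ereal_inf [set (\sum_(k <oo) hausdorff_cost s (U k))%E | U in
    [set U : nat -> set 'rV[R]_n | A `<=` \bigcup_k U k /\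
      forall k, (diam (U k) <= delta%:E)%E]].

(* Hausdorff measure up to the usual dimensional normalizing constant. *)
Definition hausdorff (n s : nat) (A : set 'rV[R]_n) : \bar R :=
  ereal_sup [set hausdorff_pre s delta A | delta in [set delta | 0 < delta]].

Definition bilipschitz_on (n : nat) (U : set 'rV[R]_n)
    (Phi : 'rV[R]_n -> 'rV[R]_n) : Prop :=
  exists2 L : R, 0 < L & forall x y, U x -> U y ->
    enorm (Phi x - Phi y) <= L * enorm (x - y) /\
    enorm (x - y) <= L * enorm (Phi x - Phi y).

Definition groger_E1 (m : nat) : set 'rV[R]_m.+1 :=
  [set x | enorm x < 1 /\ x ord0 ord_max < 0].

Definition groger_E2 (m : nat) : set 'rV[R]_m.+1 :=
  [set x | enorm x < 1 /\ x ord0 ord_max <= 0].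

Definition groger_E3 (m : nat) : set 'rV[R]_m.+1 :=
  [set x | groger_E2 x /\ (x ord0 ord_max < 0 \/ 0 < x ord0 ord0)].

Definition groger_regular (m : nat) (Omega GammaN : set 'rV[R]_m.+1) : Prop :=
  forall y, bdry Omega y ->
  exists (U : set 'rV[R]_m.+1) (Phi : 'rV[R]_m.+1 -> 'rV[R]_m.+1),
  [/\ open U, U y, bilipschitz_on U Phi, Phi y = 0 &
      let E := Phi @` (U `&` (Omega `|` GammaN)) in
      [\/ E = groger_E1 (m := m), E = groger_E2 (m := m) | E = groger_E3 (m := m)]].

End geometry.

Section elasticity.
Context (R : realType) (n : nat).
Implicit Types (A B : 'M[R]_n) (F : 'M[R]_n -> 'M[R]_n)
  (C : R -> 'M[R]_n -> 'M[R]_n).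

Definition ddot A B : R := \sum_i \sum_j A i j * B i j.
Definition frob A : R := Num.sqrt (ddot A A).
Definition symm A : Prop := A^T = A.

(* Elements of L(Sym) are maps on all matrices of which only the restriction to the
   symmetric matrices matters; op_norm_le bounds the operator norm of that
   restriction. *)
Definition sym_op F : Prop :=
  (forall A, symm A -> symm (F A)) /\
  (forall a A B, symm A -> symm B -> F (a *: A + B) = a *: F A + F B).

Definition op_norm_le F (M : R) : Prop :=
  forall A, symm A -> frob (F A) <= M * frob A.

Definition bounded_op C : Prop := exists M, forall s, op_norm_le (C s) M.

Definition lipschitz_op C : Prop :=
  exists L, forall s t, op_norm_le (fun A => C s A - C t A) (L * `|s - t|).

(* C' is the derivative of C : R -> L(Sym) for the operator norm. *)
Definition derivative_op C C' : Prop :=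
  forall s e, 0 < e -> exists2 d, 0 < d & forall h, `|h| < d ->
    op_norm_le (fun A => C (s + h) A - C s A - h *: C' s A) (e * `|h|).

Definition stiffness C : Prop :=
  [/\ forall s, sym_op (C s), bounded_op C, lipschitz_op C,
      exists C', [/\ forall s, sym_op (C' s), derivative_op C C',
                     bounded_op C' & lipschitz_op C'] &
      (forall s A B, symm A -> symm B -> ddot (C s A) B = ddot A (C s B)) /\
      exists2 c, 0 < c &
        forall s A, symm A -> c * frob A ^+ 2 <= ddot A (C s A)].

End elasticity.

Section duality.
Context (R : realType).

Definition dual (X : normedModType R) : set (X -> R) :=
  [set F : X -> R | (forall a x y, F (a *: x + y) = a * F x + F y) /\ continuous F].

Definition dual_norm (X : normedModType R) (F : X -> R) : \bar R :=
  ereal_sup [set `|F x|%:E | x in [set x | `|x| <= 1]].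

(* The L phi are isomorphisms of X onto the dual of Y, and their norms and those of
   their inverses are bounded by one constant (hence both are continuous). *)
Definition uniform_iso_to_dual (P : Type) (X Y : normedModType R)
    (L : P -> X -> (Y -> R)) : Prop :=
  (forall phi,
    [/\ forall v, dual (L phi v),
        forall a u v w, L phi (a *: u + v) w = a * L phi u w + L phi v w &
        forall F, dual F -> exists! v, L phi v = F]) /\
  exists M : R, forall phi v,
    (dual_norm (L phi v) <= (M * `|v|)%:E)%E /\
    (`|v|%:E <= M%:E * dual_norm (L phi v))%E.

End duality.

Section elasticity_operators.
Context (R : realType) (n : nat) (Omega GammaD : set 'rV[R]_n).
Context (oOmega : open Omega).

Definition L2 : normedModType R := Lq (leb_on oOmega) (ler1n R 2).

Local Notation W q1 := (W1q_GammaD_vec GammaD oOmega q1).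

Definition grad (q : R) (q1 : 1 <= q) (v : W q1) (x : 'rV[R]_n) : 'M[R]_n :=
  \matrix_(i, j) Lq_fun (fpow_coord (W1q_GammaD_val (fpow_coord v i)) (Some j)) x.

Definition strain (q : R) (q1 : 1 <= q) (v : W q1) (x : 'rV[R]_n) : 'M[R]_n :=
  2^-1 *: (grad v x + (grad v x)^T).

(* v |-> int_Omega C(phi) E(v) : E(.) dx, with values in functionals on
   W^{1,q'}_GammaD. *)
Definition elastic_op (C : R -> 'M[R]_n -> 'M[R]_n) (q q' : R)
    (q1 : 1 <= q) (q'1 : 1 <= q') (phi : L2) (v : W q1) : W q'1 -> R :=
  fun w => (\int[leb_on oOmega]_x
              ddot (C (Lq_fun phi x) (strain v x)) (strain w x))%R.

(* B(phi)^-1 (C(phi) v), i.e. the w with B(phi) w = C(phi) v; it exists and is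
   unique when B(phi) is onto the dual and one-to-one. *)
Definition A_op (Cnu C : R -> 'M[R]_n -> 'M[R]_n) (q q' : R)
    (q1 : 1 <= q) (q'1 : 1 <= q') (phi : L2) (v : W q1) : W q1 :=
  xget 0 [set w | elastic_op Cnu phi w = elastic_op C phi v :> (W q'1 -> R)].
End elasticity_operators.
Arguments elastic_op {R n Omega} GammaD oOmega C {q q'} q1 q'1 phi v _.
Arguments A_op {R n Omega} GammaD oOmega Cnu C {q q'} q1 q'1 phi v.

(* Functions on the interval ]0, T[ with values in X, defined on all of R but only
   considered on ]0, T[. When u is merely an a.e. limit of simple functions, |u| is
   a.e. equal to a Borel function and its integral below is that function's. *)
Section bochner.
Context (R : realType) (X : normedModType R).
Implicit Types (u g s : R -> X) (T : R).

Local Notation leb := (@lebesgue_measure R).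

Definition simple s : Prop :=
  finite_set (range s) /\ forall x, measurable (s @^-1` [set x]).

Definition simple_integral T s : X :=
  \sum_(x \in range s) fine (leb (`]0, T[ `&` s @^-1` [set x])) *: x.

Definition strongly_measurable T u : Prop :=
  exists2 s : nat -> R -> X, forall k, simple (s k) &
    {ae leb, forall t, t \in `]0, T[ -> s k t @[k --> \oo] --> u t}.

Definition bochner_integral_is T u (x : X) : Prop :=
  exists s : nat -> R -> X,
  [/\ forall k, simple (s k),
      {ae leb, forall t, t \in `]0, T[ -> s k t @[k --> \oo] --> u t},
      (\int[leb]_(t in `]0%R, T[) `|u t - s k t|%:E)%E @[k --> \oo] --> 0%E &
      simple_integral T (s k) @[k --> \oo] --> x].

Definition bochner_L2 T u : Prop :=
  strongly_measurable T u /\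
  (\int[leb]_(t in `]0%R, T[) (`|u t| ^+ 2)%:E < +oo)%E.

Definition Cc_infty_itv T (psi : R -> R) : Prop :=
  [/\ forall k t, derivable (derive1n k psi) t 1,
      compact (closure [set t | psi t != 0]) &
      closure [set t | psi t != 0] `<=` `]0, T[].

Definition weak_time_derivative T u g : Prop :=
  forall psi, Cc_infty_itv T psi ->
  exists2 x, bochner_integral_is T (fun t => derive1 psi t *: u t) x &
             bochner_integral_is T (fun t => psi t *: g t) (- x).

(* The value at 0 is that of the continuous representative on [0, T]. *)
Definition initial_value T u (u0 : X) : Prop :=
  exists v : R -> X, [/\ {within `[0, T], continuous v},
    {ae leb, forall t, t \in `]0, T[ -> v t = u t} & v 0 = u0].

(* u is in H^1(0, T; X), u' + A u = f a.e. on ]0, T[, and u(0) = u0. *)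
Definition cauchy_solution T (A : R -> X -> X) (f : R -> X) (u0 : X) u : Prop :=
  [/\ bochner_L2 T u,
      exists g, [/\ bochner_L2 T g, weak_time_derivative T u g &
        {ae leb, forall t, t \in `]0, T[ -> g t + A t (u t) = f t}] &
      initial_value T u u0].
End bochner.

(* Main.v *)
Require Import Defs.
From mathcomp Require Import all_boot all_order all_algebra.
From mathcomp Require Import all_classical all_reals all_analysis.
From mathcomp Require Import measurable_realfun ring lra.
Set Implicit Arguments.
Unset Strict Implicit.
Unset Printing Implicit Defensive.
Import Order.TTheory GRing.Theory Num.Theory.
Import numFieldNormedType.Exports HBSimple.
Local Open Scope classical_set_scope.
Local Open Scope ring_scope.

(* For fixed phi the operator B(phi) identifies X = W^{1,q} with the dual of
   Y = W^{1,q'}. Testing with Y therefore determines the elements of X and their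
   norms up to a constant, every bounded functional on Y comes from X, and hence X
   is complete and X-valued integrals reduce to scalar ones: the integral of u is
   the x with <B x, w> = int <B u(t), w> dt for all w.

   As C is bounded and Lipschitz and q >= 2, the map phi |-> (C(phi) E(v)) is
   continuous from L^2 to L^q for each fixed v. With the uniform bound on B(phi)^-1
   this makes t |-> A(phi(t)) v continuous for each v, and A(phi(t)) is bounded
   uniformly in t.

   A solution is then the same as a continuous solution of the Volterra equation
   u(t) = u0 + int_0^t (f - A(phi) u) ds. In one direction the scalar functions
   <B u(t), w> are integrated by parts against test functions (Fubini); in the other
   the fundamental lemma of the calculus of variations applies to them. The Volterra
   map contracts by 1/2 in the norm sup_t |u(t)| e^{-2 K t}, which gives existence
   and uniqueness. *)

(** * Limits of simple functions *)

(** Whatever would ask for completeness or for a vector-valued integral is moved to the dual side: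
    real limits or real integrals define a bounded linear functional on [Y], which is then
    represented in [X]. Norms are recovered by testing, at the price of a factor [M] for each
    passage, so that the norm of an integral is at most [M * M] times the integral of the norm. The
    pairing must not depend on time, or it would not commute with time integrals and weak
    derivatives: it is [B(0)], although [A(phi(t))] is built from [B(phi(t))]. The coefficients
    [C(phi)] and [C(phi')] are close in [L^2] when [phi] and [phi'] are, but need not be close in
    [L^oo]; hence continuity in [t] is obtained on each fixed vector and not in operator norm. With
    the uniform bound this suffices, because the Volterra equation involves only
    [t |-> A(phi(t)) u(t)] for continuous [u]. *)

Section simple_maps.
Context (R : realType).

(** Unfolds to [simple] when [Z] is a normed space; arbitrary value types allow real indicators as
    factors and free composition. *)
Definition simple_map (Z : Type) (s : R -> Z) : Prop :=
  finite_set (range s) /\ forall x, measurable (s @^-1` [set x]).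

(** Convergence holds at every point, so that sums, products and compositions involve no null sets;
    [strongly_measurable_simple_limit] leads back to this case. *)
Definition simple_limit (Z : topologicalType) (u : R -> Z) : Prop :=
  exists2 s : nat -> R -> Z, forall k, simple_map (s k) &
    forall t, s k t @[k --> \oo] --> u t.

Lemma simple_map_preimage (Z : Type) (s : R -> Z) (A : set Z) :
  simple_map s -> measurable (s @^-1` A).
Proof.
move=> [fs ms].
have -> : s @^-1` A = \bigcup_(x in range s `&` A) (s @^-1` [set x]).
  apply/seteqP; split=> [t At|t [x [_ Ax] /= ->]//].
  by exists (s t) => //; split => //; exists t.
by apply: fin_bigcup_measurable => //; exact: finite_setIl.
Qed.

Lemma simple_map2 (Z1 Z2 Z : Type) (F : Z1 -> Z2 -> Z) s1 s2 :
  simple_map s1 -> simple_map s2 -> simple_map (fun t => F (s1 t) (s2 t)).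
Proof.
move=> [f1 m1] [f2 m2]; split.
  apply: (sub_finite_set _ (finite_image2 F f1 f2)) => _ [t _ <-].
  by exists (s1 t); [exists t|exists (s2 t) => //; exists t].
move=> x.
rewrite (_ : _ @^-1` _ = \bigcup_(y in range s1)
  (s1 @^-1` [set y] `&` s2 @^-1` [set z | F y z = x])); last first.
  apply/seteqP; split=> [t /= Ftx|t [y _ [/= -> ->]]//].
  by exists (s1 t) => //; exists t.
apply: fin_bigcup_measurable => // y _; apply: measurableI => //.
exact: simple_map_preimage.
Qed.

Lemma simple_map_comp (Z1 Z : Type) (F : Z1 -> Z) s :
  simple_map s -> simple_map (F \o s).
Proof. by move=> ss; exact: (@simple_map2 _ _ _ (fun x _ => F x) s s). Qed.

Lemma simple_map_measurable (s : R -> R) :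
  simple_map s -> measurable_fun setT s.
Proof. by move=> ss _ A _; rewrite setTI; exact: simple_map_preimage. Qed.

Lemma simple_map_indic (A : set R) : measurable A -> simple_map (\1_A : R -> R).
Proof.
move=> mA; split.
  apply: (@sub_finite_set _ _ [set 0; 1]); last exact: finite_set2.
  by move=> _ [t _ <-]; rewrite indicE /=; case: (t \in A); [right|left].
move=> x; rewrite -[_ @^-1` _]setTI.
by apply: measurable_indic.
Qed.

Lemma measurable_simple_limit (h : R -> R) :
  measurable_fun setT h -> simple_limit h.
Proof.
move=> mh.
have mEh : measurable_fun setT (EFin \o h) by exact/measurable_EFinP.
have [g gh] := approximation_sfun measurableT mEh.
exists (fun k t => g k t) => [k|t]; last first.
  have := gh t I; move=> /fine_cvgP[_].
  by [].
split; first exact: fimfunP.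
by move=> x; exact: measurable_funPTI.
Qed.

Lemma simple_limit_measurable (h : R -> R) :
  simple_limit h -> measurable_fun setT h.
Proof.
move=> [s ss sh]; apply: (@measurable_fun_cvg _ _ _ _ s) => [m|t _].
  exact: simple_map_measurable.
exact: sh.
Qed.

Lemma simple_limit2 (Z1 Z2 Z : topologicalType) (F : Z1 -> Z2 -> Z) u1 u2 :
  (forall a b, F z.1 z.2 @[z --> (a, b)] --> F a b) ->
  simple_limit u1 -> simple_limit u2 -> simple_limit (fun t => F (u1 t) (u2 t)).
Proof.
move=> cF [s1 ss1 su1] [s2 ss2 su2].
exists (fun k t => F (s1 k t) (s2 k t)) => [k|t].
  exact: simple_map2.
exact: (@continuous2_cvg _ Z1 Z2 Z _ _ _ _ F _ _ (cF _ _) (su1 t) (su2 t)).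
Qed.

Lemma simple_limit_comp (Z1 Z : topologicalType) (F : Z1 -> Z) u :
  continuous F -> simple_limit u -> simple_limit (F \o u).
Proof.
move=> cF [s ss su]; exists (fun k => F \o s k) => [k|t].
  exact: simple_map_comp.
exact: (@continuous_cvg _ Z1 Z _ _ _ F _ (cF _) (su t)).
Qed.

(** Read [u] as [u \o id]: the identity of the line is measurable, hence a limit of simple
    functions. *)
Lemma continuous_simple_limit (Z : topologicalType) (u : R -> Z) :
  continuous u -> simple_limit u.
Proof.
move=> cu; apply: (@simple_limit_comp R Z u id cu).
exact: measurable_simple_limit.
Qed.

Lemma simple_limitD (X : normedModType R) (u v : R -> X) :
  simple_limit u -> simple_limit v -> simple_limit (fun t => u t + v t).
Proof.
apply: (@simple_limit2 X X X (fun x y => x + y)) => a b.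
exact: (@add_continuous X (a, b)).
Qed.

Lemma simple_limitN (X : normedModType R) (u : R -> X) :
  simple_limit u -> simple_limit (fun t => - u t).
Proof.
apply: (@simple_limit_comp X X (fun x => - x)); exact: (@opp_continuous X).
Qed.

Lemma simple_limitZ (X : normedModType R) (h : R -> R) (u : R -> X) :
  measurable_fun setT h -> simple_limit u -> simple_limit (fun t => h t *: u t).
Proof.
move=> /measurable_simple_limit; apply: (@simple_limit2 R^o X X (fun a x => a *: x)) => a b.
exact: (@scale_continuous _ X (a, b)).
Qed.

Lemma simple_limit_norm (X : normedModType R) (u : R -> X) :
  simple_limit u -> measurable_fun setT (fun t => `|u t|).
Proof.
move=> su; apply: simple_limit_measurable.
by apply: (@simple_limit_comp X R (fun x => `|x|)) => //; exact: norm_continuous.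
Qed.

End simple_maps.

(** The exceptional points lie in a measurable null set [N]; [u] is set to zero on [N] and outside
    the interval, and the simple functions are multiplied by the indicator of what remains. *)
Lemma strongly_measurable_simple_limit (R : realType) (X : normedModType R)
    (T : R) (u : R -> X) :
  strongly_measurable T u ->
  exists v, [/\ simple_limit v, forall t, t \notin `]0, T[ -> v t = 0 &
    {ae (@lebesgue_measure R), forall t, t \in `]0, T[ -> u t = v t}].
Proof.
move=> [s ss [N [mN N0 sN]]].
pose A := `]0, T[%classic `\` N.
have mA : measurable A by apply: measurableD.
pose v t := if t \in A then u t else 0.
exists v; split.
- exists (fun k t => (\1_A t : R) *: s k t) => [k|t].
    apply: (@simple_map2 _ _ _ _ (fun a x => a *: x) (\1_A) (s k)).
      exact: simple_map_indic.
    exact: ss.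
  rewrite indicE /v; case: ifPn => [/set_mem[tT tN]|_] /=; last first.
    by rewrite (_ : (fun _ => _) = fun=> 0); [exact: cvg_cst|
      apply/funext => k; rewrite scale0r].
  rewrite (_ : (fun _ => _) = fun k => s k t); last first.
    by apply/funext => k; rewrite scale1r.
  by apply: contrapT => nsu; apply: tN; apply: sN => /= /(_ tT).
- move=> t tT; rewrite /v; case: ifPn => // /set_mem[tT' _].
  by rewrite tT' in tT.
- exists N; split => // t /= nuv; apply: contrapT => tN; apply: nuv => tT.
  rewrite /v mem_set//.
Qed.

(** The integral of a nonnegative function is a supremum over the simple functions below it, so it
    is monotone even when [g] is not measurable. This occurs when [g] comes from a function that
    only agrees almost everywhere with a measurable one; the null set is removed on the side of
    [f]. *)
Lemma le_ae_integral d (T : measurableType d) (R : realType)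
    (mu : {measure set T -> \bar R}) (D : set T) (f g : T -> \bar R) :
  measurable D -> measurable_fun D f ->
  (forall x, D x -> 0 <= f x)%E -> (forall x, D x -> 0 <= g x)%E ->
  {ae mu, forall x, D x -> (f x <= g x)%E} ->
  (\int[mu]_(x in D) f x <= \int[mu]_(x in D) g x)%E.
Proof.
move=> mD mf f0 g0 [N [mN N0 fgN]].
rewrite (ge0_negligible_integral mN)//.
rewrite integral_mkcond [leRHS]integral_mkcond !ge0_integralTE; last 2 first.
- by move=> x; rewrite erestrict_ge0.
- by move=> x; apply: erestrict_ge0 => y [/f0].
apply: ereal_sup_le => _ [h /= hf <-]; exists h => //= x.
apply: (le_trans (hf x)); rewrite !patchE; case: ifPn => xDN; last first.
  by case: ifPn => // /set_mem/g0.
move/set_mem: xDN => [Dx Nx]; rewrite mem_set//.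
by apply: contrapT => fg; apply: Nx; apply: fgN => /= /(_ Dx).
Qed.

(* [filterS] cannot infer the filter when [mu] is [lebesgue_measure]. *)
Lemma ae_imp d (T : measurableType d) (R : realType)
    (mu : {measure set T -> \bar R}) (P Q : T -> Prop) :
  (forall x, P x -> Q x) -> {ae mu, forall x, P x} -> {ae mu, forall x, Q x}.
Proof. by move=> PQ; apply: filterS. Qed.

Lemma ae_imp2 d (T : measurableType d) (R : realType)
    (mu : {measure set T -> \bar R}) (P Q S : T -> Prop) :
  (forall x, P x -> Q x -> S x) ->
  {ae mu, forall x, P x} -> {ae mu, forall x, Q x} -> {ae mu, forall x, S x}.
Proof. by move=> PQ; apply: filterS2. Qed.

(** * Bochner integrals through a perfect pairing *)

Lemma lipschitz_continuous (R : realType) (X : normedModType R)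
    (F : X -> R) (c : R) :
  (forall x y, `|F x - F y| <= c * `|x - y|) -> continuous F.
Proof.
move=> Fc x; apply/cvgrPdist_lt => e e0.
have c0 : 0 < `|c| + 1 by rewrite ltr_wpDl.
near=> y.
apply: (le_lt_trans (Fc x y)).
apply: (@le_lt_trans _ _ ((`|c| + 1) * `|x - y|)).
  by apply: ler_wpM2r => //; rewrite (le_trans (ler_norm c))// lerDl.
rewrite mulrC -ltr_pdivlMr//.
near: y; apply: cvgr_dist_lt => //.
exact: divr_gt0.
Unshelve. all: by end_near. Qed.

Section pairing.
Context (R : realType) (X Y : normedModType R).

(** An isomorphism of [X] onto the dual of [Y], the model being [<B(phi) v, w>]. [pairing_norming]
    is the bound on the inverse; quantifying over the bounds [c] avoids the extended real
    [dual_norm]. *)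
Record perfect_pairing (M : R) (L : X -> Y -> R) : Prop := {
  pairing_gt0 : 0 < M ;
  pairing_linearl : forall w a u v, L (a *: u + v) w = a * L u w + L v w ;
  pairing_linearr : forall v a w1 w2, L v (a *: w1 + w2) = a * L v w1 + L v w2 ;
  pairing_le : forall v w, `|L v w| <= M * `|v| * `|w| ;
  pairing_norming : forall v c, 0 <= c ->
    (forall w, `|L v w| <= c * `|w|) -> `|v| <= M * c ;
  pairing_onto : forall F : Y -> R,
    (forall a w1 w2, F (a *: w1 + w2) = a * F w1 + F w2) ->
    (exists c, forall w, `|F w| <= c * `|w|) ->
    exists v, forall w, L v w = F w }.

Variables (M : R) (L : X -> Y -> R).
Hypothesis HL : perfect_pairing M L.

Local Notation leb := (@lebesgue_measure R).

Lemma pairing0l w : L 0 w = 0.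
Proof.
have := pairing_linearl HL w 1 0 0; rewrite scaler0 addr0 mul1r.
by move=> /eqP; rewrite addrC -subr_eq subrr eq_sym => /eqP.
Qed.

Lemma pairingDl u v w : L (u + v) w = L u w + L v w.
Proof. by have := pairing_linearl HL w 1 u v; rewrite scale1r mul1r. Qed.

Lemma pairingZl a v w : L (a *: v) w = a * L v w.
Proof.
by have := pairing_linearl HL w a v 0; rewrite addr0 pairing0l addr0.
Qed.

Lemma pairingNl v w : L (- v) w = - L v w.
Proof. by rewrite -scaleN1r pairingZl mulN1r. Qed.

Lemma pairingBl u v w : L (u - v) w = L u w - L v w.
Proof. by rewrite pairingDl pairingNl. Qed.

Lemma pairing_continuous w : continuous (L ^~ w).
Proof.
apply: (@lipschitz_continuous R X (L^~ w) (M * `|w|)) => x y.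
by rewrite -pairingBl (le_trans (pairing_le HL _ _))// mulrAC.
Qed.

Lemma pairing_inj u v : (forall w, L u w = L v w) -> u = v.
Proof.
move=> uv; apply/eqP; rewrite -subr_eq0 -normr_le0 -(mulr0 M).
apply: (pairing_norming HL) => // w.
by rewrite pairingBl uv subrr normr0 mul0r.
Qed.

Lemma pairing_measurable (u : R -> X) w :
  simple_limit u -> measurable_fun setT (fun t => L (u t) w).
Proof.
move=> su; apply: simple_limit_measurable.
exact: (@simple_limit_comp R X R (L^~ w) u (@pairing_continuous w) su).
Qed.

Lemma integrable_pairing D (u : R -> X) w : measurable D -> simple_limit u ->
  leb.-integrable D (EFin \o (fun t => `|u t|)) ->
  leb.-integrable D (EFin \o (fun t => L (u t) w)).
Proof.
move=> mD su iu.
apply: (@le_integrable _ _ _ _ _ mD _ (EFin \o (fun t => M * `|w| * `|u t|))).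
- apply/measurable_EFinP; apply: measurable_funTS; exact: pairing_measurable.
- move=> t Dt /=; rewrite lee_fin [leRHS]ger0_norm.
    by rewrite (le_trans (pairing_le HL _ _))// mulrAC.
  by rewrite !mulr_ge0// ltW// (pairing_gt0 HL).
- exact: (integrableZl mD (M * `|w|) iu).
Qed.

Lemma le_Rintegral_pairing D (u : R -> X) w : measurable D -> simple_limit u ->
  leb.-integrable D (EFin \o (fun t => `|u t|)) ->
  `|\int[leb]_(t in D) L (u t) w| <= M * `|w| * \int[leb]_(t in D) `|u t|.
Proof.
move=> mD su iu.
have iL := integrable_pairing w mD su iu.
apply: (le_trans (le_normr_Rintegral mD iL)).
rewrite -RintegralZl//; apply: le_Rintegral => //.
- exact: integrable_norm.
- exact: (integrableZl mD (M * `|w|) iu).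
- by move=> t _; rewrite (le_trans (pairing_le HL _ _))// mulrAC.
Qed.

Lemma weak_integral D (u : R -> X) : measurable D -> simple_limit u ->
  leb.-integrable D (EFin \o (fun t => `|u t|)) ->
  exists v, forall w, L v w = \int[leb]_(t in D) L (u t) w.
Proof.
move=> mD su iu; apply: (pairing_onto HL) => [a w1 w2|].
  have i1 := integrable_pairing w1 mD su iu.
  have i2 := integrable_pairing w2 mD su iu.
  rewrite -RintegralZl// -RintegralD//; last exact: (integrableZl mD a i1).
  by apply: eq_Rintegral => t _; exact: (pairing_linearr HL).
exists (M * \int[leb]_(t in D) `|u t|) => w.
by rewrite mulrAC; exact: le_Rintegral_pairing.
Qed.

Lemma simple_simple_limit (s : R -> X) : simple s -> simple_limit s.
Proof. by move=> ss; exists (fun=> s) => // t; exact: cvg_cst. Qed.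

Lemma measurable_0T (T : R) :
  measurable (`]0, T[%classic : set (measurableTypeR R)).
Proof. exact: measurable_itv. Qed.

Lemma lebesgue_oo_lty (T : R) : (leb `]0%R, T[ < +oo)%E.
Proof. by rewrite lebesgue_measure_itv/=; case: ifPn => // _; rewrite ltry. Qed.

Lemma mem_fset_range (s : R -> X) t : simple s ->
  s t \in finmap.enum_fset (fset_set (range s)).
Proof.
by move=> [fs _]; have -> := in_fset_set fs (s t); rewrite mem_set//; exists t.
Qed.

Lemma integrable_simple T (s : R -> X) : simple s ->
  leb.-integrable `]0, T[ (EFin \o (fun t => `|s t|)).
Proof.
move=> ss; apply: measurable_bounded_integrable => //; first exact: lebesgue_oo_lty.
- by apply: measurable_funTS; apply: simple_limit_norm; exact: simple_simple_limit.
- exists (\sum_(x <- finmap.enum_fset (fset_set (range s))) `|x|); split.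
    by rewrite num_real.
  move=> c cc t _ /=; apply: (le_trans _ (ltW cc)); rewrite normr_id.
  have ts := mem_fset_range t ss.
  rewrite (big_rem (s t))//= lerDl.
  by apply: sumr_ge0.
Qed.

Lemma pairing_sum (I : Type) (r : seq I) (F : I -> X) w :
  L (\sum_(i <- r) F i) w = \sum_(i <- r) L (F i) w.
Proof.
apply: (big_morph (L^~ w)); last exact: pairing0l.
by move=> u v; rewrite pairingDl.
Qed.

Lemma simple_integral_pairing T (s : R -> X) w : simple s ->
  L (simple_integral T s) w = \int[leb]_(t in `]0, T[) L (s t) w.
Proof.
move=> ss; have fs := ss.1.
rewrite /simple_integral fsbig_finite// pairing_sum.
pose r := finmap.enum_fset (fset_set (range s)).
(* Among the finitely many values [x] of [s], only [x = s t] has a nonzero indicator at [t]. *)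
have -> : \int[leb]_(t in `]0, T[) L (s t) w =
    \int[leb]_(t in `]0, T[)
      (\sum_(x <- r) L x w * \1_(s @^-1` [set x]) t).
  apply: eq_Rintegral => t _.
  have ts := mem_fset_range t ss.
  rewrite (big_rem (s t))//= indicE mem_set// mulr1 big1_seq ?addr0// => x /andP[_].
  rewrite mem_rem_uniq ?finmap.fset_uniq// inE => /andP[xst _].
  by rewrite indicE memNset ?mulr0// => /= /esym/eqP; rewrite (negbTE xst).
have lT := lebesgue_oo_lty T.
have i1 x : leb.-integrable `]0, T[ (EFin \o (\1_(s @^-1` [set x]) : R -> R)).
  apply: measurable_bounded_integrable => //.
    apply: measurable_funTS; apply: measurable_indic.
    exact: ss.2.
  exists 1; split => // c c1 t _ /=.
  by rewrite indicE; case: (_ \in _); rewrite ?normr1 ?normr0 ltW// (lt_trans _ c1).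
have i2 x : leb.-integrable `]0, T[
    (EFin \o (fun t => L x w * \1_(s @^-1` [set x]) t)).
  exact: (integrableZl (measurable_0T T) (L x w) (i1 x)).
rewrite /Rintegral.
under [in RHS]eq_integral do rewrite -sumEFin.
rewrite (@integral_sum _ _ _ leb _ _ X _ i2)// -sum_fine; last first.
  move=> x _; apply: integrable_fin_num => //; exact: i2.
apply: eq_bigr => x _.
transitivity (\int[leb]_(t in `]0, T[) (L x w * \1_(s @^-1` [set x]) t)) => //.
rewrite pairingZl mulrC RintegralZl//.
rewrite /Rintegral integral_indic//; last exact: ss.2.
by rewrite setIC.
Qed.

Lemma simple_integral_dist T (s u : R -> X) w : simple s -> simple_limit u ->
  leb.-integrable `]0, T[ (EFin \o (fun t => `|u t|)) ->
  leb.-integrable `]0, T[ (EFin \o (fun t => `|u t - s t|)) /\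
  `|L (simple_integral T s) w - \int[leb]_(t in `]0, T[) L (u t) w| <=
     M * `|w| * \int[leb]_(t in `]0, T[) `|u t - s t|.
Proof.
move=> ss su iu.
have s1 := simple_simple_limit ss.
have sus : simple_limit (fun t => u t - s t).
  by apply: simple_limitD => //; exact: simple_limitN.
have is_ := integrable_simple T ss.
have ius : leb.-integrable `]0, T[ (EFin \o (fun t => `|u t - s t|)).
  apply: (@le_integrable _ _ _ _ _ (measurable_0T T) _
    (EFin \o (fun t => `|u t| + `|s t|))).
  - apply/measurable_EFinP; apply: measurable_funTS; exact: simple_limit_norm.
  - move=> t _ /=; rewrite lee_fin normr_id [leRHS]ger0_norm ?addr_ge0//.
    exact: ler_normB.
  - exact: (integrableD (measurable_0T T) iu is_).
split=> //.
rewrite simple_integral_pairing// -RintegralB//.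
- under eq_Rintegral do rewrite -pairingBl -opprB pairingNl.
  rewrite (_ : \int[leb]_(t in `]0, T[) - L (u t - s t) w =
               - \int[leb]_(t in `]0, T[) L (u t - s t) w).
    by rewrite normrN; exact: le_Rintegral_pairing.
  rewrite -mulN1r -RintegralZl//; last exact: integrable_pairing.
  by under [in RHS]eq_Rintegral do rewrite mulN1r.
- exact: integrable_pairing.
- exact: integrable_pairing.
Qed.

(** [v] is a measurable version of [u], which itself need not be measurable. The mean distance of
    [v] to the simple functions is dominated by that of [u]; pairing with [w] is continuous, so both
    sides are limits of the paired simple integrals. *)
Lemma bochner_integral_pairing T (u v : R -> X) x w : bochner_integral_is T u x ->
  simple_limit v -> leb.-integrable `]0, T[ (EFin \o (fun t => `|v t|)) ->
  {ae leb, forall t, t \in `]0, T[ -> u t = v t} ->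
  L x w = \int[leb]_(t in `]0, T[) L (v t) w.
Proof.
move=> [s [ss _ us0 sx]] sv iv uv.
have sus k : simple_limit (fun t => v t - s k t).
  by apply: simple_limitD => //; apply: simple_limitN; exact: simple_simple_limit.
have vs0 : \int[leb]_(t in `]0, T[) `|v t - s k t| @[k --> \oo] --> 0.
  apply: fine_cvg; apply: (squeeze_cvge _ _ us0); last exact: cvg_cst.
  near=> k; rewrite integral_ge0//=.
  apply: le_ae_integral => //.
  - apply/measurable_EFinP; apply: measurable_funTS; exact: simple_limit_norm.
  - by apply: (ae_imp _ uv) => t utv tT; rewrite utv.
apply: (@cvg_unique R _ (L (simple_integral T (s k)) w @[k --> \oo])) => //.
- exact: (@continuous_cvg _ X R _ _ _ (L^~ w) _ (@pairing_continuous w x) sx).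
- apply/cvgrPdist_le => e e0.
  have c0 : 0 < M * `|w| + 1.
    by rewrite ltr_wpDl// mulr_ge0// ltW// (pairing_gt0 HL).
  near=> k.
  have [_] := simple_integral_dist w (ss k) sv iv.
  rewrite distrC => /le_trans; apply.
  have I0 : 0 <= \int[leb]_(t in `]0, T[) `|v t - s k t|.
    by rewrite Rintegral_ge0.
  apply: (@le_trans _ _ ((M * `|w| + 1) * \int[leb]_(t in `]0, T[) `|v t - s k t|)).
    by apply: ler_wpM2r => //; rewrite lerDl.
  rewrite mulrC -ler_pdivlMr//.
  near: k.
  apply: (filterS _ (@cvgr_dist_le R R _ _ _ _ _ vs0 _ (divr_gt0 e0 c0))) => k.
  rewrite sub0r normrN.
  by apply: le_trans; exact: ler_norm.
Unshelve. all: by end_near. Qed.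

(** The candidate is the weak integral. Simple functions truncated to [|s k| <= 2 |u|] converge to
    [u] in mean by dominated convergence, and [pairing_norming] turns the tested estimates into
    convergence of the simple integrals in [X]. *)
Lemma bochner_integral_exists T (u : R -> X) : simple_limit u ->
  leb.-integrable `]0, T[ (EFin \o (fun t => `|u t|)) ->
  exists x, bochner_integral_is T u x.
Proof.
move=> su iu; have [s0 ss0 s0u] := su.
have mu := simple_limit_norm su.
(* Where [u t != 0], the point [t] is eventually in [A k] since [|u t| < 2 |u t|]; where [u t = 0],
   the truncated value is 0 for every [k]. *)
pose A k := [set t | `|s0 k t| <= 2 * `|u t|].
have mA k : measurable (A k).
  rewrite -[A k]setTI; apply: measurable_fun_le => //.
    by apply: simple_limit_norm; exact: (simple_simple_limit (ss0 k)).
  exact: measurable_funM.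
pose s k t := (\1_(A k) t : R) *: s0 k t.
have ss k : simple (s k).
  apply: (@simple_map2 R R X X (fun a x => a *: x) (\1_(A k)) (s0 k)) => //.
  exact: simple_map_indic.
have s_le k t : `|s k t| <= 2 * `|u t|.
  rewrite /s indicE; have [/set_mem At|_] := boolP (t \in A k).
    by rewrite scale1r.
  by rewrite scale0r normr0 mulr_ge0.
have sA k t : A k t -> s k t = s0 k t.
  by move=> At; rewrite /s indicE mem_set// scale1r.
have s_cvg t : s k t @[k --> \oo] --> u t.
  have [ut0|ut0] := eqVneq (u t) 0.
    rewrite ut0 (_ : (fun k => s k t) = fun=> 0); first exact: cvg_cst.
    apply/funext => k; apply/eqP; rewrite -normr_le0.
    by rewrite (le_trans (s_le k t))// ut0 normr0 mulr0.
  apply: cvg_trans (s0u t); apply: near_eq_cvg.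
  have : `|s0 k t| @[k --> \oo] --> `|u t| by exact: cvg_norm.
  move=> /cvgr_lt/(_ (2 * `|u t|)); rewrite ltr_pMl ?normr_gt0// ltr1n => /(_ isT).
  by apply: filterS => k sk; rewrite sA//; exact: ltW.
have [x xE] := weak_integral (measurable_0T T) su iu.
have mus k : measurable_fun `]0, T[ (fun t => (`|u t - s k t|)%:E).
  apply/measurable_EFinP; apply: measurable_funTS; apply: simple_limit_norm.
  by apply: simple_limitD => //; apply: simple_limitN; exact: simple_simple_limit.
have us_cvg : {ae leb, forall t, `]0, T[%classic t ->
    (`|u t - s k t|)%:E @[k --> \oo] --> 0%E}.
  apply: aeW => t _; apply: cvg_EFin; first exact: nearW.
  have /cvg_norm : u t - s k t @[k --> \oo] --> (0 : X).
    by rewrite -(subrr (u t)); apply: cvgB; [exact: cvg_cst|exact: s_cvg].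
  by rewrite normr0.
have us_le : {ae leb, forall t, forall k, `]0, T[%classic t ->
    (`|(`|u t - s k t|)%:E| <= (3 * `|u t|)%:E)%E}.
  apply: aeW => t k _ /=; rewrite lee_fin normr_id.
  rewrite (le_trans (ler_normB _ _))//.
  have -> : 3 * `|u t| = `|u t| + 2 * `|u t| by ring.
  by rewrite lerD2l.
have [_ us0 _] := dominated_convergence (measurable_0T T) mus (measurable_cst _)
  us_cvg (integrableZl (measurable_0T T) 3 iu) us_le.
have us0' : (\int[leb]_(t in `]0%R, T[) `|u t - s k t|%:E)%E @[k --> \oo] --> 0%E.
  apply: cvg_trans us0; apply: near_eq_cvg; apply: nearW => k.
  by apply: eq_integral => t _ /=; rewrite subr0 normr_id.
exists x, s; split => //; first by apply: aeW => t _.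
have I0 k : 0 <= \int[leb]_(t in `]0, T[) `|u t - s k t|.
  by rewrite Rintegral_ge0.
apply/cvgrPdist_le => e e0.
have c0 : 0 < M * M by rewrite mulr_gt0// (pairing_gt0 HL).
near=> k.
rewrite distrC.
apply: (@le_trans _ _ (M * (M * \int[leb]_(t in `]0, T[) `|u t - s k t|))).
  apply: (pairing_norming HL) => [|w].
    by rewrite mulr_ge0// ltW// (pairing_gt0 HL).
  have [_] := simple_integral_dist w (ss k) su iu.
  by rewrite pairingBl xE => /le_trans; apply; rewrite mulrAC.
rewrite mulrA mulrC -ler_pdivlMr//.
near: k.
apply: (filterS _ (@cvgr_dist_le R R _ _ _ _ _ (fine_cvg us0') _
  (divr_gt0 e0 c0))) => k.
rewrite sub0r normrN.
  by apply: le_trans; exact: ler_norm.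
Unshelve. all: by end_near. Qed.

End pairing.

(** * Weak derivatives of scalar functions *)

Section interval_integrals.
Context (R : realType).
Local Notation leb := (@lebesgue_measure R).
Implicit Types (a b k : R -> R) (T : R).

Lemma integrable_cc (x y : R) k : measurable_fun setT k ->
  leb.-integrable `]x, y[ (EFin \o k) -> leb.-integrable `[x, y] (EFin \o k).
Proof.
move=> mk /integrableP[_ ik]; apply/integrableP; split.
  by apply/measurable_EFinP; exact: measurable_funTS.
apply: le_lt_trans ik; rewrite le_eqVlt; apply/orP; left; apply/eqP.
have mabs (i : interval R) : measurable_fun [set` i] (fun t => `|(EFin \o k) t|%E).
  apply: measurable_funTS; apply: measurableT_comp => //.
  exact/measurable_EFinP.
by rewrite integral_itv_bndo_bndc// integral_itv_obnd_cbnd.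
Qed.

Lemma Rintegral_oo_cc (x y : R) k : leb.-integrable `[x, y] (EFin \o k) ->
  \int[leb]_(t in `]x, y[) k t = \int[leb]_(t in `[x, y]) k t.
Proof.
move=> ik; rewrite Rintegral_itv_bndo_bndc; last first.
  by apply: integrableS ik => //; apply: subset_itv_oo_cc.
rewrite Rintegral_itv_obnd_cbnd//.
by apply: integrableS ik => //; apply: subset_itv_oc_cc.
Qed.

Lemma integrable_patch (A : set R) k : measurable A ->
  leb.-integrable A (EFin \o k) -> leb.-integrable setT (EFin \o (k \_ A)).
Proof. by move=> mA /integrable_mkcond; rewrite restrict_EFin; apply. Qed.

Lemma integrable_prod_mul (f g : R -> R) :
  leb.-integrable setT (EFin \o f) -> leb.-integrable setT (EFin \o g) ->
  (leb \x leb)%E.-integrable setT (EFin \o (fun z : R * R => f z.1 * g z.2)).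
Proof.
move=> iF iG.
have /measurable_EFinP mf := measurable_int _ iF.
have /measurable_EFinP mg := measurable_int _ iG.
apply/integrable12ltyP.
  apply/measurable_EFinP; apply: measurable_funM.
    exact: (measurableT_comp mf).
  exact: (measurableT_comp mg).
under eq_integral => x _.
  under eq_integral do rewrite /= normrM EFinM.
  rewrite ge0_integralZl//; last first.
    by apply/measurable_EFinP; exact: measurableT_comp.
  over.
have /integrableP[_ iF'] := iF; have /integrableP[_ iG'] := iG.
have g0 : (0 <= \int[leb]_x `|g x|%:E)%E by apply: integral_ge0.
have gfin : (\int[leb]_x `|g x|%:E)%E \is a fin_num by rewrite ge0_fin_numE.
rewrite ge0_integralZr//=; last first.
  by apply/measurable_EFinP; exact: measurableT_comp.
by rewrite lte_mul_pinfty ?integral_ge0// ge0_fin_numE ?integral_ge0.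
Qed.

(** Both sides are iterated integrals of [a t * b s] over the triangle [s <= t]; extension by zero
    outside [[0, T]] and the indicator of [D] carry it to the whole plane. *)
Lemma triangle_fubini T a b :
  leb.-integrable `[0, T] (EFin \o a) -> leb.-integrable `[0, T] (EFin \o b) ->
  \int[leb]_(t in `[0, T]) (a t * \int[leb]_(s in `[0, t]) b s) =
  \int[leb]_(s in `[0, T]) (b s * \int[leb]_(t in `[s, T]) a t).
Proof.
move=> ia ib.
pose a1 := a \_ `[0, T]; pose b1 := b \_ `[0, T].
have ia1 : leb.-integrable setT (EFin \o a1) by exact: integrable_patch.
have ib1 : leb.-integrable setT (EFin \o b1) by exact: integrable_patch.
pose D := [set z : R * R | z.2 <= z.1].
have mD : measurable D.
  rewrite -[D]setTI; exact: measurable_fun_le.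
pose f z := (a1 z.1 * b1 z.2 * \1_D z)%:E.
have iab := integrable_prod_mul ia1 ib1.
have /measurable_EFinP mab := measurable_int _ iab.
have intf : (leb \x leb)%E.-integrable setT f.
  apply: le_integrable iab => //.
    apply/measurable_EFinP; apply: measurable_funM => //.
  move=> z _; rewrite /f/= lee_fin normrM ler_piMr// indicE.
  by case: (_ \in _); rewrite ?normr1 ?normr0.
have := congr1 fine (Fubini intf).
have -> : (\int[leb]_x \int[leb]_y f (x, y))%E =
    (\int[leb]_(t in `[0%R, T]) (a t * \int[leb]_(s in `[0, t]) b s)%:E)%E.
  rewrite [RHS]integral_mkcond; apply: eq_integral => t _.
  rewrite patchE; case: ifPn => [|tT]; last first.
    rewrite integral0_eq// => s _; rewrite /f/= /a1 patchE.
    by rewrite (negbTE tT) !mul0r.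
  rewrite inE/= in_itv/= => /andP[t0 tT].
  have itT : leb.-integrable `[0, t] (EFin \o b).
    by apply: integrableS ib => //; apply: subset_itvl; rewrite bnd_simp.
  rewrite -RintegralZl// /Rintegral fineK; last first.
    apply: integrable_fin_num => //; exact: (integrableZl _ (a t) itT).
  rewrite [RHS]integral_mkcond; apply: eq_integral => s _.
  rewrite /f/= /a1 /b1 !patchE mem_set/=; last by rewrite in_itv/= t0 tT.
  rewrite indicE; have [st|ts] := leP s t.
    rewrite [(t, s) \in D]mem_set// mulr1.
    have -> : (s \in `[0, t]%classic) = (s \in `[0, T]%classic).
      by rewrite !mem_setE !in_itv/= st (le_trans st tT).
    by case: ifPn; rewrite // mulr0.
  rewrite [(t, s) \in D]memNset/= ?mulr0; last by rewrite /D/= leNgt ts.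
  by rewrite memNset//= in_itv/= [s <= t]leNgt ts andbF.
have -> : (\int[leb]_y \int[leb]_x f (x, y))%E =
    (\int[leb]_(s in `[0%R, T]) (b s * \int[leb]_(t in `[s, T]) a t)%:E)%E.
  rewrite [RHS]integral_mkcond; apply: eq_integral => s _.
  rewrite patchE; case: ifPn => [|sT]; last first.
    rewrite integral0_eq// => t _; rewrite /f/= /b1 patchE.
    by rewrite (negbTE sT) mulr0 mul0r.
  rewrite inE/= in_itv/= => /andP[s0 sT].
  have isT : leb.-integrable `[s, T] (EFin \o a).
    by apply: integrableS ia => //; apply: subset_itvr; rewrite bnd_simp.
  rewrite -RintegralZl// /Rintegral fineK; last first.
    apply: integrable_fin_num => //; exact: (integrableZl _ (b s) isT).
  rewrite [RHS]integral_mkcond; apply: eq_integral => t _.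
  rewrite /f/= /a1 /b1 !patchE [s \in _]mem_set/=; last by rewrite in_itv/= s0 sT.
  rewrite indicE; have [st|ts] := leP s t.
    rewrite [(t, s) \in D]mem_set// mulr1 mulrC.
    have -> : (t \in `[s, T]%classic) = (t \in `[0, T]%classic).
      by rewrite !mem_setE !in_itv/= st (le_trans s0 st).
    by case: ifPn; rewrite // mulr0.
  rewrite [(t, s) \in D]memNset/= ?mulr0; last by rewrite /D/= leNgt ts.
  by rewrite memNset//= in_itv/= leNgt ts.
by [].
Qed.

End interval_integrals.

(** * Primitives and integration by parts on [[0, T]] *)

Section primitives.
Context (R : realType).
Local Notation leb := (@lebesgue_measure R).
Implicit Types (f k : R -> R) (T : R).

(** The projection of the line onto [[0, T]]: composing with it turns continuity within the interval
    into continuity on the line and keeps the values on [[0, T]]. *)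
Definition clamp T (t : R) : R := Num.max 0 (Num.min t T).

Lemma clamp_continuous T : continuous (clamp T).
Proof.
move=> x; apply: (@continuous_max R R (fun=> 0) (fun t => Num.min t T)).
  exact: cvg_cst.
by apply: (@continuous_min R R id (fun=> T)); [exact: cvg_id|exact: cvg_cst].
Qed.

Lemma clamp_itv T t : 0 <= T -> clamp T t \in `[0, T].
Proof.
move=> T0; rewrite in_itv/= /clamp le_max lexx/=.
by rewrite ge_max T0 ge_min lexx orbT.
Qed.

Lemma clamp_id T t : t \in `[0, T] -> clamp T t = t.
Proof.
rewrite in_itv/= /clamp => /andP[t0 tT].
by rewrite min_l// max_r.
Qed.

Lemma continuous_clamp T (Z : topologicalType) (u : R -> Z) : 0 <= T ->
  {within `[0, T], continuous u} -> continuous (u \o clamp T).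
Proof.
move=> T0 /subspace_continuousP cu x W nW.
have := cu _ (clamp_itv x T0) W nW.
rewrite /= nbhs_simpl /within/= => nu.
have := clamp_continuous nu.
rewrite nbhs_simpl/=; apply: filterS => y /=; apply.
exact: clamp_itv.
Qed.

Lemma continuous_integrable f a b : continuous f ->
  leb.-integrable `[a, b] (EFin \o f).
Proof.
move=> cf; apply: continuous_compact_integrable; first exact: segment_compact.
exact: continuous_subspaceT.
Qed.

Lemma is_derive_continuous f (df : R -> R) :
  (forall x : R, is_derive x 1 f (df x)) -> continuous f.
Proof.
move=> dF x; apply: differentiable_continuous.
by apply/derivable1_diffP; exact: ex_derive.
Qed.

Lemma Rintegral_FTC f (F : R -> R) a b : a <= b -> continuous f ->
  (forall x : R, is_derive x 1 F (f x)) ->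
  \int[leb]_(t in `[a, b]) f t = F b - F a.
Proof.
rewrite le_eqVlt => /predU1P[->|ab] cf dF.
  by rewrite set_itv1 Rintegral_set1 subrr.
rewrite /Rintegral (@continuous_FTC2 _ f F)//.
- exact: continuous_subspaceT.
- have cF := is_derive_continuous dF.
  split => [x _|//|]; first exact: ex_derive.
  + apply: cvg_at_right_filter; exact: cF.
  + apply: cvg_at_left_filter; exact: cF.
- by move=> x _; rewrite derive1E derive_val.
Qed.

Lemma primitive_continuous T k : 0 < T ->
  leb.-integrable `[0, T] (EFin \o k) ->
  {within `[0, T], continuous (fun t => \int[leb]_(s in `[0, t]) k s)}.
Proof. by move=> T0; apply: parameterized_integral_continuous; exact: ltW. Qed.

Lemma test_function_is_derive T (psi : R -> R) : Cc_infty_itv T psi ->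
  [/\ forall t : R, is_derive t 1 psi (derive1 psi t), continuous (derive1 psi),
      psi 0 = 0 & psi T = 0].
Proof.
move=> [dpsi _ supp_psi]; split.
- move=> t; apply: DeriveDef; first exact: (dpsi 0%N t).
  by rewrite derive1E.
- move=> x; apply: differentiable_continuous; apply/derivable1_diffP.
  exact: (dpsi 1%N x).
- apply/eqP; apply: contraT => psi0.
  have /supp_psi : closure [set t | psi t != 0] 0 by exact: subset_closure.
  by rewrite /= in_itv/= ltxx.
- apply/eqP; apply: contraT => psiT.
  have /supp_psi : closure [set t | psi t != 0] T by exact: subset_closure.
  by rewrite /= in_itv/= ltxx andbF.
Qed.

(** As [k] is merely integrable, its primitive need not be differentiable everywhere. Exchanging the
    order of integration leaves the integral of the derivative of [psi] over [[s, T]], which is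
    [- psi s]. *)
Lemma integration_by_parts_test T k psi : 0 < T -> Cc_infty_itv T psi ->
  leb.-integrable `[0, T] (EFin \o k) ->
  \int[leb]_(t in `[0, T]) (derive1 psi t * \int[leb]_(s in `[0, t]) k s) =
  - \int[leb]_(s in `[0, T]) (psi s * k s).
Proof.
move=> T0 /test_function_is_derive[dpsi cpsi' psi0 psiT] ik.
have cpsi := is_derive_continuous dpsi.
rewrite triangle_fubini//; last exact: continuous_integrable.
rewrite -mulN1r -RintegralZl//; last first.
  have [M [Mr Mpsi]] : bounded_set [set psi x | x in `[0, T]].
    apply: compact_bounded; apply: continuous_compact.
      exact: continuous_subspaceT.
    exact: segment_compact.
  apply: (integrableMr _ _ _ ik) => //.
    by apply: measurable_funTS; exact: continuous_measurable_fun.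
  by exists M; split => // c Mc t tT; apply: (Mpsi c Mc); exists t.
apply: eq_Rintegral => s; rewrite inE/= in_itv/= => /andP[s0 sT].
by rewrite (Rintegral_FTC (F := psi))// psiT sub0r mulN1r mulrC mulNr.
Qed.

(** The integral of [expR (2 * K * s)] over [[0, t]] is at most [expR (2 * K * t) / (2 * K)]: the 2
    in the exponent becomes the contraction factor one half. *)
Lemma Rintegral_exp_le (q : R -> R) (K D t : R) : 0 < K -> 0 <= t ->
  leb.-integrable `[0, t] (EFin \o q) ->
  (forall s, s \in `[0, t] -> q s <= D * expR (2 * K * s)) -> 0 <= D ->
  K * \int[leb]_(s in `[0, t]) q s <= D / 2 * expR (2 * K * t).
Proof.
move=> K0 t0 iq qD D0.
pose F s := D / (2 * K) * expR (2 * K * s).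
have dF (s : R) : is_derive s 1 F (D * expR (2 * K * s)).
  have h1 : is_derive s 1 (fun s => 2 * K * s) (2 * K).
    rewrite -[X in is_derive _ _ _ X]mulr1; exact: is_deriveZ.
  have h2 : is_derive s 1 (expR \o (fun s => 2 * K * s))
    (expR (2 * K * s) * (2 * K)) by exact: is_derive1_comp.
  have h3 : is_derive s 1 F (D / (2 * K) * (expR (2 * K * s) * (2 * K))).
    exact: is_deriveZ.
  suff <- : D / (2 * K) * (expR (2 * K * s) * (2 * K)) = D * expR (2 * K * s).
    exact: h3.
  by field; rewrite gt_eqF.
have cf : continuous (fun s => D * expR (2 * K * s)).
  move=> s; apply: cvgM; first exact: cvg_cst.
  apply: (@continuous_comp _ _ _ (fun s : R => 2 * K * s) expR).
    by apply: cvgM; [exact: cvg_cst|exact: cvg_id].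
  exact: continuous_expR.
apply: (@le_trans _ _ (K * \int[leb]_(s in `[0, t]) (D * expR (2 * K * s)))).
  rewrite ler_pM2l//; apply: le_Rintegral => //.
  exact: continuous_integrable.
rewrite (Rintegral_FTC t0 cf dF) /F mulr0 expR0 mulr1 mulrBr lerBlDr.
have -> : K * (D / (2 * K) * expR (2 * K * t)) = D / 2 * expR (2 * K * t).
  by field; rewrite gt_eqF.
by rewrite lerDl mulr_ge0 ?(ltW K0)// divr_ge0// mulr_ge0// ltW.
Qed.

End primitives.

(** * A smooth step function *)

Section smooth_step.
Context (R : realType).
Implicit Types (n : nat) (x : R).

(** The powers belong to the family so that it is closed under differentiation up to linear
    combinations. *)
Definition flat n x : R := if 0 < x then x^-1 ^+ n * expR (- x^-1) else 0.

Lemma flat_ge0 n x : 0 <= flat n x.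
Proof.
rewrite /flat; case: ifPn => // x0.
by rewrite mulr_ge0 ?expR_ge0// exprn_ge0// invr_ge0 ltW.
Qed.

Lemma flat_gt0 n x : 0 < x -> 0 < flat n x.
Proof. by move=> x0; rewrite /flat x0 mulr_gt0 ?expR_gt0// exprn_gt0// invr_gt0. Qed.

Lemma flat_le0 n x : x <= 0 -> flat n x = 0.
Proof. by move=> x0; rewrite /flat ltNge x0. Qed.

(** The exponential series gives [y ^ (n + 2) / (n + 2)! <= exp y] at [y = 1 / x]; the two spare
    powers provide the quadratic decay that makes the derivative at 0 vanish. *)
Lemma flat_le_sqr n x : flat n x <= (n.+2)`!%:R * x ^+ 2.
Proof.
have [x0|x0] := leP x 0; first by rewrite flat_le0// mulr_ge0// sqr_ge0.
rewrite /flat x0 expRN.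
have y0 : 0 <= x^-1 by rewrite invr_ge0 ltW.
have := expR_ge1Dxn n.+1 y0; set F := _`!%:R => h.
have F0 : 0 < F :> R by rewrite ltr0n fact_gt0.
rewrite ler_pdivrMr ?expR_gt0//.
have {}h : x^-1 ^+ n.+2 / F <= expR x^-1 by apply: le_trans h; rewrite lerDr.
apply: (@le_trans _ _ (F * x ^+ 2 * (x^-1 ^+ n.+2 / F))); last first.
  by rewrite ler_wpM2l// mulr_ge0 ?sqr_ge0// ltW.
rewrite le_eqVlt; apply/orP; left; apply/eqP.
have -> : x^-1 ^+ n.+2 = x^-1 ^+ n * x^-1 ^+ 2 by rewrite -exprD addn2.
move: (x^-1 ^+ n) => y; field.
by rewrite (gt_eqF x0) (gt_eqF F0).
Qed.

Lemma is_derive_sqr_bound (f : R -> R) (C : R) :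
  (forall x, `|f x| <= C * x ^+ 2) -> is_derive (0 : R) 1 f 0.
Proof.
move=> fC.
have f0 : f 0 = 0 by apply/eqP; rewrite -normr_le0 (le_trans (fC 0))// expr0n mulr0.
have lim0 : h^-1 *: ((f \o shift 0) (h *: 1) - f 0) @[h --> (0 : R)^'] --> (0 : R).
  apply/cvgrPdist_le => e e0.
  have C0 : 0 < `|C| + 1 by rewrite ltr_wpDl.
  near=> h.
  have h0 : h != 0 by near: h; exact: nbhs_dnbhs_neq.
  rewrite sub0r normrN f0 subr0 /= addr0 normrZ [h *: 1]mulr1.
  rewrite normfV ler_pdivrMl ?normr_gt0//.
  apply: (le_trans (fC h)); rewrite -[h ^+ 2]ger0_norm ?sqr_ge0// normrX.
  apply: (@le_trans _ _ ((`|C| + 1) * `|h| ^+ 2)).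
    by rewrite ler_wpM2r ?sqr_ge0// (le_trans (ler_norm C))// lerDl.
  rewrite expr2 mulrCA ler_wpM2l// mulrC -ler_pdivlMr//.
  near: h; apply: dnbhs0_le; exact: divr_gt0.
apply: DeriveDef; first by apply/cvg_ex; exists 0.
exact: cvg_lim.
Unshelve. all: by end_near. Qed.

Lemma is_derive_flat n x : is_derive x 1 (flat n) (flat n.+2 x - n%:R * flat n.+1 x).
Proof.
have [x0|x0|->] := ltgtP x 0.
- rewrite !flat_le0 ?(ltW x0)// mulr0 subr0.
  apply: (@near_eq_is_derive _ _ _ (cst 0)).
  near=> y; rewrite flat_le0// ltW//.
  by near: y; exact: lt_nbhsl.
- rewrite /flat x0.
  apply: (@near_eq_is_derive _ _ _ (fun y : R => y^-1 ^+ n * expR (- y^-1))).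
    near=> y; rewrite ifT//.
    by near: y; exact: lt_nbhsr.
  have dV : is_derive x 1 (fun y : R => y^-1) (- x ^- 2 *: 1).
    by apply: is_deriveV; rewrite gt_eqF.
  have dE : is_derive x 1 (fun y : R => expR (- y^-1))
      (expR (- x^-1) * (- (- x ^- 2 *: 1))).
    have dN : is_derive x 1 (fun y : R => - y^-1) (- (- x ^- 2 *: 1)).
      exact: (is_deriveN dV).
    exact: (@is_derive1_comp R expR (fun y : R => - y^-1) _ _ _ _ dN).
  have dX : is_derive x 1 (fun y : R => y^-1 ^+ n)
      ((n%:R * x^-1 ^+ n.-1) *: (- x ^- 2 *: 1)).
    by have := is_deriveX n dV; rewrite exprfctE.
  apply: (is_derive_eq (is_deriveM dX dE)).
  rewrite /GRing.scale/= !mulr1.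
  case: n {dX} => [|n] /=; rewrite ?expr0 ?mul0r ?mulr0 ?exprS.
    by field; rewrite gt_eqF.
  by rewrite -(addn1 n) natrD; field; rewrite gt_eqF.
- rewrite !flat_le0// mulr0 subr0.
  apply: (@is_derive_sqr_bound _ (n.+2)`!%:R) => y.
  by rewrite ger0_norm ?flat_ge0// flat_le_sqr.
Unshelve. all: by end_near. Qed.

(** A syntactic substitute for [C^oo]: every member has a derivative that is again a member, so
    derivatives of all orders exist by induction on the order. *)
Inductive smooth_class : (R -> R) -> Prop :=
| smooth_flat n : smooth_class (flat n)
| smooth_add f g : smooth_class f -> smooth_class g ->
    smooth_class (fun x => f x + g x)
| smooth_mul f g : smooth_class f -> smooth_class g ->
    smooth_class (fun x => f x * g x)
| smooth_scale (a : R) f : smooth_class f -> smooth_class (fun x => a * f x)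
| smooth_affine (a b : R) f : smooth_class f -> smooth_class (fun x => f (a * x + b))
| smooth_inv f : (forall x, 0 < f x) -> smooth_class f ->
    smooth_class (fun x => (f x)^-1).

Lemma smooth_class_derive f : smooth_class f ->
  exists2 df, smooth_class df & forall x, is_derive x 1 f (df x).
Proof.
elim=> {f} [n|f g _ [df cdf dF] _ [dg cdg dG]|f g cf [df cdf dF] cg [dg cdg dG]|
  a f _ [df cdf dF]|a b f _ [df cdf dF]|f f0 cf [df cdf dF]].
- exists (fun x => flat n.+2 x + (- n%:R) * flat n.+1 x).
    by apply: smooth_add; [|apply: smooth_scale]; exact: smooth_flat.
  by move=> x; rewrite mulNr; exact: is_derive_flat.
- exists (fun x => df x + dg x); first exact: smooth_add.
  by move=> x; exact: is_deriveD.
- exists (fun x => f x * dg x + g x * df x).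
    by apply: smooth_add; exact: smooth_mul.
  by move=> x; exact: is_deriveM.
- exists (fun x => a * df x); first exact: smooth_scale.
  by move=> x; exact: is_deriveZ.
- exists (fun x => a * df (a * x + b)).
    by apply: smooth_scale; exact: smooth_affine.
  move=> x; rewrite mulrC; apply: (@is_derive1_comp R f (fun y => a * y + b)).
  have h1 : is_derive x 1 (fun y : R => a * y) (a * 1) by exact: is_deriveZ.
  have h2 : is_derive x 1 (fun y : R => a * y + b) (a * 1 + 0).
    by apply: is_deriveD.
  by rewrite mulr1 addr0 in h2.
- exists (fun x => -1 * (df x * ((f x)^-1 * (f x)^-1))).
    by apply: smooth_scale; apply: smooth_mul => //; apply: smooth_mul;
      exact: smooth_inv.
  move=> x; apply: (is_derive_eq (is_deriveV _ (dF x))).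
    by rewrite gt_eqF.
  rewrite /GRing.scale/=; field.
  by rewrite gt_eqF.
Qed.

Lemma smooth_class_derivable f : smooth_class f ->
  forall k x, derivable (derive1n k f) x 1.
Proof.
move=> cf k; elim: k f cf => [|k IH] f cf x.
  have [df _ dF] := smooth_class_derive cf.
  by rewrite derive1n0; exact: ex_derive.
have [df cdf dF] := smooth_class_derive cf.
rewrite derive1Sn (_ : derive1 f = df); first exact: IH.
by apply/funext => y; rewrite derive1E derive_val.
Qed.

(** [S] is [flat 0 x / (flat 0 x + flat 0 (1 - x))], where the denominator is positive because [x]
    or [1 - x] is. *)
Lemma smooth_step : exists S dS : R -> R,
  [/\ smooth_class S, forall x, is_derive x 1 S (dS x), continuous dS,
      forall x, 0 <= dS x &
      [/\ forall x, x <= 0 -> S x = 0 /\ dS x = 0 &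
          forall x, 1 <= x -> S x = 1 /\ dS x = 0]].
Proof.
pose D x := flat 0 x + flat 0 (-1 * x + 1).
have D0 x : 0 < D x.
  rewrite /D; have [x0|x0] := ltP 0 x.
    by rewrite ltr_wpDr ?flat_ge0// flat_gt0.
  rewrite ltr_wpDl ?flat_ge0// flat_gt0//; lra.
pose S x := flat 0 x * (D x)^-1.
have cD : smooth_class D.
  by apply: smooth_add; [|apply: smooth_affine]; exact: smooth_flat.
have cS : smooth_class S.
  by apply: smooth_mul; [exact: smooth_flat|exact: smooth_inv].
have [dS cdS dSE] := smooth_class_derive cS.
(* [smooth_class_derive] only provides some derivative. It agrees with the quotient rule, where
   [flat 2] is the derivative of [flat 0]; sign and zeros are read off this formula. *)
have dSE' x : dS x = (flat 2 x * flat 0 (-1 * x + 1) +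
    flat 0 x * flat 2 (-1 * x + 1)) * ((D x)^-1 * (D x)^-1).
  have f1 := is_derive_flat 0 x; rewrite mul0r subr0 in f1.
  have f2 : is_derive x 1 (fun y => flat 0 (-1 * y + 1)) (flat 2 (-1 * x + 1) * -1).
    apply: (@is_derive1_comp R (flat 0) (fun y => -1 * y + 1)).
      by have := is_derive_flat 0 (-1 * x + 1); rewrite mul0r subr0.
    have h1 : is_derive x 1 (fun y : R => -1 * y) (-1 * 1) by exact: is_deriveZ.
    have h2 : is_derive x 1 (fun y : R => -1 * y + 1) (-1 * 1 + 0).
      by apply: is_deriveD.
    by rewrite mulr1 addr0 in h2.
  have dD : is_derive x 1 D (flat 2 x + flat 2 (-1 * x + 1) * -1).
    exact: is_deriveD.
  have Dx0 : D x != 0 by rewrite gt_eqF.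
  have dS2 := is_deriveM f1 (is_deriveV Dx0 dD).
  rewrite -(@derive_val _ _ _ _ _ _ _ (dSE x)).
  rewrite (@derive_val _ _ _ _ _ _ _ dS2) /GRing.scale/=.
  have -> : flat 2 x * flat 0 (-1 * x + 1) + flat 0 x * flat 2 (-1 * x + 1) =
    flat 2 x * D x - flat 0 x * (flat 2 x - flat 2 (-1 * x + 1)) by rewrite /D; ring.
  by field.
exists S, dS; split => //.
- have [ddS _ ddSE] := smooth_class_derive cdS.
  exact: is_derive_continuous ddSE.
- move=> x; rewrite dSE' mulr_ge0//.
    by rewrite addr_ge0// mulr_ge0// flat_ge0.
  by rewrite mulr_ge0// invr_ge0 ltW.
- split => x x0.
    by rewrite dSE' /S !(flat_le0 _ x0) !mul0r addr0 mul0r.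
  have x1 : -1 * x + 1 <= 0 by lra.
  rewrite dSE' /S /D !(flat_le0 _ x1) !mulr0 !addr0 mul0r divff//.
  by rewrite gt_eqF// flat_gt0//; lra.
Qed.

End smooth_step.

(** * From weak derivatives to primitives *)

Section weak_derivative.
Context (R : realType).
Local Notation leb := (@lebesgue_measure R).

Lemma continuous_dist_le (f : R -> R) (x e : R) : continuous f -> 0 < e ->
  exists2 d, 0 < d & forall y, `|y - x| <= d -> `|f x - f y| <= e.
Proof.
move=> cf e0.
have /nbhs_ballP[d /= d0 dP] : nbhs x [set y | `|f x - f y| <= e].
  exact: (@cvgr_dist_le R R _ _ _ _ _ (cf x) _ e0).
exists (d / 2); first exact: divr_gt0.
move=> y yx; apply: dP; rewrite -ball_normE /ball_/= distrC (le_lt_trans yx)//.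
by rewrite ltr_pdivrMr// ltr_pMr// ltr1n.
Qed.

(** Tested with the difference of two smooth steps, the hypothesis says that two averages of [H],
    one taken near [a] and one near [b], coincide. By continuity they are within [eta / 2] of [H a]
    and [H b]. *)
Lemma weak_derivative0_constant T (H : R -> R) : continuous H ->
  (forall psi, Cc_infty_itv T psi ->
    \int[leb]_(t in `[0, T]) (derive1 psi t * H t) = 0) ->
  forall a b, 0 <= a -> a < b -> b <= T -> H a = H b.
Proof.
move=> cH intH a b a0 ab bT.
have [S [dS [cS dSE cdS dS0 [S_le0 S_ge1]]]] := smooth_step R.
apply/eqP; rewrite -subr_eq0 -normr_le0; apply/ler_addgt0Pl => eta eta0.
rewrite addr0.
have eta20 : 0 < eta / 2 by exact: divr_gt0.
have [da da0 Ha] := continuous_dist_le a cH eta20.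
have [db db0 Hb] := continuous_dist_le b cH eta20.
(* [2 * e] stays within both radii of continuity, and [4 * e <= b - a] makes the lower step end no
   later than the upper one begins. *)
pose e := Num.min (Num.min da db / 2) ((b - a) / 4).
have ba0 : 0 < b - a by rewrite subr_gt0.
have e0 : 0 < e by rewrite !lt_min !divr_gt0// lt_min da0.
have e_ba : 4 * e <= b - a by rewrite mulrC -ler_pdivlMr// ge_min lexx orbT.
have e2 : 2 * e <= Num.min da db by rewrite mulrC -ler_pdivlMr// ge_min lexx.
have [e_da e_db] : 2 * e <= da /\ 2 * e <= db.
  by move: e2; rewrite le_min => /andP.
(* [A c] climbs from 0 to 1 on [[c, c + e]], so its derivative [dA c] is a probability density
   there. The argument [(t - c) / e] is spelled to match [smooth_affine]. *)
pose A c t := S (e^-1 * t + (- c / e)).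
pose dA c t := e^-1 * dS (e^-1 * t + (- c / e)).
have argE c t : e^-1 * t + (- c / e) = (t - c) / e by rewrite mulNr mulrBl mulrC.
have cA c : smooth_class (A c) by exact: smooth_affine.
have dAE c (t : R) : is_derive t 1 (A c) (dA c t).
  rewrite /dA mulrC; apply: (@is_derive1_comp R S (fun y => e^-1 * y + (- c / e))).
  have h1 : is_derive t 1 (fun y : R => e^-1 * y) (e^-1 * 1) by exact: is_deriveZ.
  have h2 : is_derive t 1 (fun y : R => e^-1 * y + (- c / e)) (e^-1 * 1 + 0).
    by apply: is_deriveD.
  by rewrite mulr1 addr0 in h2.
have cdA c : continuous (dA c).
  move=> t; apply: cvgM; first exact: cvg_cst.
  apply: (@continuous_comp _ _ _ (fun y : R => e^-1 * y + (- c / e)) dS); last exact: cdS.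
  by apply: cvgD; [apply: cvgM; [exact: cvg_cst|exact: cvg_id]|exact: cvg_cst].
have dA0 c t : 0 <= dA c t by rewrite mulr_ge0// invr_ge0 ltW.
have A_le c t : t <= c -> A c t = 0 /\ dA c t = 0.
  move=> tc; rewrite /A /dA argE.
  have [-> ->] : S ((t - c) / e) = 0 /\ dS ((t - c) / e) = 0.
    by apply: S_le0; rewrite pmulr_lle0 ?invr_gt0// subr_le0.
  by rewrite mulr0.
have A_ge c t : c + e <= t -> A c t = 1 /\ dA c t = 0.
  move=> tc; rewrite /A /dA argE.
  have [-> ->] : S ((t - c) / e) = 1 /\ dS ((t - c) / e) = 0.
    by apply: S_ge1; rewrite ler_pdivlMr// mul1r lerBrDl.
  by rewrite mulr0.
have T0 : 0 <= T by lra.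
have intA c : 0 <= c -> c + e <= T -> \int[leb]_(t in `[0, T]) dA c t = 1.
  move=> c0 cT; rewrite (Rintegral_FTC T0 (cdA c) (dAE c)).
  by rewrite (A_ge c T cT).1 (A_le c 0 c0).1 subr0.
have bump c x : 0 <= c -> c + e <= T ->
    (forall t, c <= t <= c + e -> `|H x - H t| <= eta / 2) ->
    `|H x - \int[leb]_(t in `[0, T]) (dA c t * H t)| <= eta / 2.
  move=> c0 cT Hx.
  have cdAH : continuous (fun t => dA c t * H t).
    by move=> t; apply: cvgM; [exact: cdA|exact: cH].
  have cdAHx : continuous (fun t => H x * dA c t).
    by move=> t; apply: cvgM; [exact: cvg_cst|exact: cdA].
  have i1 := continuous_integrable 0 T cdAH.
  have i2 := continuous_integrable 0 T cdAHx.
  have i3 := continuous_integrable 0 T (cdA c).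
  have -> : H x = \int[leb]_(t in `[0, T]) (H x * dA c t).
    by rewrite RintegralZl// intA// mulr1.
  rewrite -RintegralB//.
  have -> : eta / 2 = \int[leb]_(t in `[0, T]) (eta / 2 * dA c t).
    by rewrite RintegralZl// intA// mulr1.
  have cd : continuous (fun t => H x * dA c t - dA c t * H t).
    by move=> t; apply: cvgB; [exact: cdAHx|exact: cdAH].
  have ce : continuous (fun t => eta / 2 * dA c t).
    by move=> t; apply: cvgM; [exact: cvg_cst|exact: cdA].
  apply: (le_trans (le_normr_Rintegral _ (continuous_integrable 0 T cd))) => //.
  apply: le_Rintegral => //.
  - exact: integrable_norm (continuous_integrable 0 T cd).
  - exact: continuous_integrable.
  - move=> t _; rewrite [X in `|X - _|]mulrC -mulrBr normrM (ger0_norm (dA0 c t)) mulrC.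
    have [tc|ct] := leP t c; first by rewrite (A_le c t tc).2 !mulr0.
    have [tc|tc] := leP (c + e) t; first by rewrite (A_ge c t tc).2 !mulr0.
    by rewrite ler_wpM2r// Hx// !ltW.
(* The distance [e] kept from [a] and [b] puts the support of [psi] inside the open interval even
   when [a = 0] or [b = T]. *)
pose ca := a + e; pose cb := b - 2 * e.
pose psi t := A ca t + -1 * A cb t.
have psiE t : derive1 psi t = dA ca t - dA cb t.
  have h : is_derive t 1 psi (dA ca t + -1 * dA cb t).
    by apply: is_deriveD; exact: is_deriveZ.
  by rewrite derive1E derive_val mulN1r.
have supp_psi : closure [set t | psi t != 0] `<=` `[a + e, b - e].
  rewrite [X in _ `<=` X](_ : _ = closure `[a + e, b - e]); last first.
    by apply/closure_id; exact: interval_closed.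
  apply: closureS => t /= psit; rewrite in_itv/=; apply/andP; split.
    rewrite leNgt; apply: contraNN psit => ta; rewrite /psi.
    have tb : t <= cb by rewrite (le_trans (ltW ta))// /cb; lra.
    by rewrite (A_le ca t (ltW ta)).1 (A_le cb t tb).1 mulr0 addr0.
  rewrite leNgt; apply: contraNN psit => ta; rewrite /psi.
  have tca : ca + e <= t by rewrite /ca; lra.
  have tcb : cb + e <= t by rewrite /cb; lra.
  by rewrite (A_ge ca t tca).1 (A_ge cb t tcb).1 mulr1 subrr.
have Cpsi : Cc_infty_itv T psi.
  split.
  - apply: smooth_class_derivable; apply: smooth_add => //.
    exact: smooth_scale.
  - apply: (subclosed_compact _ (@segment_compact _ (a + e) (b - e))) => //.
    exact: closed_closure.
  - move=> t /supp_psi /=; rewrite !in_itv/= => /andP[t1 t2].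
    by apply/andP; split; lra.
have := intH _ Cpsi.
have iA c : leb.-integrable `[0, T] (EFin \o (fun t => dA c t * H t)).
  apply: continuous_integrable => t; apply: cvgM; [exact: cdA|exact: cH].
under eq_Rintegral do rewrite psiE mulrBl.
rewrite RintegralB// => /eqP; rewrite subr_eq0 => /eqP Iab.
have ea : `|H a - \int[leb]_(t in `[0, T]) (dA ca t * H t)| <= eta / 2.
  apply: bump; [by rewrite /ca; lra..|].
  move=> t /andP[]; rewrite /ca => t1 t2; apply: Ha.
  by rewrite ger0_norm; lra.
have eb : `|H b - \int[leb]_(t in `[0, T]) (dA cb t * H t)| <= eta / 2.
  apply: bump; [by rewrite /cb; lra..|].
  move=> t /andP[]; rewrite /cb => t1 t2; apply: Hb.
  by rewrite ler0_norm; lra.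
rewrite -Iab in eb; set I := Rintegral _ _ _ in ea eb.
have -> : H a - H b = (H a - I) - (H b - I) by ring.
by rewrite (le_trans (ler_normB _ _))// [leRHS]splitr lerD.
Qed.

(** The difference of [h] and the clamped primitive of [k] is continuous with weak derivative zero,
    hence constant on [[0, T]]. *)
Lemma weak_derivative_primitive T (h k : R -> R) : 0 < T -> continuous h ->
  leb.-integrable `[0, T] (EFin \o k) ->
  (forall psi, Cc_infty_itv T psi ->
    \int[leb]_(t in `[0, T]) (derive1 psi t * h t) =
    - \int[leb]_(t in `[0, T]) (psi t * k t)) ->
  forall t, t \in `[0, T] -> h t = h 0 + \int[leb]_(s in `[0, t]) k s.
Proof.
move=> T0 ch ik hk t; rewrite in_itv/= => /andP[t0 tT].
have cK := continuous_clamp (ltW T0) (primitive_continuous T0 ik).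
set K := (X in continuous X) in cK.
have KE s : s \in `[0, T] -> K s = \int[leb]_(r in `[0, s]) k r.
  by move=> sT; rewrite /K /= clamp_id.
have cH : continuous (fun s => h s - K s).
  by move=> s; apply: cvgB; [exact: ch|exact: cK].
have K0 : K 0 = 0.
  by rewrite KE ?set_itv1 ?Rintegral_set1// in_itv/= lexx ltW.
have : t = 0 \/ 0 < t by move: t0; rewrite le_eqVlt => /predU1P[->|]; [left|right].
case=> [->|t_gt0]; first by rewrite set_itv1 Rintegral_set1 addr0.
have intH psi : Cc_infty_itv T psi ->
    \int[leb]_(s in `[0, T]) (derive1 psi s * (h s - K s)) = 0.
  move=> Cpsi; have [_ cpsi' _ _] := test_function_is_derive Cpsi.
  under eq_Rintegral do rewrite mulrBr.
  rewrite RintegralB//; last 2 first.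
  - apply: continuous_integrable => s; apply: cvgM; [exact: cpsi'|exact: ch].
  - apply: continuous_integrable => s; apply: cvgM; [exact: cpsi'|exact: cK].
  rewrite hk// -integration_by_parts_test//.
  apply/eqP; rewrite subr_eq0; apply/eqP.
  by apply: eq_Rintegral => s; rewrite inE/= => /KE ->.
have := weak_derivative0_constant cH intH (lexx 0) t_gt0 tT.
rewrite K0 subr0 KE ?in_itv/= ?t0// => ->.
by rewrite subrK.
Qed.

End weak_derivative.

(** * The abstract Cauchy problem *)

Lemma le_geometric_le0 (R : realType) (x c : R) :
  (forall n, x <= c / 2 ^+ n) -> x <= 0.
Proof.
move=> xc; rewrite leNgt; apply/negP => x0.
have c0 : 0 < c by have := xc 0%N; rewrite expr0 divr1; exact: lt_le_trans.
have /archi_boundP := ltW (divr_gt0 c0 x0); set n := Num.bound _ => cxn.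
have := xc n; rewrite leNgt => /negP; apply.
rewrite ltr_pdivrMr ?exprn_gt0// mulrC -ltr_pdivrMr//.
by rewrite (lt_le_trans cxn)// -natrX ler_nat ltnW// ltn_expl.
Qed.

(** The intervals of radius [r n = 2 * c / 2 ^+ n] around [a n] are nested, because
    [r n = c / 2 ^+ n + r n.+1]; the supremum of the left ends lies in all of them. *)
Lemma geometric_cauchy (R : realType) (a : nat -> R) (c : R) :
  (forall n, `|a n.+1 - a n| <= c / 2 ^+ n) ->
  exists l, forall n, `|a n - l| <= 2 * c / 2 ^+ n.
Proof.
move=> ac.
pose r n := 2 * c / 2 ^+ n.
have rS n : r n = c / 2 ^+ n + r n.+1.
  by rewrite /r exprS; field; rewrite expf_neq0.
have c0 n : 0 <= c / 2 ^+ n by exact: le_trans (ac n).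
have lo n m : (n <= m)%N -> a n - r n <= a m - r m.
  elim: m => [|m IH]; first by rewrite leqn0 => /eqP ->.
  rewrite leq_eqVlt => /predU1P[->//|/IH /le_trans]; apply.
  have := ac m; rewrite ler_norml rS => /andP[h _]; lra.
have hi n m : (n <= m)%N -> a m + r m <= a n + r n.
  elim: m => [|m IH]; first by rewrite leqn0 => /eqP ->.
  rewrite leq_eqVlt => /predU1P[->//|/IH]; apply: le_trans.
  have := ac m; rewrite ler_norml (rS m) => /andP[_ h]; lra.
have r0 n : 0 <= r n by rewrite /r -mulrA mulr_ge0.
have lohi n m : a n - r n <= a m + r m.
  apply: (le_trans (lo _ _ (leq_maxl n m))).
  apply: le_trans (hi _ _ (leq_maxr n m)).
  by have := r0 (maxn n m); lra.
pose E := range (fun n => a n - r n).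
have hE m : ubound E (a m + r m) by move=> _ [n _ <-].
exists (sup E) => n; rewrite ler_distl; apply/andP; split; last first.
  rewrite -lerBlDr; apply: ub_le_sup; last by exists n.
  by exists (a 0%N + r 0%N).
rewrite lerBlDr; apply: ge_sup; last exact: hE.
by exists (a 0%N - r 0%N); exists 0%N.
Qed.

Lemma continuous_dominated (R : realType) (X : normedModType R) (v : R -> X)
    (P : R -> R) (c : R) : continuous P ->
  (forall s t, `|v s - v t| <= c * `|P s - P t|) -> continuous v.
Proof.
move=> cP vP x; apply/cvgrPdist_le => e e0.
have c0 : 0 < `|c| + 1 by rewrite ltr_wpDl.
near=> y; apply: (le_trans (vP x y)).
apply: (@le_trans _ _ ((`|c| + 1) * `|P x - P y|)).
  by apply: ler_wpM2r => //; rewrite (le_trans (ler_norm c))// lerDl.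
rewrite mulrC -ler_pdivlMr//.
near: y; exact: (@cvgr_dist_le R R _ _ _ _ _ (cP x) _ (divr_gt0 e0 c0)).
Unshelve. all: by end_near. Qed.

(** * Completeness and integration through the pairing *)

Section volterra.
Context (R : realType) (X Y : normedModType R) (M : R) (L : X -> Y -> R).
Hypothesis HL : perfect_pairing M L.
Local Notation leb := (@lebesgue_measure R).

(** Each real sequence [L (x n) w] converges, and the limits form a bounded linear functional of
    [w], represented by [v]. The constant is [2 * M * C] from [geometric_cauchy], times [M] from
    norming. *)
Lemma pairing_complete (x : nat -> X) (C : R) :
  (forall n, `|x n.+1 - x n| <= C / 2 ^+ n) ->
  exists v, forall n, `|x n - v| <= M * (2 * M * C) / 2 ^+ n.
Proof.
move=> xC.
have M0 := pairing_gt0 HL.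
have C0 : 0 <= C by have := xC 0%N; rewrite expr0 divr1; exact: le_trans.
pose c (w : Y) := 2 * (M * C * `|w|).
have /choice[F FP] w : exists l, forall n, `|L (x n) w - l| <= c w / 2 ^+ n.
  apply: geometric_cauchy => n; rewrite -(pairingBl HL).
  rewrite (le_trans (pairing_le HL _ _))//.
  have -> : M * C * `|w| / 2 ^+ n = M * (C / 2 ^+ n) * `|w| by ring.
  by rewrite ler_wpM2r// ler_wpM2l// ltW.
have [v vF] : exists v, forall w, L v w = F w.
  apply: (pairing_onto HL) => [a w1 w2|].
    apply/eqP; rewrite -subr_eq0 -normr_le0.
    apply: (@le_geometric_le0 _ _ (c (a *: w1 + w2) + `|a| * c w1 + c w2)) => n.
    have -> : F (a *: w1 + w2) - (a * F w1 + F w2) =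
      - (L (x n) (a *: w1 + w2) - F (a *: w1 + w2)) +
      a * (L (x n) w1 - F w1) + (L (x n) w2 - F w2).
      by rewrite (pairing_linearr HL); ring.
    rewrite (le_trans (ler_normD _ _))// !mulrDl lerD ?FP//.
    rewrite (le_trans (ler_normD _ _))// lerD ?normrN ?FP//.
    by rewrite normrM -mulrA ler_wpM2l// FP.
  exists (M * `|x 0%N| + 2 * (M * C)) => w.
  have := FP w 0%N; rewrite expr0 divr1 => h.
  have -> : F w = L (x 0%N) w - (L (x 0%N) w - F w) by ring.
  rewrite (le_trans (ler_normB _ _))// mulrDl lerD ?(pairing_le HL)//.
  by apply: (le_trans h); rewrite /c mulrA.
exists v => n; rewrite -mulrA; apply: (pairing_norming HL) => [|w].
  by rewrite divr_ge0 ?exprn_ge0// !mulr_ge0// ltW.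
rewrite (pairingBl HL) vF (le_trans (FP w n))// le_eqVlt; apply/orP; left.
by apply/eqP; rewrite /c; ring.
Qed.

Lemma integrable_continuous_norm (u : R -> X) a b : continuous u ->
  leb.-integrable `[a, b] (EFin \o (fun t => `|u t|)).
Proof.
move=> cu; apply: continuous_integrable => x.
by apply: cvg_norm; exact: cu.
Qed.

(** Tested increments of the integral are bounded by increments of the primitive [P] of [|g|], which
    is continuous; norming carries this modulus of continuity over to [v]. *)
Lemma volterra_step T (g : R -> X) (u0 : X) : 0 < T -> simple_limit g ->
  leb.-integrable `[0, T] (EFin \o (fun t => `|g t|)) ->
  exists2 v : R -> X, continuous v & forall t, t \in `[0, T] -> forall w,
    L (v t) w = L u0 w + \int[leb]_(s in `[0, t]) L (g s) w.
Proof.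
move=> T0 sg ig.
have M0 := pairing_gt0 HL.
have igt t : leb.-integrable `[0, clamp T t] (EFin \o (fun s => `|g s|)).
  apply: integrableS ig => //; apply: subset_itvl; rewrite bnd_simp.
  by have := clamp_itv t (ltW T0); rewrite in_itv/= => /andP[].
have /choice[V VP] t : exists v, forall w,
    L v w = \int[leb]_(s in `[0, clamp T t]) L (g s) w.
  exact: (weak_integral HL _ sg (igt t)).
pose P t := \int[leb]_(s in `[0, clamp T t]) `|g s|.
have cP : continuous P := continuous_clamp (ltW T0) (primitive_continuous T0 ig).
have VPle s t : clamp T s <= clamp T t -> `|V s - V t| <= M * M * `|P s - P t|.
  move=> st; rewrite distrC [X in _ * X]distrC -mulrA.
  have s0 : 0 <= clamp T s.
    by have := clamp_itv s (ltW T0); rewrite in_itv/= => /andP[].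
  have ist : leb.-integrable `]clamp T s, clamp T t] (EFin \o (fun s => `|g s|)).
    by apply: integrableS (igt t) => //; apply: subset_itvr; rewrite bnd_simp.
  have -> : P t - P s = \int[leb]_(r in `]clamp T s, clamp T t]) `|g r|.
    by rewrite /P (Rintegral_itvB (igt t))// ?bnd_simp.
  apply: (pairing_norming HL) => [|w].
    by rewrite mulr_ge0// ltW.
  rewrite (pairingBl HL) !VP.
  have iL := integrable_pairing HL w _ sg (igt t).
  rewrite (Rintegral_itvB (iL _))// ?bnd_simp//.
  apply: (le_trans (le_Rintegral_pairing HL w _ sg ist)) => //.
  rewrite mulrAC ler_wpM2r// ler_wpM2l ?(ltW M0)//.
  exact: ler_norm.
exists (fun t => u0 + V t) => [|t tT w].
  apply: (@continuous_dominated R X _ P (M * M) cP) => s t.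
  rewrite opprD addrACA subrr add0r.
  have [st|/ltW ts] := leP (clamp T s) (clamp T t); first exact: VPle.
  by rewrite distrC [X in _ * X]distrC VPle.
by rewrite (pairingDl HL) VP clamp_id.
Qed.

End volterra.

(** * Well-posedness for a strongly continuous family of operators *)

Section evolution.
Context (R : realType) (X Y : normedModType R) (M : R) (L : X -> Y -> R).
Hypothesis HL : perfect_pairing M L.
Local Notation leb := (@lebesgue_measure R).

Variables (T : R) (A : R -> X -> X) (K : R).
Hypothesis T0 : 0 < T.
Hypothesis A_linear : forall t, t \in `[0, T] -> forall a u v,
  A t (a *: u + v) = a *: A t u + A t v.
Hypothesis A_le : forall t, t \in `[0, T] -> forall v, `|A t v| <= K * `|v|.
Hypothesis A_continuous : forall v, {within `[0, T], continuous (A^~ v)}.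

(** [A] is controlled on [[0, T]] only; the projection extends its properties to the whole line. *)
Let B t := A (clamp T t).

Let BB t u v : B t (u - v) = B t u - B t v.
Proof.
have tT := clamp_itv t (ltW T0).
by rewrite /B -[u - v]addrC -scaleN1r A_linear// scaleN1r addrC.
Qed.

Let B_le t v : `|B t v| <= K * `|v|.
Proof. exact/A_le/clamp_itv/ltW. Qed.

(** The increment splits into [(B x - B y) (u x)], small by continuity at the fixed vector [u x],
    and [B y (u x - u y)], small by the uniform bound. *)
Let B_continuous (u : R -> X) : continuous u -> continuous (fun t => B t (u t)).
Proof.
move=> cu x; apply/cvgrPdist_le => e e0.
have cB : continuous (B^~ (u x)).
  exact: (@continuous_clamp R T X (A^~ (u x)) (ltW T0) (@A_continuous (u x))).
have e20 : 0 < e / 2 by exact: divr_gt0.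
have K0 : 0 < `|K| + 1 by rewrite ltr_wpDl.
near=> y.
have -> : B x (u x) - B y (u y) = B x (u x) - B y (u x) + B y (u x - u y).
  by rewrite BB addrA subrK.
rewrite (le_trans (ler_normD _ _))// [leRHS]splitr lerD//.
  by near: y; exact: (@cvgr_dist_le R X _ _ _ _ _ (cB x) _ e20).
apply: (le_trans (B_le _ _)).
apply: (@le_trans _ _ ((`|K| + 1) * `|u x - u y|)).
  by apply: ler_wpM2r => //; rewrite (le_trans (ler_norm K))// lerDl.
rewrite mulrC -ler_pdivlMr//.
near: y; exact: (@cvgr_dist_le R X _ _ _ _ _ (cu x) _ (divr_gt0 e20 K0)).
Unshelve. all: by end_near. Qed.

Let sub_itv t : t \in `[0, T] -> `[0, t]%classic `<=` `[0, T]%classic.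
Proof.
by rewrite in_itv/= => /andP[_ tT]; apply: subset_itvl; rewrite bnd_simp.
Qed.

(** One factor [M] bounds the tested integral, the other recovers the norm, and [|K|] bounds the
    operators; adding 1 keeps [K1] positive. *)
Let K1 := M * M * `|K| + 1.

Let K1_gt0 : 0 < K1.
Proof. by rewrite ltr_wpDl// !mulr_ge0// ltW// (pairing_gt0 HL). Qed.

(* One step of the Picard iteration halves the norm sup_t |u(t)| e^(-2 K1 t). *)
Let volterra_contraction (y z : R -> X) (D : R) : continuous y ->
  (forall t, t \in `[0, T] -> forall w,
    L (z t) w = - \int[leb]_(s in `[0, t]) L (B s (y s)) w) ->
  (forall t, t \in `[0, T] -> `|y t| <= D * expR (2 * K1 * t)) ->
  forall t, t \in `[0, T] -> `|z t| <= D / 2 * expR (2 * K1 * t).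
Proof.
move=> cy zE yD t tT.
have M0 := pairing_gt0 HL.
have D0 : 0 <= D.
  have : 0 \in `[0, T] by rewrite in_itv/= lexx ltW.
  by move=> /yD; rewrite mulr0 expR0 mulr1; exact: le_trans.
have t0 : 0 <= t by move: tT; rewrite in_itv/= => /andP[].
have cBy := B_continuous cy.
have iBy := integrable_continuous_norm 0 t cBy.
have iy := integrable_continuous_norm 0 t cy.
have h s : s \in `[0, t] -> `|y s| <= D * expR (2 * K1 * s).
  by move=> st; apply: yD; exact: (sub_itv tT).
apply: le_trans (Rintegral_exp_le K1_gt0 t0 iy h D0).
apply: (@le_trans _ _ (M * (M * \int[leb]_(s in `[0, t]) `|B s (y s)|))).
  apply: (pairing_norming HL) => [|w].
    by rewrite mulr_ge0 ?(ltW M0)// Rintegral_ge0.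
  rewrite zE// normrN mulrAC; apply: (le_Rintegral_pairing HL) => //.
  exact: continuous_simple_limit.
apply: (@le_trans _ _ (M * (M * (`|K| * \int[leb]_(s in `[0, t]) `|y s|)))).
  rewrite ler_wpM2l ?(ltW M0)// ler_wpM2l ?(ltW M0)// -RintegralZl//.
  apply: le_Rintegral => //; first exact: (integrableZl _ `|K| iy).
  by move=> s _; rewrite (le_trans (B_le _ _))// ler_wpM2r// ler_norm.
rewrite !mulrA ler_wpM2r ?Rintegral_ge0//.
by rewrite /K1 lerDl.
Qed.

Let continuous_expR_bound (y : R -> X) : continuous y ->
  exists D, forall t, t \in `[0, T] -> `|y t| <= D * expR (2 * K1 * t).
Proof.
move=> cy.
have cyn : {within `[0, T], continuous (fun t => `|y t|)}.
  by apply: continuous_subspaceT => x; apply: cvg_norm; exact: cy.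
have [c _ yc] := EVT_max (ltW T0) cyn.
exists `|y c| => t tT; rewrite (le_trans (yc t tT))// ler_peMr//.
rewrite -expR0 ler_expR !mulr_ge0 ?(ltW K1_gt0)//.
by move: tT; rewrite in_itv/= => /andP[].
Qed.

(** [z] is its own image under the homogeneous Volterra map, so its exponential bound [D] can be
    halved indefinitely. *)
Let volterra_unique (z : R -> X) : continuous z ->
  (forall t, t \in `[0, T] -> forall w,
    L (z t) w = - \int[leb]_(s in `[0, t]) L (B s (z s)) w) ->
  forall t, t \in `[0, T] -> z t = 0.
Proof.
move=> cz zE t tT; apply/eqP; rewrite -normr_le0.
have [D zD] := continuous_expR_bound cz.
apply: (@le_geometric_le0 _ _ (D * expR (2 * K1 * t))) => n.
elim: n t tT => [|n IH] t tT; first by rewrite expr0 divr1 zD.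
have h s : s \in `[0, T] -> `|z s| <= D / 2 ^+ n * expR (2 * K1 * s).
  by move=> sT; rewrite mulrAC; exact: IH.
apply: (le_trans (volterra_contraction cz zE h tT)).
by rewrite exprS le_eqVlt; apply/orP; left; apply/eqP; field; rewrite expf_neq0.
Qed.

Section inhomogeneous.
Variables (f : R -> X) (u0 : X).
Hypothesis sf : simple_limit f.
Hypothesis if1 : leb.-integrable `[0, T] (EFin \o (fun t => `|f t|)).

Lemma volterra_rhs_simple_limit (u : R -> X) : continuous u ->
  simple_limit (fun t => f t - B t (u t)).
Proof.
move=> cu; apply: simple_limitD => //; apply: simple_limitN.
by apply: continuous_simple_limit; exact: B_continuous.
Qed.

Let rhs_integrable (u : R -> X) : continuous u ->
  leb.-integrable `[0, T] (EFin \o (fun t => `|f t - B t (u t)|)).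
Proof.
move=> cu.
have mI : measurable (`[0, T]%classic : set (measurableTypeR R)).
  exact: measurable_itv.
have iB := integrable_continuous_norm 0 T (B_continuous cu).
apply: (@le_integrable _ _ _ _ _ mI _ (EFin \o (fun t => `|f t| + `|B t (u t)|))).
- apply/measurable_EFinP; apply: measurable_funTS; apply: simple_limit_norm.
  exact: volterra_rhs_simple_limit.
- move=> t _ /=; rewrite lee_fin normr_id [leRHS]ger0_norm ?addr_ge0//.
  exact: ler_normB.
- exact: (integrableD mI if1 iB).
Qed.

(** The integral equation in tested form, with real integrals only; the clamp changes nothing on
    [[0, T]]. *)
Definition volterra_solution (u : R -> X) : Prop :=
  continuous u /\ forall t, t \in `[0, T] -> forall w,
    L (u t) w = L u0 w + \int[leb]_(s in `[0, t]) L (f s - A (clamp T s) (u s)) w.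

Let rhs_integrable_pairing (u : R -> X) w t : t \in `[0, T] -> continuous u ->
  leb.-integrable `[0, t] (EFin \o (fun s => L (f s - B s (u s)) w)).
Proof.
move=> tT cu.
have mI : measurable (`[0, t]%classic : set (measurableTypeR R)).
  exact: measurable_itv.
apply: (integrable_pairing HL) => //; first exact: volterra_rhs_simple_limit.
by apply: integrableS (rhs_integrable cu) => //; exact: sub_itv.
Qed.

Let rhsB (u v : R -> X) w t : t \in `[0, T] -> continuous u -> continuous v ->
  \int[leb]_(s in `[0, t]) L (f s - B s (u s)) w -
  \int[leb]_(s in `[0, t]) L (f s - B s (v s)) w =
  - \int[leb]_(s in `[0, t]) L (B s (u s - v s)) w.
Proof.
move=> tT cu cv.
have iu := rhs_integrable_pairing w tT cu; have iv := rhs_integrable_pairing w tT cv.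
rewrite -RintegralB// -mulN1r -RintegralZl//.
  apply: eq_Rintegral => s _.
  rewrite -(pairingBl HL) mulN1r -(pairingNl HL) BB; congr (L _ w).
  by rewrite !opprB addrC addrA subrK.
apply: (integrable_pairing HL) => //.
  apply: continuous_simple_limit; apply: (@B_continuous (fun s => u s - v s)) => x.
  by apply: cvgB; [exact: cu|exact: cv].
apply: integrable_continuous_norm; apply: (@B_continuous (fun s => u s - v s)) => x.
by apply: cvgB; [exact: cu|exact: cv].
Qed.

Lemma volterra_solution_unique u v : volterra_solution u -> volterra_solution v ->
  forall t, t \in `[0, T] -> u t = v t.
Proof.
move=> [cu uE] [cv vE] t tT; apply/eqP; rewrite -subr_eq0; apply/eqP.
apply: (@volterra_unique (fun s => u s - v s)) => // [x|s sT w].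
  by apply: cvgB; [exact: cu|exact: cv].
by rewrite (pairingBl HL) uE// vE// opprD addrACA subrr add0r rhsB.
Qed.

Lemma volterra_solution_exists : exists u, volterra_solution u.
Proof.
have M0 := pairing_gt0 HL.
(* [next] is a Picard step chosen for every [u]; for a discontinuous [u] the condition is void and
   [u] itself serves as a dummy value. *)
have /choice[next nextP] (u : R -> X) : exists v : R -> X, continuous u ->
    continuous v /\ forall t, t \in `[0, T] -> forall w,
    L (v t) w = L u0 w + \int[leb]_(s in `[0, t]) L (f s - B s (u s)) w.
  have [cu|ncu] := pselect (continuous u); last by exists u.
  have [v cv vE] := volterra_step HL u0 T0 (volterra_rhs_simple_limit cu)
    (rhs_integrable cu).
  by exists v.
pose U n := iter n next (fun=> u0).
have cU n : continuous (U n).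
  elim: n => [|n IH] /=; first by move=> x; exact: cvg_cst.
  exact: (nextP _ IH).1.
have UE n t : t \in `[0, T] -> forall w,
    L (U n.+1 t) w = L u0 w + \int[leb]_(s in `[0, t]) L (f s - B s (U n s)) w.
  exact: (nextP _ (cU n)).2.
have cUB n : continuous (fun t => U n.+1 t - U n t).
  by move=> x; apply: cvgB; exact: cU.
have [D UD] := continuous_expR_bound (cUB 0%N).
have step n t : t \in `[0, T] ->
    `|U n.+1 t - U n t| <= D / 2 ^+ n * expR (2 * K1 * t).
  elim: n t => [|n IH] t tT; first by rewrite expr0 divr1 UD.
  have h s : s \in `[0, T] -> forall w, L (U n.+2 s - U n.+1 s) w =
      - \int[leb]_(r in `[0, s]) L (B r (U n.+1 r - U n r)) w.
    move=> sT w.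
    by rewrite (pairingBl HL) !UE// opprD addrACA subrr add0r rhsB.
  apply: (le_trans (volterra_contraction (cUB n) h IH tT)).
  by rewrite exprS le_eqVlt; apply/orP; left; apply/eqP; field; rewrite expf_neq0.
pose C := D * expR (2 * K1 * T).
have D0 : 0 <= D.
  have : 0 \in `[0, T] by rewrite in_itv/= lexx ltW.
  by move=> /UD; rewrite mulr0 expR0 mulr1; exact: le_trans.
have stepC n t : t \in `[0, T] -> `|U n.+1 t - U n t| <= C / 2 ^+ n.
  move=> tT; apply: (le_trans (step n t tT)).
  rewrite /C mulrAC ler_wpM2r ?invr_ge0 ?exprn_ge0// ler_wpM2l//.
  rewrite ler_expR ler_wpM2l ?mulr_ge0 ?(ltW K1_gt0)//.
  by move: tT; rewrite in_itv/= => /andP[].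
pose C1 := M * (2 * M * C).
(* The bound [C] no longer depends on [t], so the limits at all times are reached at the same rate;
   the convergence is uniform and [u] inherits continuity. *)
have /choice[u uP] t : exists v, forall n, `|U n (clamp T t) - v| <= C1 / 2 ^+ n.
  apply: (pairing_complete HL) => n; apply: stepC.
  exact: clamp_itv (ltW T0).
have C10 : 0 <= C1 by rewrite /C1 !mulr_ge0 ?(ltW M0) ?expR_ge0.
have small e : 0 < e -> exists n, C1 / 2 ^+ n <= e.
  move=> e0; apply: contrapT => /forallNP h.
  have : e <= 0; last by rewrite leNgt e0.
  apply: (@le_geometric_le0 _ e C1) => n.
  by apply/ltW; rewrite ltNge; apply/negP; exact: h.
have cu : continuous u.
  move=> x; apply/cvgrPdist_le => e e0.
  have e30 : 0 < e / 3 by exact: divr_gt0.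
  have [n nP] := small _ e30.
  have cUn : continuous (U n \o clamp T).
    by move=> z; apply: continuous_comp; [exact: clamp_continuous|exact: cU].
  near=> y.
  have -> : u x - u y = (U n (clamp T x) - U n (clamp T y)) -
      (U n (clamp T x) - u x) + (U n (clamp T y) - u y).
    by rewrite opprB [U n (clamp T x) - _ + _]addrC !addrA !subrK.
  rewrite (le_trans (ler_normD _ _))//.
  rewrite (_ : e = e / 3 + e / 3 + e / 3); last by field.
  rewrite lerD ?(le_trans (uP _ _) nP)//.
  rewrite (le_trans (ler_normB _ _))// lerD ?(le_trans (uP _ _) nP)//.
  near: y; exact: (@cvgr_dist_le R X _ _ _ _ _ (cUn x) _ e30).
exists u; split=> // t tT w.
have uU n s : s \in `[0, T] -> `|U n s - u s| <= C1 / 2 ^+ n.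
  by move=> sT; have := uP s n; rewrite clamp_id.
apply/eqP; rewrite -subr_eq0 -normr_le0.
have t0 : 0 <= t by move: tT; rewrite in_itv/= => /andP[].
(* The defect of [u] in the equation is compared with the exact relation between [U n] and [U n.+1].
   The first summand accounts for [U n.+1 - u], the second for [U n - u] under the integral. *)
apply: (@le_geometric_le0 _ _ (M * C1 * `|w| + M * `|w| * (`|K| * C1 * t))) => n.
have -> : L (u t) w - (L u0 w + \int[leb]_(s in `[0, t]) L (f s - B s (u s)) w) =
    - L (U n.+1 t - u t) w +
    - \int[leb]_(s in `[0, t]) L (B s (U n s - u s)) w.
  rewrite -rhsB// (pairingBl HL) UE//; ring.
have cUu : continuous (fun s => U n s - u s).
  by move=> x; apply: cvgB; [exact: cU|exact: cu].
have iUu := integrable_continuous_norm 0 t (B_continuous cUu).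
rewrite (le_trans (ler_normD _ _))// !normrN mulrDl lerD//.
  apply: (le_trans (pairing_le HL _ _)).
  have -> : M * C1 * `|w| / 2 ^+ n = M * (C1 / 2 ^+ n) * `|w| by ring.
  rewrite ler_wpM2r// ler_wpM2l ?(ltW M0)// (le_trans (uU _ _ tT))//.
  by rewrite ler_wpM2l// lef_pV2 ?posrE ?exprn_gt0// ler_eXn2l ?ltr1n.
apply: (@le_trans _ _ (M * `|w| * \int[leb]_(s in `[0, t]) `|B s (U n s - u s)|)).
  apply: (le_Rintegral_pairing HL) => //.
  by apply: continuous_simple_limit; exact: B_continuous.
have -> : M * `|w| * (`|K| * C1 * t) / 2 ^+ n =
    M * `|w| * (`|K| * C1 * t / 2 ^+ n) by ring.
rewrite ler_wpM2l ?mulr_ge0 ?(ltW M0)//.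
have ccst : continuous (fun _ : R => `|K| * C1 / 2 ^+ n) by move=> x; exact: cvg_cst.
apply: (@le_trans _ _ (\int[leb]_(s in `[0, t]) (`|K| * C1 / 2 ^+ n))).
  apply: le_Rintegral => //; first exact: continuous_integrable.
  move=> s /= st.
  rewrite (le_trans (B_le _ _))//.
  apply: (@le_trans _ _ (`|K| * `|U n s - u s|)); first by rewrite ler_wpM2r ?ler_norm.
  by rewrite -mulrA ler_wpM2l// uU//; exact: (sub_itv tT).
rewrite Rintegral_cst//.
have -> : fine (leb `[0, t]) = t.
  rewrite lebesgue_measure_itv/= lte_fin.
  by move: t0; rewrite le_eqVlt => /predU1P[<-|->]; rewrite ?ltxx//= subr0.
by rewrite mulrAC.
Unshelve. all: by end_near. Qed.

Lemma continuous_segment_bounded (psi : R -> R) : continuous psi ->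
  exists c, forall t, t \in `[0, T] -> `|psi t| <= c.
Proof.
move=> cpsi.
have cpsin : {within `[0, T], continuous (fun t => `|psi t|)}.
  by apply: continuous_subspaceT => x; apply: cvg_norm; exact: cpsi.
have [c _ psic] := EVT_max (ltW T0) cpsin.
by exists `|psi c|.
Qed.

Lemma scaled_limit_integrable (psi : R -> R) (g : R -> X) : continuous psi ->
  simple_limit g -> leb.-integrable `[0, T] (EFin \o (fun t => `|g t|)) ->
  [/\ simple_limit (fun t => psi t *: g t),
      leb.-integrable `]0, T[ (EFin \o (fun t => `|psi t *: g t|)) &
      forall w, \int[leb]_(t in `]0, T[) L (psi t *: g t) w =
                \int[leb]_(t in `[0, T]) (psi t * L (g t) w)].
Proof.
move=> cpsi sg ig.
have mI : measurable (`[0, T]%classic : set (measurableTypeR R)).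
  exact: measurable_itv.
have sp : simple_limit (fun t => psi t *: g t).
  by apply: simple_limitZ => //; exact: continuous_measurable_fun.
have [c cP] := continuous_segment_bounded cpsi.
have ip : leb.-integrable `[0, T] (EFin \o (fun t => `|psi t *: g t|)).
  apply: (@le_integrable _ _ _ _ _ mI _ (EFin \o (fun t => c * `|g t|))).
  - apply/measurable_EFinP; apply: measurable_funTS; exact: simple_limit_norm.
  - move=> t tT /=; rewrite lee_fin normr_id normrZ [leRHS]normrM normr_id ler_wpM2r//.
    by rewrite (le_trans (cP t tT))// ler_norm.
  - exact: (integrableZl mI c ig).
split=> // [|w].
  by apply: integrableS ip => //; exact: subset_itv_oo_cc.
rewrite Rintegral_oo_cc; last exact: (integrable_pairing HL).
by apply: eq_Rintegral => t _; rewrite (pairingZl HL).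
Qed.

(** Tested with [w], [u] is the constant [L u0 w] plus a primitive. The constant contributes nothing
    because [psi] vanishes at both ends; the primitive is integrated by parts. *)
Lemma volterra_weak_derivative u : volterra_solution u ->
  weak_time_derivative T u (fun t => f t - B t (u t)).
Proof.
move=> [cu uE] psi Cpsi.
have [dpsi cpsi' psi0 psiT] := test_function_is_derive Cpsi.
have cpsi := is_derive_continuous dpsi.
have [sp1 ip1 E1] := scaled_limit_integrable cpsi' (continuous_simple_limit cu)
  (integrable_continuous_norm 0 T cu).
have [sp2 ip2 E2] := scaled_limit_integrable cpsi (volterra_rhs_simple_limit cu)
  (rhs_integrable cu).
have [x1 x1P] := bochner_integral_exists HL sp1 ip1.
have [x2 x2P] := bochner_integral_exists HL sp2 ip2.
exists x1 => //.
suff <- : x2 = - x1 by [].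
apply: (pairing_inj HL) => w; rewrite (pairingNl HL).
have aeT (v : R -> X) : {ae leb, forall t, t \in `]0, T[ -> v t = v t} by exact: aeW.
rewrite (bochner_integral_pairing HL w x1P sp1 ip1 (aeT _)) E1.
rewrite (bochner_integral_pairing HL w x2P sp2 ip2 (aeT _)) E2.
have TT : T \in `[0, T] by rewrite in_itv/= lexx ltW.
have ik := rhs_integrable_pairing w TT cu.
apply/eqP; rewrite eq_sym eqr_oppLR; apply/eqP.
rewrite -(integration_by_parts_test T0 Cpsi ik).
set k := (fun s => L (f s - B s (u s)) w).
have cK := continuous_clamp (ltW T0) (primitive_continuous T0 ik).
have -> : \int[leb]_(t in `[0, T]) (derive1 psi t * L (u t) w) =
    \int[leb]_(t in `[0, T]) (derive1 psi t * L u0 w +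
      derive1 psi t * \int[leb]_(s in `[0, clamp T t]) k s).
  apply: eq_Rintegral => t; rewrite inE/= => tT.
  by rewrite uE// clamp_id// mulrDr.
rewrite RintegralD//; last 2 first.
- by apply: continuous_integrable => s; apply: cvgM; [exact: cpsi'|exact: cvg_cst].
- by apply: continuous_integrable => s; apply: cvgM; [exact: cpsi'|exact: cK].
rewrite RintegralZr//; last exact: continuous_integrable.
rewrite (Rintegral_FTC (ltW T0) cpsi' dpsi) psi0 psiT subrr mul0r add0r.
by apply: eq_Rintegral => t; rewrite inE/= => tT; rewrite clamp_id.
Qed.

(** [u] is the continuous representative of [v]. Testing with [w] gives a scalar weak derivative of
    [L (u t) w], to which [weak_derivative_primitive] applies. *)
Lemma weak_derivative_volterra (u v g : R -> X) : continuous u -> u 0 = u0 ->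
  {ae leb, forall t, t \in `]0, T[ -> u t = v t} ->
  {ae leb, forall t, t \in `]0, T[ -> g t + A t (v t) = f t} ->
  weak_time_derivative T v g -> volterra_solution u.
Proof.
move=> cu u00 uv gE wvg; split=> // t tT w.
have TT : T \in `[0, T] by rewrite in_itv/= lexx ltW.
have ch : continuous (fun t => L (u t) w).
  by move=> x; apply: (@continuous_comp _ _ _ u (L^~ w));
    [exact: cu|exact: (pairing_continuous HL)].
have ik := rhs_integrable_pairing w TT cu.
rewrite -u00; apply: (weak_derivative_primitive T0 ch ik _ tT) => psi Cpsi.
have [dpsi cpsi' psi0 psiT] := test_function_is_derive Cpsi.
have cpsi := is_derive_continuous dpsi.
have [sp1 ip1 E1] := scaled_limit_integrable cpsi' (continuous_simple_limit cu)
  (integrable_continuous_norm 0 T cu).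
have [sp2 ip2 E2] := scaled_limit_integrable cpsi (volterra_rhs_simple_limit cu)
  (rhs_integrable cu).
have [x xP1 xP2] := wvg _ Cpsi.
rewrite -E1 -(bochner_integral_pairing HL w xP1 sp1 ip1); last first.
  by apply: (ae_imp _ uv) => s us sT; rewrite us.
rewrite -E2 -(bochner_integral_pairing HL w xP2 sp2 ip2) ?(pairingNl HL) ?opprK//.
apply: (ae_imp2 _ uv gE) => s us gs sT; congr (_ *: _).
have sT' : s \in `[0, T] by exact: subset_itv_oo_cc sT.
by rewrite -gs// /B clamp_id// us// addrK.
Qed.

End inhomogeneous.

(** Integrability follows from [|g| <= 1 + |g| ^+ 2] on the bounded interval. *)
Lemma square_integrable_integrable (g : R -> X) : simple_limit g ->
  (\int[leb]_(t in `]0%R, T[) (`|g t| ^+ 2)%:E < +oo)%E ->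
  leb.-integrable `]0, T[ (EFin \o (fun t => `|g t| ^+ 2)) /\
  leb.-integrable `[0, T] (EFin \o (fun t => `|g t|)).
Proof.
move=> sg g2.
have mg := simple_limit_norm sg.
have mI := @measurable_0T R T.
have ig2 : leb.-integrable `]0, T[ (EFin \o (fun t => `|g t| ^+ 2)).
  apply/integrableP; split.
    by apply/measurable_EFinP; apply: measurable_funTS; exact: measurable_funX.
  apply: le_lt_trans g2; rewrite le_eqVlt; apply/orP; left; apply/eqP.
  by apply: eq_integral => t _ /=; rewrite ger0_norm ?sqr_ge0.
split=> //; apply: integrable_cc => //.
have i1 : leb.-integrable `]0, T[ (EFin \o (fun=> 1 : R)).
  apply: integrableS (continuous_integrable 0 T _) => //.
    exact: subset_itv_oo_cc.
  by move=> x; exact: cvg_cst.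
apply: (@le_integrable _ _ _ _ _ mI _ (EFin \o (fun t => 1 + `|g t| ^+ 2))).
- by apply/measurable_EFinP; exact: measurable_funTS.
- move=> t _ /=; rewrite lee_fin normr_id ger0_norm ?addr_ge0 ?sqr_ge0//.
  have := sqr_ge0 (`|g t| - 1); nra.
- exact: (integrableD mI i1 ig2).
Qed.

Lemma simple_limit_strongly_measurable (g : R -> X) :
  simple_limit g -> strongly_measurable T g.
Proof. by move=> [s ss sg]; exists s => //; apply: aeW => t _; exact: sg. Qed.

(** [f] is replaced by an everywhere limit [fs] of simple functions that equals it almost everywhere
    on the interval. Uniqueness holds because the clamped continuous representative of any solution
    solves the same Volterra equation. *)
Theorem cauchy_problem_wellposed (f : R -> X) (u0 : X) : bochner_L2 T f ->
  exists u, cauchy_solution T A f u0 u /\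
    forall v, cauchy_solution T A f u0 v ->
      {ae leb, forall t, t \in `]0, T[ -> v t = u t}.
Proof.
move=> [/strongly_measurable_simple_limit[fs [sfs fs0 ffs]] f2].
have mI := @measurable_0T R T.
have mfs := simple_limit_norm sfs.
have fs2 : (\int[leb]_(t in `]0%R, T[) (`|fs t| ^+ 2)%:E < +oo)%E.
  apply: le_lt_trans f2; apply: le_ae_integral => //.
  - by apply/measurable_EFinP; apply: measurable_funTS; exact: measurable_funX.
  - by apply: (ae_imp _ ffs) => t ft tT; rewrite ft.
have [ifs2 ifs] := square_integrable_integrable sfs fs2.
have itv_oo t : t \in `]0, T[ -> t \in `[0, T] by exact: subset_itv_oo_cc.
have L2_continuous (y : R -> X) : continuous y ->
    leb.-integrable `]0, T[ (EFin \o (fun t => `|y t| ^+ 2)).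
  move=> cy; have cy2 : continuous (fun t => `|y t| ^+ 2).
    move=> x; apply: (@continuous_comp _ _ _ (fun t => `|y t|) (fun r => r ^+ 2)).
      by apply: cvg_norm; exact: cy.
    exact: exprn_continuous.
  by apply: integrableS (continuous_integrable 0 T cy2).
have [u uV] := volterra_solution_exists u0 sfs ifs.
have [cu uE] := uV.
exists u; split; last first.
  move=> v [_ [g [_ wvg gE]] [v0 [cv0 v0v v00]]].
  pose vh := v0 \o clamp T.
  have cvh : continuous vh := continuous_clamp (ltW T0) cv0.
  have vhE : {ae leb, forall t, t \in `]0, T[ -> vh t = v t}.
    by apply: (ae_imp _ v0v) => t vt tT; rewrite /vh/= clamp_id ?vt// itv_oo.
  have vhV : volterra_solution fs u0 vh.
    apply: (weak_derivative_volterra sfs ifs cvh _ vhE _ wvg).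
      by rewrite /vh/= clamp_id// in_itv/= lexx ltW.
    by apply: (ae_imp2 _ gE ffs) => t gt ft tT; rewrite gt// ft.
  apply: (ae_imp _ vhE) => t vt tT; rewrite -vt//.
  by apply: (volterra_solution_unique sfs ifs vhV uV); exact: itv_oo.
pose g t := fs t - B t (u t).
have sg : simple_limit g by exact: volterra_rhs_simple_limit.
have cB := B_continuous cu.
split.
- split; first exact: (simple_limit_strongly_measurable (continuous_simple_limit cu)).
  by apply: (integrable_lty mI (L2_continuous _ cu)).
- exists g; split.
  + split; first exact: simple_limit_strongly_measurable.
    have i2 : leb.-integrable `]0, T[
        (EFin \o (fun t => 2 * (`|fs t| ^+ 2 + `|B t (u t)| ^+ 2))).
      exact: (integrableZl mI 2 (integrableD mI ifs2 (L2_continuous _ cB))).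
    apply: (integrable_lty mI (f := EFin \o (fun t => `|g t| ^+ 2))).
    apply: (le_integrable mI _ _ i2).
      apply/measurable_EFinP; apply: measurable_funTS; apply: measurable_funX.
      exact: simple_limit_norm.
    move=> t _ /=; rewrite lee_fin !ger0_norm ?mulr_ge0 ?addr_ge0 ?sqr_ge0//.
    apply: (@le_trans _ _ ((`|fs t| + `|B t (u t)|) ^+ 2)).
      by rewrite lerXn2r ?nnegrE ?addr_ge0// ler_normB.
    have := sqr_ge0 (`|fs t| - `|B t (u t)|); nra.
  + exact: (volterra_weak_derivative sfs ifs uV).
  + apply: (ae_imp _ ffs) => t ft tT.
    by rewrite /g /B clamp_id ?itv_oo// subrK ft.
- exists u; split; [exact: continuous_subspaceT|exact: aeW|].
  apply: (pairing_inj HL) => w; rewrite uE ?in_itv/= ?lexx ?ltW//.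
  by rewrite set_itv1 Rintegral_set1 addr0.
Qed.

End evolution.

(** * Continuity of the elasticity operators *)

Section nemytskii.
Context d (S : measurableType d) (R : realType) (mu : {measure set S -> \bar R}).
Implicit Types (f g h a e : S -> R) (q : R).

Local Notation "''N_' q [ f ]" := (Lnorm mu q%:E (EFin \o f)).

Lemma LnormE q f : 'N_q[f] = ((\int[mu]_x (`|f x| `^ q)%:E) `^ q^-1)%E.
Proof. by rewrite unlock. Qed.

Lemma measurable_norm_powR q f : measurable_fun setT f ->
  measurable_fun setT (fun x => (`|f x| `^ q)%:E).
Proof.
move=> mf; apply/measurable_EFinP; apply: (measurableT_comp (measurable_powR _)).
exact: measurableT_comp.
Qed.

Lemma Lnorm_le q f (c : R) : 0 < q -> 0 <= c ->
  (\int[mu]_x (`|f x| `^ q)%:E <= (c `^ q)%:E)%E -> ('N_q[f] <= c%:E)%E.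
Proof.
move=> q0 c0 fc; rewrite LnormE.
have -> : c%:E = ((c `^ q)%:E `^ q^-1)%E.
  by rewrite poweR_EFin -powRrM divff ?gt_eqF// powRr1.
apply: gt0_ler_poweR => //; first by rewrite invr_ge0 ltW.
- by rewrite in_itv/= leey andbT integral_ge0.
- by rewrite in_itv/= leey andbT lee_fin powR_ge0.
Qed.

Lemma Lnorm_lty q f : 0 < q ->
  ('N_q[f] < +oo)%E <-> (\int[mu]_x (`|f x| `^ q)%:E < +oo)%E.
Proof.
move=> q0; split=> foo; last by rewrite LnormE poweR_lty.
have := poweR_Lnorm mu (EFin \o f) (lt0r_neq0 q0).
by move=> /= <-; rewrite poweR_lty.
Qed.

Lemma Lnorm_mul_lty q a g (c : R) : 0 < q -> 0 <= c ->
  measurable_fun setT a -> measurable_fun setT g -> (forall x, `|a x| <= c) ->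
  ('N_q[g] < +oo)%E -> ('N_q[(a \* g)%R] < +oo)%E.
Proof.
move=> q0 c0 ma mg ac goo'; have goo := (Lnorm_lty g q0).1 goo'.
apply: (Lnorm_lty _ q0).2.
apply: (@le_lt_trans _ _ (\int[mu]_x ((c `^ q)%:E * (`|g x| `^ q)%:E))%E).
  apply: ge0_le_integral => //.
  - by apply: measurable_norm_powR; exact: measurable_funM.
  - by apply: measurable_funeM; exact: measurable_norm_powR.
  - move=> x _; rewrite -EFinM lee_fin normrM powRM// ler_wpM2r ?powR_ge0//.
    by apply: ge0_ler_powR; rewrite ?nnegrE ?(ltW q0).
rewrite ge0_integralZl_EFin ?powR_ge0//; last exact: measurable_norm_powR.
by rewrite lte_mul_pinfty// lee_fin powR_ge0.
Qed.

Lemma hoelder_Rintegral q (q' : R) f h : 0 < q -> 0 < q' -> q^-1 + q'^-1 = 1 ->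
  measurable_fun setT f -> measurable_fun setT h ->
  ('N_q[f] < +oo)%E -> ('N_q'[h] < +oo)%E ->
  mu.-integrable setT (EFin \o (fun x => f x * h x)) /\
  `|\int[mu]_x (f x * h x)| <= fine 'N_q[f] * fine 'N_q'[h].
Proof.
move=> q0 q'0 qq' mf mh foo hoo.
have := hoelder mu mf mh q0 q'0 qq'; rewrite Lnorm1 => H.
have fin1 : 'N_q[f] \is a fin_num by rewrite ge0_fin_numE ?Lnorm_ge0.
have fin2 : 'N_q'[h] \is a fin_num by rewrite ge0_fin_numE ?Lnorm_ge0.
have ifh : mu.-integrable setT (EFin \o (fun x => f x * h x)).
  apply/integrableP; split; first exact/measurable_EFinP/measurable_funM.
  by apply: (le_lt_trans H); rewrite lte_mul_pinfty ?Lnorm_ge0.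
split=> //; apply: (le_trans (le_normr_Rintegral measurableT ifh)).
rewrite -lee_fin EFinM !fineK//.
exact: (integrable_fin_num measurableT (integrable_abse ifh)).
Qed.

(** Dominated convergence: at each point the indicator vanishes once [k] exceeds [|g x|], and
    [|g| ^ q] dominates. *)
Lemma Lnorm_tail q g (e : R) : 0 < q -> measurable_fun setT g ->
  ('N_q[g] < +oo)%E -> 0 < e ->
  exists k : nat, (\int[mu]_x ((`|g x| `^ q) * \1_[set x | k%:R < `|g x|]%R x)%:E
    <= e%:E)%E.
Proof.
move=> q0 mg goo' e0; have goo := (Lnorm_lty g q0).1 goo'.
pose F k x := ((`|g x| `^ q) * \1_[set x | k%:R < `|g x|] x)%:E.
have mgq := measurable_norm_powR q mg.
have ig : mu.-integrable setT (fun x => (`|g x| `^ q)%:E).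
  apply/integrableP; split => //; apply: le_lt_trans goo.
  rewrite le_eqVlt; apply/orP; left; apply/eqP; apply: eq_integral => x _ /=.
  by rewrite ger0_norm ?powR_ge0.
have mF k : measurable_fun setT (F k).
  apply/measurable_EFinP; apply: measurable_funM; first exact/measurable_EFinP.
  apply: measurable_indic; rewrite -[X in measurable X]setTI.
  have mn : measurable_fun setT (fun x => `|g x|) by exact: measurableT_comp.
  rewrite (_ : [set x | _] = (fun x => `|g x|) @^-1` `]k%:R, +oo[); first exact: mn.
  by apply/seteqP; split=> x /=; rewrite in_itv/= andbT.
have F0 : (\int[mu]_x F k x)%E @[k --> \oo] --> (\int[mu]_x (cst 0%E : S -> \bar R) x)%E.
  apply: (@dominated_cvg _ _ _ mu _ measurableT F (cst 0%E)
    (fun x => (`|g x| `^ q)%:E)) => //.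
  - move=> x _; apply: cvg_near_cst.
    exists (Num.bound `|g x|) => // k /= kg.
    rewrite /F indicE memNset ?mulr0//=; apply/negP; rewrite -leNgt.
    rewrite (le_trans (ltW (archi_boundP _)))// ler_nat//.
  - move=> k x _; rewrite /F/= lee_fin normrM ger0_norm ?powR_ge0//.
    by rewrite ler_piMr ?powR_ge0// indicE; case: (_ \in _); rewrite ?normr1 ?normr0.
rewrite integral0 in F0.
have /fine_cvgP[_ F0'] := F0.
have [k _ kP] := @cvgr_dist_le R R _ _ _ _ _ F0' _ e0.
exists k; have := kP k (leqnn k); rewrite /= sub0r normrN.
have Ffin : (\int[mu]_x F k x)%E \is a fin_num.
  apply: integrable_fin_num => //; apply: le_integrable ig => // x _.
  rewrite /F/= lee_fin normrM ler_piMr// indicE.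
  by case: (_ \in _); rewrite ?normr1 ?normr0.
move=> /(le_trans (ler_norm _)) h.
by rewrite -(fineK Ffin) lee_fin.
Qed.

(* With [|a| <= c] and [|a| <= l |e|], the factor [a] is small in measure when [e] is
   small in L^2: where [|g| <= k] one has [|a g|^q <= k^q c^(q-2) l^2 e^2] (this
   uses [q >= 2]), and elsewhere [|a g|^q <= c^q |g|^q] has a small integral. *)
Lemma Lnorm_mul_small q g (c l eps : R) : 2 <= q -> 0 < c -> 0 < l ->
  measurable_fun setT g -> ('N_q[g] < +oo)%E -> 0 < eps ->
  exists2 delta : R, 0 < delta & forall a e,
    measurable_fun setT a -> measurable_fun setT e ->
    (forall x, `|a x| <= c) -> {ae mu, forall x, `|a x| <= l * `|e x|} ->
    ('N_2[e] <= delta%:E)%E -> ('N_q[(a \* g)%R] <= eps%:E)%E.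
Proof.
move=> q2 c0 l0 mg goo eps0.
have q0 : 0 < q by exact: lt_le_trans q2.
have qn0 : q != 0 by rewrite gt_eqF.
pose eta := eps `^ q / 2.
have eta0 : 0 < eta by rewrite divr_gt0// powR_gt0.
have cq0 : 0 < c `^ q by rewrite powR_gt0.
have [k kP] := Lnorm_tail q0 mg goo (divr_gt0 eta0 cq0).
(* [b] is the factor of [e ^ 2] where [|g| <= k]; [k.+1] in place of [k] keeps it positive when
   [k = 0]. The radius [sqrt (eta / b)] makes this part at most [eta], half of [eps ^ q]. *)
pose b := k.+1%:R `^ q * c `^ (q - 2) * l ^+ 2.
have b0 : 0 < b by rewrite !mulr_gt0 ?powR_gt0 ?exprn_gt0.
have d0 : 0 < Num.sqrt (eta / b) by rewrite sqrtr_gt0 divr_gt0.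
exists (Num.sqrt (eta / b)) => // a e ma me ac ae eP.
apply: Lnorm_le => //; first exact: ltW.
have e2 : (\int[mu]_x (e x ^+ 2)%:E <= (eta / b)%:E)%E.
  have := poweR_Lnorm mu (EFin \o e) (lt0r_neq0 (ltr0n R 2)).
  rewrite (eq_integral (fun x => (e x ^+ 2)%:E)); last first.
    by move=> x _ /=; rewrite powR_mulrn// real_normK// num_real.
  move=> <-.
  have -> : (eta / b)%:E = ((Num.sqrt (eta / b))%:E `^ 2)%E.
    by rewrite poweR_EFin powR_mulrn ?sqrtr_ge0// sqr_sqrtr// divr_ge0// ltW.
  apply: gt0_ler_poweR => //.
  - by rewrite in_itv/= leey andbT Lnorm_ge0.
  - by rewrite in_itv/= leey andbT lee_fin sqrtr_ge0.
have mag : measurable_fun setT (a \* g) by exact: measurable_funM.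
pose tail x := (`|g x| `^ q) * \1_[set x | k%:R < `|g x|] x.
have mtail : measurable_fun setT tail.
  apply: measurable_funM; first exact/measurable_EFinP/measurable_norm_powR.
  apply: measurable_indic; rewrite -[X in measurable X]setTI.
  have mn : measurable_fun setT (fun x => `|g x|) by exact: measurableT_comp.
  rewrite (_ : [set x | _] = (fun x => `|g x|) @^-1` `]k%:R, +oo[); first exact: mn.
  by apply/seteqP; split=> x /=; rewrite in_itv/= andbT.
have tail0 x : 0 <= tail x by rewrite mulr_ge0 ?powR_ge0// indicE.
apply: (@le_trans _ _ (\int[mu]_x (b%:E * (e x ^+ 2)%:E +
    (c `^ q)%:E * (tail x)%:E))%E).
  apply: le_ae_integral => //.
  - exact: measurable_norm_powR.
  - by move=> x _; rewrite adde_ge0// -EFinM lee_fin mulr_ge0 ?sqr_ge0// ltW.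
  - apply: (ae_imp _ ae) => x aex _.
    rewrite -!EFinM -EFinD lee_fin /= normrM powRM//.
    have [gk|gk] := leP `|g x| k%:R; last first.
      rewrite /tail indicE mem_set// mulr1 ler_wpDl//.
        by rewrite mulr_ge0 ?sqr_ge0// ltW.
      rewrite ler_wpM2r ?powR_ge0//.
      by apply: ge0_ler_powR; rewrite ?nnegrE ?(ltW q0)// ltW.
    apply: ler_wpDr; first by rewrite mulr_ge0// ltW.
    have -> : `|a x| `^ q = `|a x| `^ (q - 2) * `|a x| ^+ 2.
      have [->|ax0] := eqVneq (a x) 0.
        by rewrite normr0 powR0// expr0n mulr0.
      rewrite -powR_mulrn// -powRD ?subrK//.
      by rewrite normr_eq0 ax0 implybT.
    apply: (@le_trans _ _ (c `^ (q - 2) * (l * `|e x|) ^+ 2 * k.+1%:R `^ q)).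
      apply: ler_pM; rewrite ?powR_ge0 ?mulr_ge0 ?powR_ge0 ?exprn_ge0//.
        apply: ler_pM; rewrite ?powR_ge0 ?exprn_ge0//.
          by apply: ge0_ler_powR; rewrite ?nnegrE ?subr_ge0// ltW.
        by rewrite lerXn2r ?nnegrE// mulr_ge0// ltW.
      apply: ge0_ler_powR; rewrite ?nnegrE ?(ltW q0)//.
      by rewrite (le_trans gk)// ler_nat.
    rewrite exprMn real_normK ?num_real// /b le_eqVlt; apply/orP; left.
    by apply/eqP; ring.
rewrite ge0_integralD//; last 4 first.
- by move=> x _; rewrite -EFinM lee_fin mulr_ge0 ?sqr_ge0// ltW.
- by apply: measurable_funeM; apply/measurable_EFinP; exact: measurable_funX.
- by move=> x _; rewrite -EFinM lee_fin mulr_ge0// ltW.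
- by apply: measurable_funeM; exact/measurable_EFinP.
rewrite ge0_integralZl_EFin ?(ltW b0)//; last 2 first.
- by move=> x _; rewrite lee_fin sqr_ge0.
- by apply/measurable_EFinP; exact: measurable_funX.
rewrite ge0_integralZl_EFin ?(ltW cq0)//; last 2 first.
- by move=> x _; rewrite lee_fin.
- exact/measurable_EFinP.
have -> : (eps `^ q)%:E = (b%:E * (eta / b)%:E + (c `^ q)%:E * (eta / c `^ q)%:E)%E.
  rewrite -!EFinM -EFinD; congr EFin; rewrite /eta.
  by field; rewrite !gt_eqF.
by apply: leeD; apply: lee_pmul => //; rewrite ?lee_fin ?(ltW b0) ?(ltW cq0)//;
  apply: integral_ge0 => x _; rewrite lee_fin ?sqr_ge0.
Qed.

End nemytskii.

Lemma finite_radius (R : realType) (I : finType) (P : I -> R -> Prop) :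
  (forall i d1 d2, d1 <= d2 -> P i d2 -> P i d1) ->
  (forall i, exists2 d, 0 < d & P i d) -> exists2 d, 0 < d & forall i, P i d.
Proof.
move=> monoP exP.
have /choice[r rP] i : exists d, 0 < d /\ P i d.
  by have [d d0 Pd] := exP i; exists d.
exists (\big[Num.min/1]_i r i).
  by apply: lt_bigmin => // i _; exact: (rP i).1.
by move=> i; apply: monoP (rP i).2; exact: bigmin_le_cond.
Qed.

(** * The elasticity tensor in coordinates *)

Section stiffness_coefficients.
Context (R : realType) (n : nat).
Implicit Types (C : R -> 'M[R]_n -> 'M[R]_n) (p r : 'I_n * 'I_n).

(** Indexed by all ordered pairs, these are not a basis in general, but the symmetric part of [G]
    expands in them with the entries of [G] themselves as coefficients. *)
Definition sym_delta p : 'M[R]_n :=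
  2^-1 *: (delta_mx p.1 p.2 + delta_mx p.2 p.1).

Lemma symm_sym_delta p : symm (sym_delta p).
Proof. by rewrite /symm /sym_delta linearZ/= linearD/= !trmx_delta addrC. Qed.

Lemma sym_part_sum (G : 'M[R]_n) :
  2^-1 *: (G + G^T) = \sum_p G p.1 p.2 *: sym_delta p.
Proof.
apply/matrixP => i j; rewrite !mxE summxE.
under eq_bigr do rewrite !mxE.
rewrite -(pair_bigA _ (fun a b => G a b * (2^-1 *
  (((i == a) && (j == b))%:R + ((i == b) && (j == a))%:R)))) /=.
under eq_bigr do under eq_bigr do rewrite mulrDr mulrDr.
under eq_bigr do rewrite big_split/=.
rewrite big_split/= mulrDr; congr (_ + _).
  rewrite (bigD1 i)//= (bigD1 j)//= !eqxx mulr1 mulrC.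
  rewrite big1 ?addr0 => [|b /negbTE bj]; last by rewrite eq_sym bj !mulr0.
  by rewrite big1 ?addr0// => a /negbTE ai; rewrite big1// => b _;
    rewrite eq_sym ai !mulr0.
rewrite (bigD1 j)//= (bigD1 i)//= !eqxx mulr1 mulrC.
rewrite big1 ?addr0 => [|b /negbTE bj]; last by rewrite eq_sym bj !mulr0.
by rewrite big1 ?addr0// => a /negbTE ai; rewrite big1// => b _;
  rewrite [j == a]eq_sym ai andbF !mulr0.
Qed.

Lemma ddotDl (A1 A2 A3 : 'M[R]_n) : ddot (A1 + A2) A3 = ddot A1 A3 + ddot A2 A3.
Proof.
rewrite /ddot -big_split; apply: eq_bigr => i _; rewrite -big_split.
by apply: eq_bigr => j _; rewrite mxE mulrDl.
Qed.

Lemma ddotZl (a : R) (A1 A2 : 'M[R]_n) : ddot (a *: A1) A2 = a * ddot A1 A2.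
Proof.
rewrite /ddot mulr_sumr; apply: eq_bigr => i _; rewrite mulr_sumr.
by apply: eq_bigr => j _; rewrite mxE mulrA.
Qed.

Lemma ddotC (A1 A2 : 'M[R]_n) : ddot A1 A2 = ddot A2 A1.
Proof. by apply: eq_bigr => i _; apply: eq_bigr => j _; rewrite mulrC. Qed.

Lemma ddot0l (A1 : 'M[R]_n) : ddot 0 A1 = 0.
Proof. by rewrite -(scale0r 0) ddotZl mul0r. Qed.

Lemma ddot_suml (I : Type) (s : seq I) (F : I -> 'M[R]_n) A1 :
  ddot (\sum_(i <- s) F i) A1 = \sum_(i <- s) ddot (F i) A1.
Proof.
by apply: (big_morph (fun A => ddot A A1)); [move=> *; exact: ddotDl|exact: ddot0l].
Qed.

Lemma sym_op0 (F : 'M[R]_n -> 'M[R]_n) : sym_op F -> F 0 = 0.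
Proof.
move=> [_ linF]; have s0 : symm (0 : 'M[R]_n) by rewrite /symm trmx0.
have := linF (-1) 0 0 s0 s0; rewrite scaler0 addr0 scaleN1r.
by rewrite addNr.
Qed.

Lemma sym_op_sum (I : Type) (s : seq I) (F : 'M[R]_n -> 'M[R]_n) (c : I -> R)
    (G : I -> 'M[R]_n) : sym_op F -> (forall i, symm (G i)) ->
  F (\sum_(i <- s) c i *: G i) = \sum_(i <- s) c i *: F (G i).
Proof.
move=> oF sG.
suff [_ ->//] : symm (\sum_(i <- s) c i *: G i) /\
  F (\sum_(i <- s) c i *: G i) = \sum_(i <- s) c i *: F (G i).
elim: s => [|i s [IHs IHF]]; first by rewrite !big_nil /symm trmx0 (sym_op0 oF).
rewrite !big_cons; split; last by rewrite oF.2// IHF.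
by rewrite /symm linearD/= linearZ/= (sG i) IHs.
Qed.

Definition stiffness_coef C p r (s : R) : R := ddot (C s (sym_delta p)) (sym_delta r).

(** Reduces the integrand of the elastic form to finitely many products of a scalar coefficient and
    two gradient entries, so that the estimates concern real functions only. *)
Lemma ddot_sym_part C (s : R) (G H : 'M[R]_n) : sym_op (C s) ->
  ddot (C s (2^-1 *: (G + G^T))) (2^-1 *: (H + H^T)) =
  \sum_p \sum_r stiffness_coef C p r s * G p.1 p.2 * H r.1 r.2.
Proof.
move=> oC; rewrite !sym_part_sum sym_op_sum//; last exact: symm_sym_delta.
rewrite ddot_suml; apply: eq_bigr => p _.
rewrite ddotC ddot_suml; apply: eq_bigr => r _.
by rewrite ddotZl ddotC ddotZl /stiffness_coef; ring.
Qed.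

Lemma frob_ge_entry (A : 'M[R]_n) i j : `|A i j| <= frob A.
Proof.
rewrite -sqrtr_sqr /frob ler_sqrt ?sqr_ge0//; last first.
  by apply: sumr_ge0 => a _; apply: sumr_ge0 => b _; rewrite -expr2 sqr_ge0.
rewrite /ddot (bigD1 i)//= (bigD1 j)//= -expr2 -addrA lerDl addr_ge0//.
  by apply: sumr_ge0 => a _; rewrite -expr2 sqr_ge0.
by apply: sumr_ge0 => a _; apply: sumr_ge0 => b _; rewrite -expr2 sqr_ge0.
Qed.

Lemma ddot_le (A1 A2 : 'M[R]_n) :
  `|ddot A1 A2| <= frob A1 * \sum_i \sum_j `|A2 i j|.
Proof.
rewrite /ddot mulr_sumr (le_trans (ler_norm_sum _ _ _))//.
apply: ler_sum => i _; rewrite mulr_sumr (le_trans (ler_norm_sum _ _ _))//.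
by apply: ler_sum => j _; rewrite normrM ler_wpM2r// frob_ge_entry.
Qed.

Lemma stiffness_coef_bounded_lipschitz C p r : bounded_op C -> lipschitz_op C ->
  exists c l : R, [/\ 0 < c, 0 < l, forall s, `|stiffness_coef C p r s| <= c &
    forall s t, `|stiffness_coef C p r s - stiffness_coef C p r t| <= l * `|s - t|].
Proof.
move=> [c cP] [l lP].
pose D := frob (sym_delta p); pose E := \sum_i \sum_j `|sym_delta r i j|.
have D0 : 0 <= D by exact: sqrtr_ge0.
have E0 : 0 <= E by apply: sumr_ge0 => i _; exact: sumr_ge0.
have sp := symm_sym_delta p.
exists (`|c| * D * E + 1), (`|l| * D * E + 1); split.
- by rewrite ltr_wpDl// !mulr_ge0.
- by rewrite ltr_wpDl// !mulr_ge0.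
- move=> s; rewrite (le_trans (ddot_le _ _))// ler_wpDr//.
  by rewrite -/E ler_wpM2r// (le_trans (cP s _ sp))// ler_wpM2r// ler_norm.
- move=> s t; rewrite /stiffness_coef -mulN1r -ddotZl -ddotDl scaleN1r.
  rewrite (le_trans (ddot_le _ _))// -/E.
  apply: (@le_trans _ _ (`|l| * `|s - t| * D * E)).
    by rewrite ler_wpM2r// (le_trans (lP s t _ sp))// -/D !ler_wpM2r// ler_norm.
  have := normr_ge0 (s - t); set a := `|s - t| => a0.
  have -> : `|l| * a * D * E = (`|l| * D * E) * a by ring.
  by rewrite ler_wpM2r// lerDl.
Qed.

End stiffness_coefficients.

Section Lq_facts.
Context d (S : measurableType d) (R : realType) (mu : {measure set S -> \bar R}).
Variables (q : R) (q1 : 1 <= q).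

Lemma Lq_fun_measurable (g : Lq mu q1) : measurable_fun setT (Lq_fun g).
Proof. exact: measurable_funPT. Qed.

Lemma Lq_normE (g : Lq mu q1) : (`|g|%:E = 'N[mu]_(q%:E)[EFin \o Lq_fun g])%E.
Proof. exact: finite_norm_fine. Qed.

Lemma Lq_lty (g : Lq mu q1) : ('N[mu]_(q%:E)[EFin \o Lq_fun g] < +oo)%E.
Proof. by rewrite -Lq_normE ltry. Qed.

Lemma Lq_funB (g h : Lq mu q1) :
  {ae mu, forall x, Lq_fun (g - h) x = Lq_fun g x - Lq_fun h x}.
Proof.
have := Lq_fun_linear (-1) h g.
rewrite scaleN1r addrC; apply: filterS => x ->.
by rewrite mulN1r addrC.
Qed.

End Lq_facts.

Lemma fpow_coord_le (R : realType) (I : finType) (X : normedModType R)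
    (x : fpow I X) i : `|fpow_coord x i| <= `|x|.
Proof.
have -> : `|x| = fpow_norm x by [].
rewrite /fpow_norm (bigD1 i)//= lerDl.
exact: sumr_ge0.
Qed.

(** * The elastic form on Sobolev functions *)

Section elastic_form.
Context (R : realType) (n : nat) (Omega GammaD : set 'rV[R]_n).
Context (oOmega : open Omega).
Local Notation mu := (leb_on oOmega).
Local Notation W q1 := (W1q_GammaD_vec GammaD oOmega q1).

Definition grad_coord (q : R) (q1 : 1 <= q) (v : W q1) (p : 'I_n * 'I_n) : Lq mu q1 :=
  fpow_coord (W1q_GammaD_val (fpow_coord v p.1)) (Some p.2).

Lemma grad_coord_le (q : R) (q1 : 1 <= q) (v : W q1) p : `|grad_coord v p| <= `|v|.
Proof.
apply: le_trans (fpow_coord_le v p.1).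
exact: (fpow_coord_le (W1q_GammaD_val (fpow_coord v p.1)) (Some p.2)).
Qed.

Variables (C : R -> 'M[R]_n -> 'M[R]_n) (q q' : R) (q1 : 1 <= q) (q'1 : 1 <= q').
Hypotheses (Csym : forall s, sym_op (C s)) (Cb : bounded_op C) (Cl : lipschitz_op C).
Hypothesis qq' : q^-1 + q'^-1 = 1.

Let q0 : 0 < q. Proof. exact: lt_le_trans q1. Qed.
Let q'0 : 0 < q'. Proof. exact: lt_le_trans q'1. Qed.

Let coef_measurable p r (phi : L2 oOmega) :
  measurable_fun setT (fun x => stiffness_coef C p r (Lq_fun phi x)).
Proof.
have [c [l [_ _ _ lip]]] := stiffness_coef_bounded_lipschitz p r Cb Cl.
apply: (@measurableT_comp _ _ _ _ _ _ (stiffness_coef C p r)).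
  by apply: continuous_measurable_fun; exact: lipschitz_continuous lip.
exact: Lq_fun_measurable.
Qed.

Let term_integrable p r (phi : L2 oOmega) (v : W q1) (w : W q'1) :
  mu.-integrable setT (EFin \o (fun x => stiffness_coef C p r (Lq_fun phi x) *
    Lq_fun (grad_coord v p) x * Lq_fun (grad_coord w r) x)).
Proof.
have [c [l [c0 _ cP _]]] := stiffness_coef_bounded_lipschitz p r Cb Cl.
have mg := Lq_fun_measurable (grad_coord v p).
have mh := Lq_fun_measurable (grad_coord w r).
have ma := coef_measurable p r phi.
apply: (hoelder_Rintegral q0 q'0 qq' (measurable_funM ma mg) mh _ (Lq_lty _)).1.
exact: (Lnorm_mul_lty q0 (ltW c0) ma mg (fun x => cP _) (Lq_lty _)).
Qed.

(** Each term is integrable by Hoelder's inequality with the conjugate exponents, which permits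
    exchanging sums and integral. *)
Lemma elastic_opE (phi : L2 oOmega) (v : W q1) (w : W q'1) :
  elastic_op GammaD oOmega C q1 q'1 phi v w =
  \sum_p \sum_r \int[mu]_x (stiffness_coef C p r (Lq_fun phi x) *
    Lq_fun (grad_coord v p) x * Lq_fun (grad_coord w r) x).
Proof.
rewrite /elastic_op.
under eq_Rintegral => x _.
  rewrite /strain ddot_sym_part//.
  under eq_bigr do under eq_bigr do rewrite !mxE.
  over.
pose F p r x := stiffness_coef C p r (Lq_fun phi x) *
    Lq_fun (grad_coord v p) x * Lq_fun (grad_coord w r) x.
have iF p r : mu.-integrable setT (EFin \o F p r) by exact: term_integrable.
have iFs p : mu.-integrable setT (fun x => \sum_r (EFin \o F p r) x)%E.
  exact: integrable_sum.
transitivity (fine (\int[mu]_x (\sum_p \sum_r (EFin \o F p r) x))%E).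
  congr fine; apply: eq_integral => x _; rewrite -sumEFin.
  by apply: eq_bigr => p _; rewrite -sumEFin.
rewrite (integral_sum measurableT iFs) -sum_fine; last first.
  by move=> p _; apply: integrable_fin_num.
apply: eq_bigr => p _; rewrite (integral_sum measurableT (iF p)) -sum_fine//.
by move=> r _; apply: integrable_fin_num => //; exact: iF.
Qed.

(** In each term the difference of the coefficients is bounded and controlled by [|phi - phi'|], so
    [Lnorm_mul_small] makes its product with the fixed gradient entry of [v] small in [L^q];
    Hoelder's inequality pairs this with [w]. Thus [delta] may depend on [v] but not on [w]. *)
Lemma elastic_op_continuous (v : W q1) (eps : R) : 2 <= q -> 0 < eps ->
  exists2 delta, 0 < delta & forall phi phi' : L2 oOmega, `|phi - phi'| <= delta ->
    forall w : W q'1,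
    `|elastic_op GammaD oOmega C q1 q'1 phi v w -
      elastic_op GammaD oOmega C q1 q'1 phi' v w|
      <= eps * `|w|.
Proof.
move=> q2 eps0.
(* The [n ^ 4] terms share [eps]; the successor keeps the divisor positive. *)
pose N : R := (#|{: 'I_n * 'I_n}| ^ 2).+1%:R.
have N0 : 0 < N by rewrite ltr0n.
pose P (pr : ('I_n * 'I_n) * ('I_n * 'I_n)) (delta : R) :=
  forall phi phi' : L2 oOmega, `|phi - phi'| <= delta -> forall w : W q'1,
  `|\int[mu]_x (stiffness_coef C pr.1 pr.2 (Lq_fun phi x) *
      Lq_fun (grad_coord v pr.1) x * Lq_fun (grad_coord w pr.2) x) -
    \int[mu]_x (stiffness_coef C pr.1 pr.2 (Lq_fun phi' x) *
      Lq_fun (grad_coord v pr.1) x * Lq_fun (grad_coord w pr.2) x)| <= eps / N * `|w|.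
have [pr d1 d2 d12 Pd2 phi phi' phid|[p r]|delta delta0 Pdelta] := @finite_radius R _ P.
- by apply: Pd2; exact: le_trans d12.
- have [c [l [c0 l0 cP lP]]] := stiffness_coef_bounded_lipschitz p r Cb Cl.
  have mg := Lq_fun_measurable (grad_coord v p).
  have [delta delta0 deltaP] := Lnorm_mul_small q2 (addr_gt0 c0 c0) l0 mg
    (Lq_lty (grad_coord v p)) (divr_gt0 eps0 N0).
  exists delta => // phi phi' phid w /=.
  rewrite -RintegralB//; [|exact: term_integrable..].
  pose a x := stiffness_coef C p r (Lq_fun phi x) -
    stiffness_coef C p r (Lq_fun phi' x).
  have ma : measurable_fun setT a.
    by apply: measurable_funB; exact: coef_measurable.
  have aP := deltaP a (Lq_fun (phi - phi')) ma (Lq_fun_measurable _).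
  have aeps : ('N[mu]_(q%:E)[EFin \o (a \* Lq_fun (grad_coord v p))%R] <=
      (eps / N)%:E)%E.
    apply: aP; [move=> x|..].
    + by rewrite (le_trans (ler_normB _ _))// lerD.
    + by have := Lq_funB phi phi'; apply: filterS => x ->; exact: lP.
    + by rewrite -(Lq_normE (phi - phi')) lee_fin.
  have mh := Lq_fun_measurable (grad_coord w r).
  have [_ Hw] := hoelder_Rintegral q0 q'0 qq' (measurable_funM ma mg) mh
    (le_lt_trans aeps (ltry _)) (Lq_lty _).
  rewrite (_ : \int[mu]_x _ = \int[mu]_x ((a \* Lq_fun (grad_coord v p)) x *
      Lq_fun (grad_coord w r) x)); last first.
    by apply: eq_Rintegral => x _; rewrite /a /=; ring.
  apply: (le_trans Hw); apply: ler_pM; rewrite ?fine_ge0 ?Lnorm_ge0//.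
    rewrite -lee_fin fineK// ge0_fin_numE ?Lnorm_ge0//.
    exact: le_lt_trans aeps (ltry _).
  by rewrite -Lq_normE/= grad_coord_le.
exists delta => // phi phi' phid w.
rewrite !elastic_opE !pair_bigA/= -sumrB (le_trans (ler_norm_sum _ _ _))//.
apply: (@le_trans _ _ (\sum_(pr : ('I_n * 'I_n) * ('I_n * 'I_n)) (eps / N * `|w|))).
  by apply: ler_sum => pr _; exact: Pdelta.
rewrite sumr_const card_prod mulnn -mulr_natl mulrA.
rewrite ler_wpM2r// mulrCA ler_piMr// ?(ltW eps0)//.
by rewrite ler_pdivrMr// mul1r ler_nat.
Qed.

End elastic_form.

(** * Quotients of isomorphisms onto a dual *)

Section duality_facts.
Context (R : realType) (Y : normedModType R).
Implicit Types (F : Y -> R) (c : R).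

Lemma dual_norm_le F c : 0 <= c ->
  (forall w, `|F w| <= c * `|w|) -> (dual_norm F <= c%:E)%E.
Proof.
move=> c0 Fc; apply: ge_ereal_sup => _ [w /= w1 <-].
by rewrite lee_fin (le_trans (Fc w))// ler_piMr.
Qed.

Lemma dual_norm_ge F c : dual F ->
  (dual_norm F <= c%:E)%E -> forall w, `|F w| <= c * `|w|.
Proof.
move=> [linF _] Fc w.
have F0 : F 0 = 0.
  have := linF 1 0 0; rewrite scaler0 addr0 mul1r => /eqP.
  by rewrite addrC -subr_eq subrr eq_sym => /eqP.
have FZ a x : F (a *: x) = a * F x by have := linF a x 0; rewrite !addr0 F0 addr0.
have [->|w0] := eqVneq w 0; first by rewrite F0 !normr0 mulr0.
have nw0 : 0 < `|w| by rewrite normr_gt0.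
rewrite -ler_pdivrMr//.
have -> : `|F w| / `|w| = `|F (`|w|^-1 *: w)|.
  by rewrite FZ normrM normfV normr_id mulrC.
rewrite -lee_fin; apply: le_trans Fc; apply: ereal_sup_ubound.
exists (`|w|^-1 *: w) => //=.
by rewrite normrZ normfV normr_id mulVf ?gt_eqF.
Qed.

(** The common bound [M] has no prescribed sign, whence [|M| + 1]; it serves all [phi] at once. *)
Lemma uniform_iso_pairing (P : Type) (X : normedModType R) (L : P -> X -> Y -> R) :
  uniform_iso_to_dual L -> exists M, forall phi, perfect_pairing M (L phi).
Proof.
move=> [isoL [M MP]]; exists (`|M| + 1) => phi.
have [dL linL ontoL] := isoL phi.
have MM : M <= `|M| + 1 by rewrite (le_trans (ler_norm M))// lerDl.
have M1 : 0 <= `|M| + 1 by rewrite addr_ge0.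
split.
- by rewrite ltr_wpDl.
- by move=> w a u v; exact: linL.
- by move=> v a w1 w2; exact: (dL v).1.
- move=> v w.
  apply: (le_trans (dual_norm_ge (dL v) (MP phi v).1 w)).
  by rewrite ler_wpM2r// ler_wpM2r.
- move=> v c c0 Lc; rewrite -lee_fin.
  apply: (le_trans (MP phi v).2).
  have d0 : (0 <= dual_norm (L phi v))%E.
    apply: ereal_sup_ge; exists (`|L phi v 0|%:E); last by rewrite lee_fin.
    by exists 0 => //=; rewrite normr0.
  apply: (@le_trans _ _ ((`|M| + 1)%:E * dual_norm (L phi v))%E).
    by apply: lee_wpmul2r => //; rewrite lee_fin.
  by rewrite EFinM; apply: lee_wpmul2l; [rewrite lee_fin|exact: dual_norm_le].
- move=> F linF [c Fc].
  have dF : dual F.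
    split; first by move=> a x y; exact: linF.
    apply: (@lipschitz_continuous R Y F c) => x y.
    have -> : F x - F y = F (x - y); last exact: Fc.
    by have := linF (-1) y x; rewrite scaleN1r mulN1r ![- _ + _]addrC => ->.
  by have [v [vF _]] := ontoL F dF; exists v => w; rewrite vF.
Qed.

End duality_facts.

Section iso_quotient.
Context (R : realType) (P X Y : normedModType R) (B E : P -> X -> Y -> R).
Hypotheses (isoB : uniform_iso_to_dual B) (isoE : uniform_iso_to_dual E).

(* [A_op] is the case [B := elastic_op Cnu] and [E := elastic_op C]. *)
Definition iso_quotient (phi : P) (v : X) : X := xget 0 [set w | B phi w = E phi v].
Local Notation A := iso_quotient.

(** The default 0 of [xget] is never taken: [E phi v] lies in the dual of [Y], and [B phi] is onto
    it. *)
Lemma iso_quotientE phi v w : B phi (A phi v) w = E phi v w.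
Proof.
have [_ _ ontoB] := isoB.1 phi; have [dE _ _] := isoE.1 phi.
have [u [uE _]] := ontoB _ (dE v).
have := @xgetPex _ (0 : X) [set w | B phi w = E phi v].
by move=> /(_ (ex_intro _ u uE)) <-.
Qed.

Lemma iso_quotient_linear phi a u v : A phi (a *: u + v) = a *: A phi u + A phi v.
Proof.
have [M MP] := uniform_iso_pairing isoB; have [N NP] := uniform_iso_pairing isoE.
apply: (pairing_inj (MP phi)) => w.
rewrite (pairing_linearl (MP phi)) !iso_quotientE.
exact: (pairing_linearl (NP phi)).
Qed.

Lemma iso_quotient_bounded : exists K, forall phi v, `|A phi v| <= K * `|v|.
Proof.
have [M MP] := uniform_iso_pairing isoB; have [N NP] := uniform_iso_pairing isoE.
exists (M * N) => phi v; rewrite -mulrA.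
apply: (pairing_norming (MP phi)) => [|w].
  by rewrite mulr_ge0// ltW// (pairing_gt0 (NP phi)).
by rewrite iso_quotientE; exact: (pairing_le (NP phi)).
Qed.

(** For each [v] separately, uniform continuity of [phi |-> L phi v] into the dual: [delta] may
    depend on [v] but not on [w]. *)
Definition strongly_continuous (L : P -> X -> Y -> R) : Prop :=
  forall (v : X) (eps : R), 0 < eps ->
  exists2 delta, 0 < delta & forall phi phi' : P, `|phi - phi'| <= delta ->
    forall w, `|L phi v w - L phi' v w| <= eps * `|w|.

(* [B(psi) (A(phi) v - A(psi) v) =
    (E(phi) - E(psi)) v - (B(phi) - B(psi)) (A(phi) v)] *)
Lemma iso_quotient_continuous v :
  strongly_continuous B -> strongly_continuous E -> continuous (A^~ v).
Proof.
move=> cB cE phi.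
have [M MP] := uniform_iso_pairing isoB.
have M0 := pairing_gt0 (MP phi).
apply/cvgrPdist_le => e e0.
have e1 : 0 < e / M / 2 by rewrite !divr_gt0.
have [d1 d10 E1] := cE v _ e1.
(* [A phi v] does not move with [psi], so continuity of [B] on this one vector is enough. *)
have [d2 d20 B1] := cB (A phi v) _ e1.
have d0 : 0 < Num.min d1 d2 by rewrite lt_min d10.
near=> psi.
have : `|phi - psi| <= Num.min d1 d2.
  near: psi; exact: (@cvgr_dist_le R P _ _ _ id phi (@cvg_id _ _) _ d0).
rewrite le_min => /andP[h1 h2].
have -> : e = M * (e / M) by field; rewrite gt_eqF.
apply: (pairing_norming (MP psi)) => [|w]; first by rewrite ltW// divr_gt0.
rewrite (pairingBl (MP psi)) iso_quotientE.
have -> : B psi (A phi v) w - E psi v w =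
    (E phi v w - E psi v w) - (B phi (A phi v) w - B psi (A phi v) w).
  by rewrite iso_quotientE; ring.
rewrite (le_trans (ler_normB _ _))//.
have -> : e / M * `|w| = e / M / 2 * `|w| + e / M / 2 * `|w| by field; rewrite gt_eqF.
by rewrite lerD ?E1 ?B1.
Unshelve. all: by end_near. Qed.

Lemma within_continuous_iso_quotient (D : set R) (phi : R -> P) v :
  strongly_continuous B -> strongly_continuous E ->
  {within D, continuous phi} -> {within D, continuous (fun t => A (phi t) v)}.
Proof.
move=> cB cE cphi t.
apply: (@continuous_comp (subspace D) P X phi (A^~ v)); first exact: cphi.
exact: iso_quotient_continuous.
Qed.

End iso_quotient.

Theorem lemma19 (R : realType)
  (* the dimension is n = m.+1 *)
  (m : nat) (m_le2 : (m <= 2)%N) (T : R) (T_gt0 : 0 < T)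
  (Omega GammaD : set 'rV[R]_m.+1) (oOmega : open Omega)
  (bOmega : bounded_set Omega) (cOmega : connected Omega)
  (C11Omega : C11_domain Omega)
  (GammaD_closed : exists2 F : set 'rV[R]_m.+1,
     closed F & GammaD = F `&` bdry Omega)
  (GammaD_gt0 : (0 < hausdorff m GammaD)%E)
  (groger : groger_regular Omega (bdry Omega `\` GammaD))
  (C Cnu : R -> 'M[R]_m.+1 -> 'M[R]_m.+1)
  (C_stiff : stiffness C) (Cnu_stiff : stiffness Cnu)
  (* the exponent pstar of Herzog, Meyer and Wachsmuth *)
  (pstar : R) (pstar_gt2 : 2 < pstar)
  (HMW : forall (r r' : R) (r1 : 1 <= r) (r'1 : 1 <= r'),
     2 <= r <= pstar -> r^-1 + r'^-1 = 1 ->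
     uniform_iso_to_dual (elastic_op GammaD oOmega Cnu r1 r'1) /\
     uniform_iso_to_dual (elastic_op GammaD oOmega C r1 r'1))
  (q q' : R) (q1 : 1 <= q) (q'1 : 1 <= q') (qq' : q^-1 + q'^-1 = 1)
  (q_range : 2 <= q <= Num.min pstar 3)
  (phi : R -> L2 oOmega) (phi_cont : {within `[0, T], continuous phi})
  (f : R -> W1q_GammaD_vec GammaD oOmega q1) (f_L2 : bochner_L2 T f)
  (u0 : W1q_GammaD_vec GammaD oOmega q1) :
  let solution :=
    cauchy_solution T (fun t => A_op GammaD oOmega Cnu C q1 q'1 (phi t)) f u0 in
  exists u, solution u /\
    forall v, solution v ->
      {ae (@lebesgue_measure R), forall t, t \in `]0, T[ -> v t = u t}.
Proof.
have /andP[q2 qmin] := q_range.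
have qp : 2 <= q <= pstar by rewrite q2 (le_trans qmin)// ge_min lexx.
have [isoB isoE] := HMW q q' q1 q'1 qp qq'.
have [M MP] := uniform_iso_pairing isoB.
have [K KP] := iso_quotient_bounded isoB isoE.
have [symB bB lB _ _] := Cnu_stiff; have [symE bE lE _ _] := C_stiff.
(* The pairing is [B(0)] at all times; any fixed element of [L^2] would do in place of 0. *)
apply: (@cauchy_problem_wellposed R _ _ M _ (MP 0) T _ K) => //.
- by move=> t _ a u v; exact: (iso_quotient_linear isoB isoE).
- by move=> t _ v; exact: KP.
- move=> v.
  apply: (within_continuous_iso_quotient isoB isoE) phi_cont => w eps eps0.
    exact: (elastic_op_continuous q'1 symB bB lB qq' w q2 eps0).
  exact: (elastic_op_continuous q'1 symE bE lE qq' w q2 eps0).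
Qed.
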